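(* Let $P\in\mathbb{R}[x_1,\ldots,x_4]$ be a polynomial of degree $D$ and let $Z=Z(P)\cap B(0,1)$. Let $0<\delta<1$ and define $$\Sigma=\{\ell\in\mathcal{L}\colon|\ell\cap N_\delta(Z)|\ge 1\}.$$ Then for each $\varepsilon>0$, $$\mathcal{E}_\delta\big(\operatorname{Dir}(\Sigma)\big)\lesssim_{D,\varepsilon}\delta^{-2-\varepsilon},$$ i.e. the left side is at most $C_{D,\varepsilon}\,\delta^{-2-\varepsilon}$ for a constant $C_{D,\varepsilon}$ depending only on $D$ and $\varepsilon$.
   Context: $\mathcal{L}$ is the set of lines in $\mathbb{R}^4$. $Z(P)$ is the real zero set of $P$, $B(0,1)$ the unit ball, $N_\delta(X)$ the $\delta$-neighborhood of $X$, and $|\ell\cap X|$ is one-dimensional Lebesgue measure. For a line $\ell$, $\operatorname{Dir}(\ell)$ is the unit vector $v=(v_1,v_2,v_3,v_4)$ parallel to $\ell$ normalized by: $v_1\ge0$; $v_2\ge 0$ if $v_1=0$; $v_3\ge0$ if $v_1=v_2=0$; $v_4=1$ if $v_1=v_2=v_3=0$. $\operatorname{Dir}(\Sigma)=\{\operatorname{Dir}(\ell):\ell\in\Sigma\}$. For a set $E$ of unit vectors, $\mathcal{E}_\delta(E)$ is its $\delta$-covering number. *)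

(* Defs.v *)
From HB Require Import structures.
From mathcomp Require Import all_boot all_order all_algebra.
From mathcomp Require mpoly.
From mathcomp Require Import all_classical all_reals all_analysis.
From mathcomp Require Import ring lra.
Set Implicit Arguments.
Unset Strict Implicit.
Unset Printing Implicit Defensive.
Import Order.TTheory GRing.Theory Num.Theory.
Import numFieldNormedType.Exports.
(* The notations of mpoly clash with those of all_analysis. *)
Import (canonicals, coercions) mpoly.
Local Open Scope classical_set_scope.
Local Open Scope ring_scope.

(* The canonical norm on 'rV[R]_n is the sup norm, hence an explicit Euclidean
   norm. *)
Definition enorm (R : realType) (n : nat) (x : 'rV[R]_n) : R :=
  Num.sqrt (\sum_(i < n) x 0 i ^+ 2).

Definition eball (R : realType) (n : nat) (x : 'rV[R]_n) (r : R) :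
    set 'rV[R]_n :=
  [set y | enorm (y - x) <= r].

Definition neighborhood (R : realType) (n : nat) (delta : R)
    (X : set 'rV[R]_n) : set 'rV[R]_n :=
  \bigcup_(x in X) eball x delta.

(* The infimum over the empty set is +oo, which is the value when E has no
   finite cover. *)
Definition covering_number (R : realType) (n : nat) (delta : R)
    (E : set 'rV[R]_n) : \bar R :=
  ereal_inf [set k%:R%:E | k in
    [set k : nat | exists c : 'I_k -> 'rV[R]_n,
       E `<=` \bigcup_i eball (c i) delta]].

Definition zero_set (R : realType) (n : nat) (P : mpoly.mpoly n R) :
    set 'rV[R]_n :=
  [set x | mpoly.meval (fun i => x 0 i) P = 0].

Definition line_through (R : realType) (n : nat) (p v : 'rV[R]_n) :
    set 'rV[R]_n :=
  range (fun t : R => p + t *: v).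

Definition lines (R : realType) (n : nat) : set (set 'rV[R]_n) :=
  [set l | exists p v, v != 0 /\ l = line_through p v].

Definition is_dir (R : realType) (l : set 'rV[R]_4) (v : 'rV[R]_4) : Prop :=
  [/\ enorm v = 1,
      exists p, l = line_through p v &
  [/\ 0 <= v 0 0,
      v 0 0 = 0 -> 0 <= v 0 1,
      v 0 0 = 0 -> v 0 1 = 0 -> 0 <= v 0 2 &
      v 0 0 = 0 -> v 0 1 = 0 -> v 0 2 = 0 -> v 0 3 = 1]].

(* Exactly one v satisfies is_dir l v when l is a line: see DirP and
   is_dir_uniq below. *)
Definition Dir (R : realType) (l : set 'rV[R]_4) : 'rV[R]_4 :=
  xget 0 (is_dir l).

(* One-dimensional Lebesgue measure on a line l, through the unit speed
   parametrization t |-> p + t * Dir l with p a chosen point of l; by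
   translation invariance the value does not depend on p. *)
Definition line_measure (R : realType) (l A : set 'rV[R]_4) : \bar R :=
  lebesgue_measure [set t : R | A (xget 0 l + t *: Dir l)].

Definition Sigma (R : realType) (delta : R) (Z : set 'rV[R]_4) :
    set (set 'rV[R]_4) :=
  [set l | lines l /\
     (1%:E <= line_measure l (l `&` neighborhood delta Z))%E].

Lemma enormZ (R : realType) (n : nat) (a : R) (x : 'rV[R]_n) :
  enorm (a *: x) = `|a| * enorm x.
Proof.
rewrite /enorm -sqrtr_sqr -sqrtrM ?sqr_ge0// mulr_sumr; congr Num.sqrt.
by apply: eq_bigr => i _; rewrite mxE exprMn.
Qed.

Lemma enorm_gt0 (R : realType) (n : nat) (x : 'rV[R]_n) :
  x != 0 -> 0 < enorm x.
Proof.
move=> x0; rewrite /enorm sqrtr_gt0 lt0r sumr_ge0 ?andbT; last first.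
  by move=> i _; rewrite sqr_ge0.
apply: contra x0 => /eqP /psumr_eq0P x0; apply/eqP/rowP => i; rewrite mxE.
by apply/eqP; rewrite -sqrf_eq0 x0// => j _; rewrite sqr_ge0.
Qed.

Lemma line_throughZ (R : realType) (n : nat) (a : R) (p v : 'rV[R]_n) :
  a != 0 -> line_through p (a *: v) = line_through p v.
Proof.
move=> a0; apply/seteqP; split => _ [t _ <-].
  by exists (t * a) => //; rewrite scalerA.
by exists (t / a) => //; rewrite scalerA divfK.
Qed.

Lemma ord4P (i : 'I_4) : [\/ i = 0, i = 1, i = 2 | i = 3].
Proof.
case: i => [[|[|[|[|//]]]]] h.
- by apply: Or41; apply: val_inj.
- by apply: Or42; apply: val_inj.
- by apply: Or43; apply: val_inj.
- by apply: Or44; apply: val_inj.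
Qed.

Lemma enorm4 (R : realType) (v : 'rV[R]_4) :
  enorm v = Num.sqrt (v 0 0 ^+ 2 + v 0 1 ^+ 2 + v 0 2 ^+ 2 + v 0 3 ^+ 2).
Proof.
rewrite /enorm !big_ord_recr big_ord0 /= add0r.
by congr (Num.sqrt (v 0 _ ^+ 2 + v 0 _ ^+ 2 + v 0 _ ^+ 2 + v 0 _ ^+ 2));
  apply: val_inj.
Qed.

Lemma DirP (R : realType) (l : set 'rV[R]_4) : lines l -> is_dir l (Dir l).
Proof.
move=> [p [v [v0 lE]]].
suff [w lw] : exists w, is_dir l w by exact: xgetI lw.
have v_gt0 := enorm_gt0 v0.
pose u := (enorm v)^-1 *: v.
have u1 : enorm u = 1.
  by rewrite enormZ ger0_norm ?invr_ge0 ?ltW// mulVf ?gt_eqF.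
have lu : l = line_through p u by rewrite lE line_throughZ// invr_eq0 gt_eqF.
have Nu1 : enorm (- u) = 1 by rewrite -scaleN1r enormZ normrN1 mul1r.
have lNu : l = line_through p (- u).
  by rewrite -scaleN1r line_throughZ// oppr_eq0 oner_eq0.
have usq : u 0 0 = 0 -> u 0 1 = 0 -> u 0 2 = 0 -> `|u 0 3| = 1.
  move: u1; rewrite enorm4 => + a b c; rewrite a b c.
  by rewrite expr0n/= !add0r sqrtr_sqr.
have pos : is_dir l u \/ is_dir l (- u);
  last by case: pos; eexists; eassumption.
have sgn (x : R) : [\/ 0 < x, x < 0 | x = 0].
  by case: (ltgtP x 0) => ?; [apply: Or32|apply: Or31|apply: Or33].
have N i : (- u) 0 i = - u 0 i by rewrite mxE.
case: (sgn (u 0 0)) => h0.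
- by left; split=> //; [exists p|split=> *; lra].
- by right; split=> //; [exists p|rewrite !N; split=> *; lra].
case: (sgn (u 0 1)) => h1.
- by left; split=> //; [exists p|split=> *; lra].
- by right; split=> //; [exists p|rewrite !N; split=> *; lra].
case: (sgn (u 0 2)) => h2.
- by left; split=> //; [exists p|split=> *; lra].
- by right; split=> //; [exists p|rewrite !N; split=> *; lra].
have := usq h0 h1 h2; case: (ger0P (u 0 3)) => _ h3.
- by left; split=> //; [exists p|split=> *; lra].
- by right; split=> //; [exists p|rewrite !N; split=> *; lra].
Qed.

Lemma is_dir_uniq (R : realType) (l : set 'rV[R]_4) (v w : 'rV[R]_4) :
  is_dir l v -> is_dir l w -> v = w.
Proof.
move=> [v1 [p lp] [v00 v01 v02 v03]] [w1 [q lq] [w00 w01 w02 w03]].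
have [s _ sE] : line_through q w p.
  by rewrite -lq lp; exists 0 => //; rewrite scale0r addr0.
have [t _ tE] : line_through q w (p + v).
  by rewrite -lq lp; exists 1 => //; rewrite scale1r.
have vE : v = (t - s) *: w.
  rewrite scalerBl -[v](addKr p) -tE -sE; apply/rowP => i.
  by rewrite !mxE; ring.
have : `|t - s| = 1 by rewrite -v1 vE enormZ w1 mulr1.
case: (ger0P (t - s)) => _ a1; first by rewrite vE a1 scale1r.
have {}vE i : v 0 i = - w 0 i.
  by rewrite vE mxE -[t - s]opprK a1 mulN1r.
move: v00 v01 v02 v03; rewrite !vE => v00 v01 v02 v03.
have e0 : w 0 0 = 0 by lra.
have e1 : w 0 1 = 0 by move: (w01 e0) (v01 ltac:(lra)); lra.
have e2 : w 0 2 = 0 by move: (w02 e0 e1) (v02 ltac:(lra) ltac:(lra)); lra.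
by exfalso; move: (w03 e0 e1 e2) (v03 ltac:(lra) ltac:(lra) ltac:(lra)); lra.
Qed.

(* Main.v *)
Require Import Defs.
From mathcomp Require Import all_boot all_order all_algebra.
From mathcomp Require mpoly.
From mathcomp Require Import all_classical all_reals all_analysis.
From mathcomp Require Import ring lra zify.
From mathcomp Require Import perm polyrcf.
From mathcomp Require ordered_qelim qe_rcf.
Set Implicit Arguments.
Unset Strict Implicit.
Unset Printing Implicit Defensive.
Import Order.TTheory GRing.Theory Num.Theory.
Import numFieldNormedType.Exports.
Import (canonicals, coercions) mpoly.
Local Open Scope ring_scope.

(** Proof idea. Let N be the number of cells of a grid of mesh ~ del, in the
    slope coordinates w of the lines x = (a + t w, t), that contain the
    direction of a line of Sigma. Each line has a segment of length >= c(D) in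
    the del-neighborhood of the regular zeros of one fixed derivative of P, and
    the set of such (w, a, t, z), with z a nearby regular zero, is semialgebraic
    of complexity depending on D only. Semialgebraic functions of one variable
    have bounded variation, so definable choice and elimination of the
    coordinates of w one after the other give a point where three tangent
    directions move w by vectors W_1, W_2, W_3 with
    det W >= N del^3 / (C log^3 (1/del)), while a, t, z and (x - z) / del move
    at speed at most 1. For four well separated t in the segment, z moves within
    the tangent hyperplane of a hypersurface, and x = z + O(del); hence
    det (A + t W) = O(del), where A is the motion of a. This is a cubic in t
    with leading coefficient det W, so det W = O(del), that is,
    N = O(del^-2 log^3 (1/del)). *)

(** * Semialgebraic sets *)

(** All constants have to be uniform in [P] and [del]. Therefore [del], the coefficients of the
    polynomial and those of its derivatives are themselves coordinates of one semialgebraic set, and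
    each finiteness bound is a bound over all fibers of that set. The chosen functions are never
    differentiated: bounded variation provides points with arbitrarily short secants of controlled
    slope, and the determinant argument uses nothing else. Passing to a derivative of [P] is forced
    by singular zeros, which have no tangent hyperplane. The error (x - z) / del is kept as a
    coordinate so that x - z changes only by O(del) times the displacement. Moving [t] alone, with
    the line fixed, shows that the normal of the hypersurface is orthogonal to (w, 1) up to O(del);
    this removes the motion of [t] from the determinant and keeps the normal away from the last
    axis. Each elimination trades rows of cells of unequal length for rows of a common length, at
    the price of a harmonic sum: hence the three logarithms, absorbed by del^-eps. *)

Definition upd (T : Type) (e : nat -> T) (k : nat) (x : T) : nat -> T :=
  fun j => if j == k then x else e j.

(** Points are infinite sequences, so that coordinates can be shifted, inserted and grouped in
    blocks freely; by [polyfun_support] and [semialg_support] only finitely many of them matter. *)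
Inductive polyfun (R : realType) : ((nat -> R) -> R) -> Prop :=
| polyfun_var k : polyfun (fun e => e k)
| polyfun_cst c : polyfun (fun=> c)
| polyfun_add f g : polyfun f -> polyfun g -> polyfun (fun e => f e + g e)
| polyfun_opp f : polyfun f -> polyfun (fun e => - f e)
| polyfun_mul f g : polyfun f -> polyfun g -> polyfun (fun e => f e * g e).

(** Quantifiers are not constructors: closure under them is a theorem, so that an induction on
    [semialg] meets only signs of polynomials and Boolean operations. The last constructor admits
    any equivalent description of a set. *)
Inductive semialg (R : realType) : ((nat -> R) -> Prop) -> Prop :=
| semialg_eq0 f : polyfun f -> semialg (fun e => f e = 0)
| semialg_gt0 f : polyfun f -> semialg (fun e => 0 < f e)
| semialg_and X Y : semialg X -> semialg Y -> semialg (fun e => X e /\ Y e)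
| semialg_not X : semialg X -> semialg (fun e => ~ X e)
| semialg_iff X Y : semialg X -> (forall e, X e <-> Y e) -> semialg Y.

Section Semialgebraic.
Variable R : realType.
Implicit Types (e : nat -> R) (f g : (nat -> R) -> R) (X Y : (nat -> R) -> Prop).

Lemma polyfun_subst f (s : (nat -> R) -> nat -> R) :
  (forall k, polyfun (fun e => s e k)) -> polyfun f ->
  polyfun (fun e => f (s e)).
Proof.
move=> ps; elim=> {f}; first exact: ps.
- by move=> c; exact: polyfun_cst.
- by move=> f g _ pf _ pg; exact: polyfun_add.
- by move=> f _ pf; exact: polyfun_opp.
- by move=> f g _ pf _ pg; exact: polyfun_mul.
Qed.

Lemma semialg_subst X (s : (nat -> R) -> nat -> R) :
  (forall k, polyfun (fun e => s e k)) -> semialg X ->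
  semialg (fun e => X (s e)).
Proof.
move=> ps; elim=> {X}.
- by move=> f pf; apply/semialg_eq0/(polyfun_subst ps).
- by move=> f pf; apply/semialg_gt0/(polyfun_subst ps).
- by move=> X Y _ sX _ sY; exact: semialg_and.
- by move=> X _ sX; exact: semialg_not.
- by move=> X Y _ sX XY; apply: semialg_iff sX _ => e; exact: XY.
Qed.

Lemma polyfun_support f : polyfun f ->
  exists n, forall e e', (forall k, (k < n)%N -> e k = e' k) -> f e = f e'.
Proof.
elim=> {f}.
- by move=> k; exists k.+1 => e e'; apply.
- by move=> c; exists 0%N.
- move=> f g _ [n nf] _ [m mg]; exists (maxn n m) => e e' ee'.
  by rewrite (nf e e') ?(mg e e')// => k kn; apply: ee'; rewrite leq_max kn ?orbT.
- by move=> f _ [n nf]; exists n => e e' /nf ->.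
- move=> f g _ [n nf] _ [m mg]; exists (maxn n m) => e e' ee'.
  by rewrite (nf e e') ?(mg e e')// => k kn; apply: ee'; rewrite leq_max kn ?orbT.
Qed.

Lemma semialg_support X : semialg X ->
  exists n, forall e e', (forall k, (k < n)%N -> e k = e' k) -> X e <-> X e'.
Proof.
elim=> {X}.
- by move=> f /polyfun_support[n nf]; exists n => e e' /nf ->.
- by move=> f /polyfun_support[n nf]; exists n => e e' /nf ->.
- move=> X Y _ [n nX] _ [m mY]; exists (maxn n m) => e e' ee'.
  rewrite (nX e e') ?(mY e e')// => k kn; apply: ee'; rewrite leq_max kn ?orbT//.
- by move=> X _ [n nX]; exists n => e e' /nX ->.
- by move=> X Y _ [n nX] XY; exists n => e e' /nX; rewrite !XY.
Qed.

Lemma polyfun_term f : polyfun f ->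
  exists2 t : GRing.term R, GRing.rterm t &
    forall s : seq R, f (nth 0 s) = GRing.eval s t.
Proof.
elim=> {f}.
- by move=> k; exists (GRing.Var _ k).
- by move=> c; exists (GRing.Const c).
- move=> f g _ [t rt ft] _ [u ru gu].
  by exists (GRing.Add t u) => /= [|s]; rewrite ?rt ?ru// ft gu.
- by move=> f _ [t rt ft]; exists (GRing.Opp t) => /= [|s]; rewrite ?rt// ft.
- move=> f g _ [t rt ft] _ [u ru gu].
  by exists (GRing.Mul t u) => /= [|s]; rewrite ?rt ?ru// ft gu.
Qed.

Lemma semialg_formula X : semialg X ->
  exists2 phi : ordered_qelim.ord.formula R, ordered_qelim.ord.rformula phi &
    forall s : seq R, X (nth 0 s) <-> ordered_qelim.ord.holds s phi.
Proof.
elim=> {X}.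
- move=> f /polyfun_term[t rt ft].
  exists (ordered_qelim.ord.Equal t (GRing.Const 0)) => /= [|s].
    by rewrite rt.
  by rewrite ft.
- move=> f /polyfun_term[t rt ft].
  exists (ordered_qelim.ord.Lt (GRing.Const 0) t) => /= [|s].
    by rewrite rt.
  by rewrite ft.
- move=> X Y _ [p rp Xp] _ [q rq Yq].
  by exists (ordered_qelim.ord.And p q) => /= [|s]; rewrite ?rp ?rq// Xp Yq.
- move=> X _ [p rp Xp].
  by exists (ordered_qelim.ord.Not p) => /= [|s]; rewrite ?rp// Xp.
- by move=> X Y _ [p rp Xp] XY; exists p => // s; rewrite -XY.
Qed.

Lemma polyfun_exp f n : polyfun f -> polyfun (fun e => f e ^+ n).
Proof.
move=> pf; elim: n => [|n IH].
  by rewrite (_ : (fun _ => _) = fun=> 1)//; exact: polyfun_cst.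
rewrite (_ : (fun _ => _) = fun e => f e * f e ^+ n); first exact: polyfun_mul.
by apply/funext => e; rewrite exprS.
Qed.

Lemma polyfun_mulrn f n : polyfun f -> polyfun (fun e => f e *+ n).
Proof.
move=> pf; rewrite (_ : (fun _ => _) = fun e => f e * n%:R).
  exact: polyfun_mul pf (polyfun_cst _).
by apply/funext => e; rewrite mulr_natr.
Qed.

Lemma term_polyfun (t : GRing.term R) : GRing.rterm t ->
  exists2 f, polyfun f & forall s : seq R, GRing.eval s t = f (nth 0 s).
Proof.
elim: t => //=.
- by move=> k _; exists (fun e => e k) => //; exact: polyfun_var.
- by move=> c _; exists (fun=> c) => //; exact: polyfun_cst.
- by move=> n _; exists (fun=> n%:R) => //; exact: polyfun_cst.
- move=> t IHt u IHu /andP[/IHt[f pf ft] /IHu[g pg gu]].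
  exists (fun e => f e + g e) => [|s]; last by rewrite ft gu.
  exact: polyfun_add.
- move=> t IHt /IHt[f pf ft].
  by exists (fun e => - f e) => [|s]; [exact: polyfun_opp|rewrite ft].
- move=> t IHt n /IHt[f pf ft].
  by exists (fun e => f e *+ n) => [|s]; [exact: polyfun_mulrn|rewrite ft].
- move=> t IHt u IHu /andP[/IHt[f pf ft] /IHu[g pg gu]].
  exists (fun e => f e * g e) => [|s]; last by rewrite ft gu.
  exact: polyfun_mul.
- move=> t IHt n /IHt[f pf ft].
  by exists (fun e => f e ^+ n) => [|s]; [exact: polyfun_exp|rewrite ft].
Qed.

Lemma polyfun_sub f g : polyfun f -> polyfun g -> polyfun (fun e => f e - g e).
Proof. by move=> pf pg; apply: polyfun_add pf (polyfun_opp pg). Qed.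

Lemma semialg_or X Y : semialg X -> semialg Y -> semialg (fun e => X e \/ Y e).
Proof.
move=> sX sY; apply: (semialg_iff (semialg_not
  (semialg_and (semialg_not sX) (semialg_not sY)))) => e.
by split; [move=> /not_andP[|] /contrapT; [left|right] | move=> [?|?] []].
Qed.

Lemma semialg_imp X Y : semialg X -> semialg Y -> semialg (fun e => X e -> Y e).
Proof.
move=> sX sY; apply: (semialg_iff (semialg_or (semialg_not sX) sY)) => e.
by split; [move=> [|]//|move=> XY; case: (pselect (X e)) => [/XY|]; tauto].
Qed.

Lemma semialg_eq f g : polyfun f -> polyfun g -> semialg (fun e => f e = g e).
Proof.
move=> pf pg; apply: (semialg_iff (semialg_eq0 (polyfun_sub pf pg))) => e.
by split=> [/eqP|->]; [rewrite subr_eq0 => /eqP|rewrite subrr].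
Qed.

Lemma semialg_lt f g : polyfun f -> polyfun g -> semialg (fun e => f e < g e).
Proof.
move=> pf pg; apply: (semialg_iff (semialg_gt0 (polyfun_sub pg pf))) => e.
by rewrite subr_gt0.
Qed.

Lemma semialg_le f g : polyfun f -> polyfun g -> semialg (fun e => f e <= g e).
Proof.
move=> pf pg; apply: (semialg_iff (semialg_not (semialg_lt pg pf))) => e.
by rewrite leNgt; split=> [/negP|/negP].
Qed.

Lemma formula_semialg (phi : ordered_qelim.ord.formula R) :
  ordered_qelim.ord.qf_form phi -> ordered_qelim.ord.rformula phi ->
  exists2 X, semialg X &
    forall s : seq R, ordered_qelim.ord.qf_eval s phi <-> X (nth 0 s).
Proof.
elim: phi => //=.
- move=> b _ _; exists (fun=> b) => //; case: b.
    exact: semialg_iff (semialg_eq0 (polyfun_cst 0)) _.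
  apply: semialg_iff (semialg_not (semialg_eq0 (polyfun_cst 0))) _ => e.
  by split.
- move=> t u _ /andP[/term_polyfun[f pf tf] /term_polyfun[g pg ug]].
  exists (fun e => f e = g e) => [|s]; first exact: semialg_eq.
  by rewrite tf ug; split=> [/eqP|->].
- move=> t u _ /andP[/term_polyfun[f pf tf] /term_polyfun[g pg ug]].
  exists (fun e => f e < g e) => [|s]; first exact: semialg_lt.
  by rewrite tf ug.
- move=> t u _ /andP[/term_polyfun[f pf tf] /term_polyfun[g pg ug]].
  exists (fun e => f e <= g e) => [|s]; first exact: semialg_le.
  by rewrite tf ug.
- move=> p IHp q IHq /andP[qp qq] /andP[/IHp[//|X sX pX] /IHq[//|Y sY qY]].
  exists (fun e => X e /\ Y e) => [|s]; first exact: semialg_and.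
  by rewrite -pX -qY; split=> [/andP[]//|[-> ->]].
- move=> p IHp q IHq /andP[qp qq] /andP[/IHp[//|X sX pX] /IHq[//|Y sY qY]].
  exists (fun e => X e \/ Y e) => [|s]; first exact: semialg_or.
  by rewrite -pX -qY; split=> [/orP[]|[->|->]]//; [left|right|rewrite orbT].
- move=> p IHp q IHq /andP[qp qq] /andP[/IHp[//|X sX pX] /IHq[//|Y sY qY]].
  exists (fun e => X e -> Y e) => [|s]; first exact: semialg_imp.
  by rewrite -pX -qY; split=> [/implyP|/implyP].
- move=> p IHp qp /IHp[//|X sX pX].
  exists (fun e => ~ X e) => [|s]; first exact: semialg_not.
  by rewrite -pX; split=> [/negP|/negP].
Qed.

(** Quantifier elimination over real closed fields. Formulas are evaluated on finite lists, so the
    point is cut to a list that covers the supports of both the given set and the quantifier-free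
    one. *)
Lemma semialg_ex_upd X k :
  semialg X -> semialg (fun e => exists x, X (upd e k x)).
Proof.
move=> sX; have [phi rphi Xphi] := semialg_formula sX.
pose psi := ordered_qelim.ord.Exists k phi.
have rpsi : ordered_qelim.ord.rformula psi by [].
have wfQE := @qe_rcf.wf_QE_wproj R; have okQE := @qe_rcf.valid_QE_wproj R.
have /andP[qtheta rtheta] := ordered_qelim.ord.quantifier_elim_wf wfQE rpsi.
have [Y sY thetaY] := formula_semialg qtheta rtheta.
apply: (semialg_iff sY) => e.
have [n nX] := semialg_support sX; have [m mY] := semialg_support sY.
pose s := mkseq e (maxn n m).
have es j : (j < maxn n m)%N -> e j = nth 0 s j.
  by move=> jn; rewrite nth_mkseq.
rewrite (mY e (nth 0 s)); last first.
  by move=> j jm; apply: es; rewrite leq_max jm orbT.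
have QE := ordered_qelim.ord.quantifier_elim_rformP wfQE okQE s rpsi.
rewrite -thetaY; split=> [/QE/=[x xphi]|[x Xx]].
- exists x; rewrite (nX _ (nth 0 (set_nth 0 s k x))); first by rewrite Xphi.
  move=> j jn; rewrite nth_set_nth /= /upd; case: ifP => // _.
  by apply: es; rewrite leq_max jn.
- apply/QE => /=; exists x; rewrite -Xphi -(nX (upd e k x))//.
  move=> j jn; rewrite nth_set_nth /= /upd; case: ifP => // _.
  by apply: es; rewrite leq_max jn.
Qed.

(** The bound variable is coordinate 0 and the others are shifted, as with de Bruijn indices; in
    this form the tactic [semialg] passes under quantifiers. *)
Lemma semialg_ex (Q : R -> (nat -> R) -> Prop) :
  semialg (fun e => Q (e 0%N) (fun n => e n.+1)) ->
  semialg (fun e => exists x, Q x e).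
Proof.
move=> sQ; have sQ' := semialg_ex_upd 0%N sQ.
pose s (e : nat -> R) n := if n is n'.+1 then e n' else 0.
apply: (semialg_iff (semialg_subst (s := s) _ sQ')) => [[|k]|//] /=.
  exact: polyfun_cst.
exact: polyfun_var.
Qed.

Lemma semialg_forall (Q : R -> (nat -> R) -> Prop) :
  semialg (fun e => Q (e 0%N) (fun n => e n.+1)) ->
  semialg (fun e => forall x, Q x e).
Proof.
move=> sQ; have sN : semialg (fun e => exists x, ~ Q x e).
  by apply: semialg_ex; exact: semialg_not.
apply: (semialg_iff (semialg_not sN)) => e.
by split=> [/forallNP QN x|QN [x]]; [exact: contrapT|apply].
Qed.

(** The order of the quantifiers matters: [d] is fixed before the other coordinates, and this is
    where uniformity in the parameters starts. *)
Lemma polyfun_section f k : polyfun f ->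
  exists d, forall e, exists2 p : {poly R}, (size p <= d)%N &
    forall x, f (upd e k x) = p.[x].
Proof.
elim=> {f}.
- move=> j; exists 2 => e; rewrite /upd; case: (j == k).
    by exists 'X => [|x]; rewrite ?size_polyX// hornerX.
  exists (e j)%:P => [|x]; last by rewrite hornerC.
  by rewrite (leq_trans (size_polyC_leq1 _)).
- move=> c; exists 1 => e.
  by exists c%:P => [|x]; rewrite ?size_polyC_leq1// hornerC.
- move=> f g _ [d fd] _ [d' gd]; exists (maxn d d') => e.
  have [p sp fp] := fd e; have [q sq gq] := gd e.
  exists (p + q) => [|x]; last by rewrite hornerD fp gq.
  by rewrite (leq_trans (size_polyD _ _))// geq_max !leq_max sp sq orbT.
- move=> f _ [d fd]; exists d => e; have [p sp fp] := fd e.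
  by exists (- p) => [|x]; rewrite ?size_polyN// hornerN fp.
- move=> f g _ [d fd] _ [d' gd]; exists (d + d')%N => e.
  have [p sp fp] := fd e; have [q sq gq] := gd e.
  exists (p * q) => [|x]; last by rewrite hornerM fp gq.
  by rewrite (leq_trans (size_polyMleq _ _))// (leq_trans (leq_pred _))// leq_add.
Qed.

Lemma poly_constant_sign (p : {poly R}) :
  exists2 r : seq R, (size r <= size p)%N &
    forall x y, x <= y -> (forall z, z \in r -> ~~ (x <= z <= y)) ->
      ((p.[x] == 0) = (p.[y] == 0)) /\ ((0 < p.[x]) = (0 < p.[y])).
Proof.
have [->|p0] := eqVneq p 0.
  by exists [::] => // x y _ _; rewrite !horner0.
have in_rootsR z : (z \in rootsR p) = root p z.
  by rewrite -(roots_on_rootsR p0) in_itv.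
exists (rootsR p) => [|x y xy nr].
  rewrite ltnW// (max_poly_roots p0) ?uniq_roots//.
  by apply/allP => z; rewrite in_rootsR.
have nroot z : x <= z <= y -> p.[z] != 0.
  move=> xzy; apply/negP => pz; have := nr z.
  by rewrite in_rootsR xzy; move/(_ pz).
have px : p.[x] != 0 by rewrite nroot// lexx.
have py : p.[y] != 0 by rewrite nroot// lexx andbT.
rewrite (negbTE px) (negbTE py); split=> //.
case: (ltP 0 p.[x]) => px0; case: (ltP 0 p.[y]) => py0 //.
- have : (- p).[x] <= 0 <= (- p).[y] by rewrite !hornerN oppr_le0 oppr_ge0 ltW.
  move=> /(poly_ivt xy)[z xzy]; rewrite rootN => pz.
  by have := nroot z xzy; rewrite (rootP pz) eqxx.
- have : p.[x] <= 0 <= p.[y] by rewrite px0 ltW.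
  move=> /(poly_ivt xy)[z xzy] pz.
  by have := nroot z xzy; rewrite (rootP pz) eqxx.
Qed.

(** Uniform finiteness: the breakpoints are roots of the polynomials that describe [X], whose number
    and degrees do not see [e]. Through quantifier elimination this also covers projections. *)
Lemma semialg_tame X k : semialg X ->
  exists M, forall e, exists2 r : seq R, (size r <= M)%N &
    forall x y, x <= y -> (forall z, z \in r -> ~~ (x <= z <= y)) ->
      (X (upd e k x) <-> X (upd e k y)).
Proof.
elim=> {X}.
- move=> f /(polyfun_section k)[d fd]; exists d => e.
  have [p sp fp] := fd e; have [r rp pr] := poly_constant_sign p.
  exists r => [|x y xy /(pr x y xy)[+ _]]; first exact: leq_trans sp.
  by rewrite !fp => E; split=> /eqP h; apply/eqP; move: h; rewrite E.
- move=> f /(polyfun_section k)[d fd]; exists d => e.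
  have [p sp fp] := fd e; have [r rp pr] := poly_constant_sign p.
  exists r => [|x y xy /(pr x y xy)[_ +]]; first exact: leq_trans sp.
  by rewrite !fp => ->.
- move=> X Y _ [M MX] _ [N NY]; exists (M + N)%N => e.
  have [r rM Xr] := MX e; have [s sN Ys] := NY e.
  exists (r ++ s) => [|x y xy nrs]; first by rewrite size_cat leq_add.
  rewrite (Xr x y xy) ?(Ys x y xy)// => z zr; apply: nrs;
  by rewrite mem_cat zr ?orbT.
- move=> X _ [M MX]; exists M => e; have [r rM Xr] := MX e.
  by exists r => // x y xy nr; rewrite (Xr x y xy).
- move=> X Y _ [M MX] XY; exists M => e; have [r rM Xr] := MX e.
  by exists r => // x y xy nr; rewrite -!XY (Xr x y xy).
Qed.

Lemma polyfun_upd f (s : (nat -> R) -> nat -> R) k j :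
  polyfun f -> polyfun (fun e => s e j) -> polyfun (fun e => upd (s e) k (f e) j).
Proof. by rewrite /upd; case: (j == k). Qed.

End Semialgebraic.

Ltac semialg_step := cbv beta; first
  [ assumption
  | exact: polyfun_var | exact: polyfun_cst
  | apply: polyfun_upd | apply: polyfun_add | apply: polyfun_opp
  | apply: polyfun_mul | apply: polyfun_exp | apply: polyfun_mulrn
  | apply: semialg_and | apply: semialg_or | apply: semialg_not
  | apply: semialg_imp
  | apply: semialg_eq | apply: semialg_lt | apply: semialg_le
  | refine (semialg_ex _) | refine (semialg_forall _) ].
Ltac semialg := repeat semialg_step.

(** * Definable choice *)

Definition agree_off (T : Type) (p n : nat) (e e' : nat -> T) :=
  forall k, ~~ (p <= k < p + n)%N -> e' k = e k.

(* A canonical point of a nonempty bounded finite union of intervals: its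
   minimum, or else the midpoint of its leftmost interval. *)
Definition leftmost (R : realType) (S : R -> Prop) (x : R) :=
  S x /\ ((forall y, S y -> x <= y) \/
    exists u b, [/\ u < b, x + x = u + b, forall y, S y -> u < y,
      forall y, u < y -> y < b -> S y &
      forall b', (forall y, u < y -> y < b' -> S y) -> b' <= b]).

(** Equivalently, [S] is a union of points of [r] and of connected components of the complement of
    [r]. *)
Definition tame_off (R : realType) (r : seq R) (S : R -> Prop) :=
  forall x y, x <= y -> (forall z, z \in r -> ~~ (x <= z <= y)) ->
    (S x <-> S y).

Section Choice.
Local Open Scope classical_set_scope.
Local Open Scope ring_scope.
Variable R : realType.
Implicit Types (e : nat -> R) (X Y : (nat -> R) -> Prop) (S : R -> Prop).

Lemma leftmost_uniq S x y : leftmost S x -> leftmost S y -> x = y.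
Proof.
have half (u b v : R) : u < b -> v + v = u + b -> u < v /\ v < b.
  by move=> ub vE; split; lra.
(* A minimum and an open left end exclude each other: the open interval contains points below the
   supposed minimum. *)
have mixed (x1 u b : R) : S x1 -> (forall y, S y -> x1 <= y) -> u < b ->
    (forall y, S y -> u < y) -> (forall y, u < y -> y < b -> S y) -> False.
  move=> Sx1 x1min ub ltu ubS; pose m := Num.min x1 b.
  have um : u < m by rewrite lt_min ub (ltu _ Sx1).
  have [mx1 mb] : m <= x1 /\ m <= b by rewrite !ge_min !lexx orbT.
  have /x1min : S ((u + m) / 2) by apply: ubS; lra.
  lra.
move=> [Sx [xmin|[u [b [ub xE ltu ubS bmax]]]]]
       [Sy [ymin|[v [c [vc yE ltv vcS cmax]]]]].
- by apply/eqP; rewrite eq_le xmin// ymin.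
- by case: (mixed x v c).
- by case: (mixed y u b).
- have uv : u = v.
    have key (u1 b1 v1 : R) : u1 < b1 -> (forall y, u1 < y -> y < b1 -> S y) ->
        (forall y, S y -> v1 < y) -> v1 <= u1.
      move=> ub1 S1 lt1; rewrite leNgt; apply/negP => uv1.
      have [vb|bv] := ltP v1 b1.
        by have := lt1 v1 (S1 _ uv1 vb); rewrite ltxx.
      have /lt1 : S ((u1 + b1) / 2) by apply: S1; lra.
      lra.
    by apply/eqP; rewrite eq_le (key v c u)// (key u b v).
  have bc : b = c.
    by apply/eqP; rewrite eq_le bmax ?cmax// ?uv// -uv.
  by move: xE yE; rewrite uv bc; lra.
Qed.

Lemma leftmost_ex S (r : seq R) (B : R) : tame_off r S ->
  (forall x, S x -> `|x| <= B) -> (exists x, S x) -> exists x, leftmost S x.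
Proof.
move=> Sr SB [x0 Sx0].
have bnd x : S x -> - B <= x <= B by move=> /SB; rewrite ler_norml.
have Slb : has_lbound S by exists (- B) => x /bnd/andP[].
have Sinf : has_inf S by split=> //; exists x0.
pose u := inf S.
have u_le x : S x -> u <= x by move=> Sx; exact: ge_inf.
have [Su|nSu] := pselect (S u); first by exists u; split=> //; left.
have u_lt x : S x -> u < x.
  move=> Sx; rewrite lt_neqAle u_le// andbT; apply: contraPneq Sx => <-.
  exact: nSu.
(* The first breakpoint beyond [u], or [x0] if that comes earlier. Points of [S] lie arbitrarily
   close to [u] and nothing changes before [b0], so the open interval from [u] to [b0] lies in
   [S]. *)
pose b0 := \big[Order.min/x0]_(z <- r | u < z) z.
have ub0 : u < b0.
  rewrite /b0; elim/big_rec: _ => [|z x uz ux]; first exact: u_lt.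
  by rewrite lt_min uz.
have b0r z : z \in r -> u < z -> b0 <= z.
  move=> zr uz; rewrite /b0; elim: r zr {Sr b0 ub0} => //= a r IH.
  rewrite in_cons big_cons => /orP[/eqP <-|/IH le]; first by rewrite uz ge_min lexx.
  by case: ifP => // _; rewrite ge_min le orbT.
have ub0S y : u < y -> y < b0 -> S y.
  move=> uy yb0; have [y' Sy' y'y] := inf_lt Sinf.1 uy.
  apply/(Sr y' y (ltW y'y)) => // z zr; apply/negP => /andP[y'z zy].
  have uz : u < z by rewrite (lt_le_trans (u_lt _ Sy')).
  by have := b0r _ zr uz; rewrite leNgt (le_lt_trans zy).
pose Bs := [set b' | forall y, u < y -> y < b' -> S y].
have Bsup : has_sup Bs.
  split; first by exists b0.
  exists (Num.max B (u + 1)) => b' /= Hb'; rewrite leNgt; apply/negP.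
  rewrite gt_max => /andP[Bb' ub'].
  pose y := (Num.max B u + b') / 2.
  have [uB BB] : u <= Num.max B u /\ B <= Num.max B u by rewrite !le_max !lexx orbT.
  have Mb' : Num.max B u < b' by rewrite gt_max Bb' (lt_trans _ ub')// ltrDl.
  have /bnd/andP[_] : S y by apply: Hb'; rewrite /y; lra.
  by rewrite /y; lra.
pose b := sup Bs.
have b0b : b0 <= b by apply: ub_le_sup => //; case: Bsup.
have ub : u < b by exact: lt_le_trans b0b.
have ubS y : u < y -> y < b -> S y.
  move=> uy yb; have [b' Hb' yb'] := sup_gt Bsup.1 yb.
  exact: Hb'.
exists ((u + b) / 2); split; first by apply: ubS; lra.
right; exists u, b; split=> //; first by lra.
by move=> b' Hb'; apply: ub_le_sup => //; case: Bsup.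
Qed.

Lemma updE e k x : upd e k x k = x.
Proof. by rewrite /upd eqxx. Qed.

Lemma upd_id e k : upd e k (e k) = e.
Proof. by apply/funext => j; rewrite /upd; case: eqP => // ->. Qed.

Lemma upd_upd e k x y : upd (upd e k x) k y = upd e k y.
Proof. by apply/funext => j; rewrite /upd; case: eqP. Qed.

Lemma semialg_leftmost X k : semialg X ->
  semialg (fun e => leftmost (fun x => X (upd e k x)) (e k)).
Proof.
move=> sX.
have sXupd a (s : (nat -> R) -> nat -> R) :
    (forall j, polyfun (fun e => s e j)) -> semialg (fun e => X (upd (s e) k (e a))).
  move=> ps; apply: semialg_subst sX => j; semialg; exact: ps.
apply: (@semialg_iff _ (fun e => X (upd e k (e k)) /\
  ((forall y, X (upd e k y) -> e k <= y) \/
    exists u b, u < b /\ (e k + e k = u + b /\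
      ((forall y, X (upd e k y) -> u < y) /\
      ((forall y, u < y -> y < b -> X (upd e k y)) /\
      forall b', (forall y, u < y -> y < b' -> X (upd e k y)) -> b' <= b)))))).
  by semialg; apply: sXupd => j; semialg.
move=> e; rewrite /leftmost; split=> [] [Xe [min|[u [b ub]]]]; split=> //;
  try (by left); right; exists u, b.
  by case: ub => ? [? [? []]].
by case: ub.
Qed.

Lemma agree_offS p n e e' :
  agree_off p n.+1 e e' <-> exists x, agree_off p.+1 n (upd e p x) e'.
Proof.
split=> [ee'|[x ee'] k kp].
  exists (e' p) => k kp; rewrite /upd; case: eqP => [->//|/eqP kp'].
  by apply: ee'; move: kp kp'; lia.
by rewrite ee' /upd; [case: eqP => //|]; move: kp; lia.
Qed.

Lemma semialg_ex_block X p n : semialg X ->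
  semialg (fun e => exists e', agree_off p n e e' /\ X e').
Proof.
elim: n p => [|n IH] p sX.
  apply: (semialg_iff sX) => e; split=> [Xe|[e' [ee' Xe']]].
    by exists e.
  by rewrite (_ : e = e')//; apply/funext => k; rewrite ee'//; lia.
apply: (semialg_iff (semialg_ex_upd p (IH p.+1 sX))) => e.
split=> [[x [e' [ee' Xe']]]|[e' [/agree_offS[x ee'] Xe']]].
  by exists e'; split=> //; apply/agree_offS; exists x.
by exists x, e'.
Qed.

(** One coordinate at a time: coordinate [p] is put at the [leftmost] point of its section after the
    rest of the block is projected out; that point exists because the section is bounded and tame.
    The last clause makes [Y] the graph of a function of the coordinates outside the block. *)
Lemma semialg_choice X p n (B : R) : semialg X ->
  (forall e, X e -> forall k, (p <= k < p + n)%N -> `|e k| <= B) ->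
  exists Y, [/\ semialg Y, forall e, Y e -> X e,
    forall e, X e -> exists e', agree_off p n e e' /\ Y e' &
    forall e e', agree_off p n e e' -> Y e -> Y e' -> e = e'].
Proof.
elim: n p X => [|n IH] p X sX XB.
  exists X; split=> // [e Xe|e e' ee' _ _]; first by exists e.
  by apply/funext => k; rewrite ee'//; lia.
pose X1 e := exists e', agree_off p.+1 n e e' /\ X e'.
have sX1 : semialg X1 by exact: semialg_ex_block.
pose Y1 e := leftmost (fun x => X1 (upd e p x)) (e p).
have sY1 : semialg Y1 by exact: semialg_leftmost.
have X1B e x : X1 (upd e p x) -> `|x| <= B.
  move=> [e' [ee' /XB/(_ p)]]; rewrite ee'; last by lia.
  by rewrite updE; apply; lia.
have X1off e e' : agree_off p.+1 n e e' -> X1 e = X1 e'.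
  move=> ee'; apply/propext; split=> [] [e1 [ee1 Xe1]]; exists e1; split=> // k kp.
    by rewrite ee1 ?ee'.
  by rewrite ee1 ?ee'.
have Y1off e e' : agree_off p.+1 n e e' -> Y1 e -> Y1 e'.
  move=> ee'; rewrite /Y1 ee'; last by lia.
  rewrite (_ : (fun x => X1 (upd e' p x)) = fun x => X1 (upd e p x))//.
  apply/funext => x; apply/esym/X1off => k kp.
  by rewrite /upd; case: eqP => // _; apply: ee'.
have [||Y [sY YX Yex Yun]] := IH p.+1 (fun e => X e /\ Y1 e).
- exact: semialg_and.
- by move=> e [/XB Xe _] k kp; apply: Xe; lia.
exists Y; split=> // [e /YX[]//|e Xe|e e' ee' Ye Ye'].
- have [M tM] := semialg_tame p sX1; have [r _ tr] := tM e.
  have X1e : exists x, X1 (upd e p x) by exists (e p), e; rewrite upd_id.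
  have [x Lx] := leftmost_ex tr (X1B e) X1e.
  have [[e' [ee' Xe']] _] := Lx.
  have Y1e' : Y1 e'.
    apply: (Y1off _ _ ee'); rewrite /Y1 updE.
    by under eq_fun do rewrite upd_upd.
  have [e2 [ee2 Ye2]] := Yex e' (conj Xe' Y1e').
  exists e2; split=> //; apply/agree_offS; exists x => k kp.
  by rewrite ee2// ee'.
- have [_ Y1e] := YX _ Ye; have [_ Y1e'] := YX _ Ye'.
  have Y1u : Y1 (upd e p (e' p)).
    apply: Y1off Y1e' => k kp; rewrite /upd; case: eqP => [->//|/eqP kp'].
    by rewrite ee'//; lia.
  have eE : e p = e' p.
    apply: leftmost_uniq Y1e _; move: Y1u; rewrite /Y1 updE.
    by under eq_fun do rewrite upd_upd.
  apply: (Yun e e') => // k kp; have [->|kp'] := eqVneq k p; first by [].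
  by apply: ee'; lia.
Qed.

End Choice.

(** * Bounded variation *)

Section Variation.
Local Open Scope classical_set_scope.
Local Open Scope ring_scope.
Variable R : realType.
Implicit Types (r : seq R) (S : R -> Prop) (f g : R -> R).

(** A monotone counter that strictly increases whenever membership in a tame set changes. Each point
    of [r] counts twice, since membership may change on reaching it and again on leaving it. *)
Definition crossings r (x : R) : nat :=
  (count (fun z => (z < x)%R) r + count (fun z => (z <= x)%R) r)%N.

Lemma crossings_le r x : (crossings r x <= size r + size r)%N.
Proof. by rewrite leq_add// count_size. Qed.

Lemma crossings_mono r x y : x <= y -> (crossings r x <= crossings r y)%N.
Proof.
move=> xy; rewrite leq_add//; apply: sub_count => z /= zx.
  exact: lt_le_trans xy.
exact: le_trans xy.
Qed.

Lemma count_ltn (T : eqType) (P Q : pred T) (s : seq T) z :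
  subpred P Q -> z \in s -> Q z -> ~~ P z -> (count P s < count Q s)%N.
Proof.
move=> PQ zs Qz nPz; elim: s zs => //= a s IH.
have le1 : (P a <= Q a)%N by case Pa: (P a) => //; rewrite (PQ _ Pa).
rewrite in_cons => /orP[/eqP <-|/IH lt].
  by rewrite Qz (negbTE nPz) add0n add1n ltnS sub_count.
by rewrite -addnS leq_add.
Qed.

Lemma crossings_jump r S x y : tame_off r S -> x <= y -> ~ (S x <-> S y) ->
  (crossings r x < crossings r y)%N.
Proof.
move=> Sr xy nS; have [z zr /andP[xz zy]] : exists2 z, z \in r & x <= z <= y.
  apply: contrapT => nz; apply: nS; apply: Sr => // z zr; apply/negP => xzy.
  by apply: nz; exists z.
have lxy : x < y.
  by rewrite lt_neqAle xy andbT; apply: contra_not_neq nS => ->.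
have [zy'|yz] := ltP z y.
  rewrite /crossings -addSn leq_add//.
    apply: (count_ltn (z := z)) => // [w wx|]; first exact: lt_trans lxy.
    by rewrite -leNgt.
  by apply: sub_count => w wx; exact: le_trans xy.
rewrite /crossings -addnS leq_add//.
  by apply: sub_count => w wx; exact: lt_trans lxy.
apply: (count_ltn (z := z)) => // [w wx|]; first exact: le_trans xy.
by rewrite -ltNge (lt_le_trans lxy).
Qed.

(** The levels [c + j * eta] have spacing [eta], so a rise from [u] to [v] passes at least
    [(v - u) / eta - 1] of them. *)
Lemma threshold_count (eta c u v : R) (N : nat) : 0 <= eta -> c <= u ->
  v <= c + N%:R * eta -> u <= v ->
  v - u <= eta * (1 + \sum_(j < N) ((u <= c + j%:R * eta) && (c + j%:R * eta < v))%:R).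
Proof.
move=> eta0 cu; elim: N v => [|N IH] v vN uv.
  by rewrite big_ord0; lra.
have cN : c + N.+1%:R * eta = c + N%:R * eta + eta.
  by rewrite -natr1 mulrDl mul1r addrA.
rewrite {}cN in vN.
rewrite big_ord_recr /=; set Sg := \sum_(_ < _) _.
have Sg0 : 0 <= Sg by apply: sumr_ge0.
have [vN'|Nv] := leP v (c + N%:R * eta).
  apply: (le_trans (IH v vN' uv)); rewrite -/Sg.
  by rewrite andbF addr0.
have [uN|Nu] := leP u (c + N%:R * eta); last first.
  rewrite /= addr0; have : 0 <= eta * Sg by rewrite mulr_ge0.
  lra.
have := IH _ (lexx _) uN.
set Sg' := \sum_(_ < _) _ => le'.
have SS : Sg' <= Sg.
  apply: ler_sum => j _; rewrite ler_nat.
  case: (u <= _) => //=; case: ltP => // lt1; case: ltP => // lt2.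
  by have := lt_le_trans Nv lt2; rewrite ltNge (ltW lt1).
have : eta * Sg' <= eta * Sg by rewrite ler_wpM2l.
rewrite /= ; lra.
Qed.

(** Each level is crossed at most [2 * M] times; integrating this over a range of length [2 * B]
    gives [4 * B * M] (Banach's indicatrix). Finitely many levels replace the integral, and the 1 is
    the rounding error. *)
Lemma variation_tame (f : R -> R) (a b B : R) (M : nat) (s : seq R) : 0 < B ->
  (forall x, a <= x <= b -> `|f x| <= B) ->
  (forall c, exists r S, [/\ (size r <= M)%N, tame_off r S &
     forall x, a <= x <= b -> S x <-> c < f x]) ->
  itv_partition a b s -> variation a b f s <= 4 * B * M%:R + 1.
Proof.
move=> B0 fB tf abs; pose n := size s.
have [r /choice[S rS]] := choice tf.
(* The number of levels is chosen after the partition, so that an error of [eta] on each of its [n]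
   pieces costs at most 1 in all. *)
pose N := (Num.truncn (2 * B * n%:R)).+1.
have N0 : 0 < N%:R :> R by rewrite ltr0n.
have NB : 2 * B * n%:R < N%:R by exact: truncnS_gt.
pose eta := 2 * B / N%:R.
have eta0 : 0 <= eta by rewrite divr_ge0// ?ltW// mulr_gt0.
have etaN : N%:R * eta = 2 * B by rewrite mulrC divfK// gt_eqF.
have etan : eta * n%:R <= 1.
  by rewrite /eta mulrAC ler_pdivrMr// mul1r ltW.
pose th j := - B + j%:R * eta.
pose rho j x := (crossings (r (th j)) x)%:R : R.
have jump x y : a <= x -> x <= y -> y <= b ->
    `|f y - f x| <= eta * (1 + \sum_(j < N) (rho j y - rho j x)).
  move=> ax xy yb.
  have axb : a <= x <= b by rewrite ax (le_trans xy).
  have ayb : a <= y <= b by rewrite yb (le_trans ax).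
  have mono c : (c < f x) != (c < f y) ->
      1 <= (crossings (r c) y)%:R - (crossings (r c) x)%:R :> R.
    move=> ne; have [_ tr fS] := rS c.
    rewrite lerBrDr -[1]/(1%:R) -natrD ler_nat add1n; apply: (crossings_jump tr xy).
    by rewrite !fS// => E; move/eqP: ne; apply; apply/idP/idP => /E.
  have nonneg j : 0 <= rho j y - rho j x.
    by rewrite subr_ge0 ler_nat crossings_mono.
  have bnd z : a <= z <= b -> - B <= f z <= B by move=> /fB; rewrite ler_norml.
  have upper z : a <= z <= b -> f z <= - B + N%:R * eta.
    by move=> /bnd /andP[_]; rewrite etaN; lra.
  have [fxy|fyx] := leP (f x) (f y).
    rewrite ger0_norm ?subr_ge0//.
    have /andP[lo _] := bnd _ axb.
    apply: (le_trans (threshold_count eta0 lo (upper _ ayb) fxy)).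
    rewrite ler_wpM2l// lerD2l ler_sum// => j _.
    case: andP => [[c1 c2]|_]; last exact: nonneg.
    by apply: mono; rewrite c2 ltNge c1.
  rewrite ler0_norm; last by rewrite subr_le0 ltW.
  rewrite opprB.
  have /andP[lo _] := bnd _ ayb.
  apply: (le_trans (threshold_count eta0 lo (upper _ axb) (ltW fyx))).
  rewrite ler_wpM2l// lerD2l ler_sum// => j _.
  case: andP => [[c1 c2]|_]; last exact: nonneg.
  by apply: mono; rewrite c2 ltNge c1.
pose F := nth b (a :: s).
have aF i : (i <= n)%N -> a <= F i by move=> ?; exact: itv_partition_nth_ge.
have Fb i : (i <= n)%N -> F i <= b by move=> ?; exact: itv_partition_nth_le.
have FF i : (i < n)%N -> F i <= F i.+1.
  by move=> ?; apply/ltW; case: abs => /(pathP b) + _; apply.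
rewrite /variation -/n -/F.
apply: (@le_trans _ _ (\sum_(0 <= i < n) (eta * (1 + \sum_(j < N) (rho j (F i.+1) - rho j (F i)))))).
  rewrite !big_nat ler_sum// => i /andP[_ ilt].
  by apply: jump; [exact/aF/ltnW|exact: FF|exact: Fb].
rewrite -mulr_sumr big_split /= sumr_const_nat subn0 exchange_big /=.
under eq_bigr do rewrite telescope_sumr//.
have : \sum_(j < N) (rho j (F n) - rho j (F 0%N)) <= N%:R * (2 * M%:R).
  apply: (@le_trans _ _ (\sum_(j < N) (2 * M%:R))).
    apply: ler_sum => j _; rewrite lerBlDr.
    have [rM _ _] := rS (th j).
    have : rho j (F n) <= (M + M)%:R.
      by rewrite ler_nat (leq_trans (crossings_le _ _))// leq_add.
    have : 0 <= rho j (F 0%N) by [].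
    by rewrite natrD; lra.
  by rewrite sumr_const card_ord [leRHS]mulr_natl.
have E : eta * (N%:R * (2 * M%:R)) = 2 * B * (2 * M%:R).
  by rewrite mulrA [eta * _]mulrC etaN.
move=> /(ler_wpM2l eta0); rewrite E => le1.
by rewrite mulrDr; move: etan le1; lra.
Qed.

(** [g] is the total variation function. Monotone majorants can be added over several coordinates,
    so that one point and one family of secants serve all of them. *)
Lemma variation_majorant (f : R -> R) (a b K : R) : a < b ->
  (forall s, itv_partition a b s -> variation a b f s <= K) ->
  exists g : R -> R, [/\ g a = 0, g b <= K & forall x y, a <= x -> x <= y -> y <= b ->
    `|f y - f x| <= g y - g x].
Proof.
move=> ab fK.
have bv : bounded_variation a b f by exists K => _ [s abs <-]; exact: fK.
pose g x := fine (total_variation a x f); exists g; split.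
- by rewrite /g total_variationxx.
- rewrite /g -lee_fin fineK; last by apply/bounded_variationP => //; exact: ltW.
  by apply: ge_ereal_sup => _ [_ [s abs <-] <-]; rewrite lee_fin fK.
move=> x y ax xy yb.
have bvy : bounded_variation a y f := bounded_variationl (le_trans ax xy) yb bv.
have bvx : bounded_variation a x f := bounded_variationl ax xy bvy.
have bvxy : bounded_variation x y f := bounded_variationr ax xy bvy.
have finP u v : u <= v -> bounded_variation u v f -> total_variation u v f \is a fin_num.
  by move=> uv ?; apply/bounded_variationP.
rewrite -lee_fin EFinB /g !fineK ?finP// ?(le_trans ax)//.
rewrite (total_variationD f ax xy) addeAC subee ?finP// add0e.
exact: total_variation_ge.
Qed.

(** Bisection takes the place of almost everywhere differentiability: one half of an interval always
    has mean slope at most that of the whole, and [x] is the common point of the nested intervals so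
    selected. *)
Lemma monotone_derived_number (g : R -> R) (a b : R) : a < b ->
  (forall x y, a <= x -> x <= y -> y <= b -> g x <= g y) ->
  exists2 x, a <= x <= b & forall h, 0 < h -> exists y, [/\ a <= y <= b,
    0 < `|y - x|, `|y - x| < h &
    `|g y - g x| <= 2 * ((g b - g a) / (b - a)) * `|y - x|].
Proof.
move=> ab gmono; pose c := (g b - g a) / (b - a).
have ba0 : 0 < b - a by rewrite subr_gt0.
pose l (n : nat) : R := (b - a) / 2 ^+ n.
have l_gt0 n : 0 < l n by rewrite divr_gt0// exprn_gt0.
have lS n : l n.+1 = l n / 2 by rewrite /l exprSr invfM mulrA.
pose step (n : nat) (u : R) :=
  if g (u + l n.+1) - g u <= c * l n.+1 then u else u + l n.+1.
pose u := fix u n := if n is n'.+1 then step n' (u n') else a.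
have inv n : [/\ a <= u n, u n + l n <= b & g (u n + l n) - g (u n) <= c * l n].
  elim: n => [|n [IH1 IH2 IH3]] /=.
    by rewrite /l expr0 divr1 addrC subrK lexx /c divfK// gt_eqF.
  have lSn := lS n; have l0 := l_gt0 n; rewrite /step.
  move: IH3; rewrite (_ : l n = l n.+1 + l n.+1); last by rewrite lSn; lra.
  move=> IH3; case: ifP => [le1|/negbT]; last rewrite -ltNge => lt1.
    by split=> //; lra.
  split; [lra|lra|].
  by rewrite -addrA; move: IH3 lt1; rewrite mulrDr; lra.
have uS n : u n <= u n.+1 /\ u n.+1 + l n.+1 <= u n + l n.
  rewrite /= /step; have := l_gt0 n.+1; have := lS n.
  by case: ifP => _; lra.
have umono n m : u n <= u (n + m)%N /\ u (n + m)%N + l (n + m)%N <= u n + l n.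
  elim: m => [|m [IH1 IH2]]; first by rewrite addn0.
  by rewrite addnS; have [] := uS (n + m)%N; lra.
have ucmp n m : u m <= u n + l n.
  have [mn|/ltnW nm] := leqP m n.
    have [+ _] := umono m (n - m)%N; rewrite subnKC//.
    by have := l_gt0 n; lra.
  have [_] := umono n (m - n)%N; rewrite subnKC//.
  by have := l_gt0 m; lra.
have usup : has_sup (range u).
  by split; [exists (u 0%N), 0%N|exists (u 0%N + l 0%N) => _ [n _ <-]].
pose x := sup (range u).
have ux n : u n <= x by apply: ub_le_sup; [case: usup|exists n].
have xu n : x <= u n + l n.
  by apply: ge_sup => [|_ [m _ <-]]; [case: usup|exact: ucmp].
exists x; first by rewrite (ux 0%N) (le_trans (xu 0%N))//; have [] := inv 0%N.
move=> h h0.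
have [n ln] : exists n, l n < h.
  pose n := (Num.truncn ((b - a) / h)).+1.
  exists n; rewrite /l ltr_pdivrMr ?exprn_gt0// mulrC -ltr_pdivrMr//.
  apply: (lt_trans (truncnS_gt _)); rewrite -natrX ltr_nat.
  exact: ltn_expl.
have [au unb gn] := inv n; have un := ux n; have xn := xu n.
have ln0 := l_gt0 n.
have gux : g (u n) <= g x by apply: gmono => //; lra.
have gxv : g x <= g (u n + l n) by apply: gmono => //; lra.
have c0 : 0 <= c.
  by apply: divr_ge0 (ltW ba0); rewrite subr_ge0; apply: gmono => //; exact: ltW.
(* The end farther from [x] is at distance at least [l n / 2], whence the factor 2. *)
have [far|near] := leP (l n / 2) (x - u n).
- exists (u n); rewrite au /=.
  have -> : `|u n - x| = x - u n by rewrite distrC ger0_norm; lra.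
  have -> : `|g (u n) - g x| = g x - g (u n) by rewrite distrC ger0_norm; lra.
  have : c * (l n / 2) <= c * (x - u n) by rewrite ler_wpM2l.
  by rewrite -/c; split; lra.
- exists (u n + l n); rewrite unb andbT.
  have -> : `|u n + l n - x| = u n + l n - x by rewrite ger0_norm; lra.
  have -> : `|g (u n + l n) - g x| = g (u n + l n) - g x by rewrite ger0_norm; lra.
  have : c * (l n / 2) <= c * (u n + l n - x) by rewrite ler_wpM2l//; lra.
  by rewrite -/c; split; lra.
Qed.

End Variation.

(** * Secants of semialgebraic functions *)

Section Secants.
Variable R : realType.
Implicit Types (e : nat -> R) (X Y : (nat -> R) -> Prop).

Lemma semialg_forall_nat (I : nat -> Prop) (P : nat -> (nat -> R) -> Prop) n :
  (forall j, semialg (P j)) -> (forall j, I j -> (j < n)%N) ->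
  semialg (fun e => forall j, I j -> P j e).
Proof.
move=> sP In.
apply: (@semialg_iff _ (fun e => forall j, (j < n)%N -> I j -> P j e)); last first.
  by move=> e; split=> H j Ij; [apply: H => //; exact: In|move=> ?; exact: H].
elim: n {In} => [|n IH].
  by apply: (@semialg_iff _ (fun=> 0 = 0 :> R)) => [|e]; [semialg|split].
apply: (@semialg_iff _ (fun e => (forall j, (j < n)%N -> I j -> P j e) /\ (I n -> P n e))).
  apply: semialg_and IH _; have [In|nIn] := pselect (I n).
    by apply: semialg_iff (sP n) _ => e; split=> [//|]; exact.
  by apply: (@semialg_iff _ (fun=> 0 = 0 :> R)) => [|e]; [semialg|split].
move=> e; split=> [[H1 H2] j|H].
  by rewrite ltnS leq_eqVlt => /orP[/eqP ->|]; [exact: H2|exact: H1].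
by split=> [j jn|]; apply: H => //; rewrite ltnS ltnW.
Qed.

Lemma semialg_ex_vec n (P : (nat -> R) -> (nat -> R) -> Prop) :
  (forall y y' e, (forall k, (k < n)%N -> y k = y' k) -> P y e -> P y' e) ->
  semialg (fun e => P e (fun k => e (n + k)%N)) ->
  semialg (fun e => exists y, P y e).
Proof.
move=> Pdep /(semialg_ex_block 0 n) sP.
pose s e k := if (k < n)%N then 0 else e (k - n)%N : R.
apply: (semialg_iff (semialg_subst (s := s) _ sP)).
  by move=> k; rewrite /s; case: (k < n)%N; semialg.
move=> e; rewrite -/(s e).
split=> [[e' [ee' Pe']]|[y Py]].
  exists e'; rewrite (_ : e = fun k => e' (n + k)%N)//.
  apply/funext => k; rewrite ee'; last by lia.
  by rewrite /s ltnNge leq_addr /= addKn.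
pose z k := if (k < n)%N then y k else e (k - n)%N.
exists z; split; first by move=> k nk; rewrite /z /s; case: ifP => // kn; lia.
have -> : (fun k => z (n + k)%N) = e.
  by apply/funext => k; rewrite /z ltnNge leq_addr /= addKn.
by apply: Pdep Py => k; rewrite /z => ->.
Qed.

(* Definable choice turns X into functions of the coordinate d whose total
   variation is bounded in terms of X only, since the number of times they cross
   a level is. *)
Lemma semialg_derived_number X d m (B : R) : semialg X -> 0 < B ->
  (forall e, X e -> forall k, (d < k < d + m.+1)%N -> `|e k| <= B) ->
  exists2 K : R, 1 <= K & forall e a b, a < b ->
    (forall s, a <= s <= b ->
       exists e', [/\ agree_off d m.+1 e e', e' d = s & X e']) ->
    exists e1, [/\ agree_off d m.+1 e e1, a <= e1 d <= b, X e1 &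
      forall h, 0 < h -> exists e', [/\ agree_off d m.+1 e e', X e',
        0 < `|e' d - e1 d|, `|e' d - e1 d| < h &
        forall j, (d < j < d + m.+1)%N ->
          `|e' j - e1 j| <= K / (b - a) * `|e' d - e1 d|]].
Proof.
move=> sX B0 XB.
have [|Y [sY YX Yex Yun]] := @semialg_choice _ X d.+1 m B sX.
  by move=> e /XB Xe k kd; apply: Xe; move: kd; clear; lia.
(* Coordinate 0 of [v] holds a level and the sequence itself is shifted by one. The superlevel sets
   of a chosen coordinate are thus fibers of one semialgebraic set, and their number of breakpoints
   depends neither on the level nor on [e]. *)
pose T j v := exists w, agree_off d.+2 m v w /\ (Y (fun n => w n.+1) /\ w 0%N < w j.+1).
have sT j : semialg (T j).
  by apply: semialg_ex_block; semialg; apply: semialg_subst sY => k; semialg.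
have /choice[M tM] := fun j => semialg_tame d.+1 (sT j).
pose MM := (\sum_(i < m) M (d.+1 + i))%N.
have MMi (i : 'I_m) : (M (d.+1 + i) <= MM)%N by rewrite /MM (bigD1 i)//= leq_addr.
pose K0 := 4 * B * MM%:R + 1.
have K00 : 0 < K0 by rewrite ltr_wpDl// mulr_ge0// mulr_ge0// ltW.
(* [m * K0] bounds the sum of the variations of the [m] dependent coordinates; the 2 is that of
   [monotone_derived_number]. *)
pose K := 2 * (m%:R * K0) + 1.
have mK0 : 0 <= m%:R * K0 by rewrite mulr_ge0// ltW.
have K_ge1 : 1 <= K by rewrite /K; lra.
exists K => // e a b ab Xab.
have {Xab} /choice[F Fspec] s : exists e', a <= s <= b ->
    [/\ agree_off d.+1 m (upd e d s) e', Y e' & X e'].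
  have [sab|] := boolP (a <= s <= b); last by exists e.
  have [e' [ee' e's Xe']] := Xab s sab.
  have [e2 [e2e' Ye2]] := Yex _ Xe'.
  exists e2 => _; split=> //; last exact: YX.
  move=> k kd; rewrite e2e'// /upd; case: eqP => [-> //|/eqP kd'].
  by apply: ee'; move: kd kd'; clear; lia.
have bnd (i : 'I_m) s : a <= s <= b -> `|F s (d.+1 + i)%N| <= B.
  by move=> /Fspec[_ _ /XB]; apply; have := ltn_ord i; clear; lia.
have tame (i : 'I_m) c : exists r S, [/\ (size r <= MM)%N, tame_off r S &
    forall s, a <= s <= b -> S s <-> c < F s (d.+1 + i)%N].
  pose v n := if n is n'.+1 then e n' else c.
  have [r rM Tr] := tM (d.+1 + i)%N v.
  exists r, (fun s => T (d.+1 + i)%N (upd v d.+1 s)); split=> //.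
    exact: leq_trans (MMi i).
  move=> s sab; have [Fs YFs _] := Fspec s sab.
  split=> [[w [vw [Yw wc]]]|cF].
    have Fw : agree_off d.+1 m (F s) (fun n => w n.+1).
      move=> k kd; rewrite vw; last by move: kd; clear; lia.
      by rewrite Fs// /upd eqSS.
    have Fweq := Yun _ _ Fw YFs Yw.
    move: wc; rewrite vw//.
    by rewrite /upd /= => /lt_le_trans; apply; rewrite Fweq.
  exists (fun n => if n is n'.+1 then F s n' else c); split=> // -[|k] kd.
    by rewrite /upd.
  rewrite Fs; last by move: kd; clear; lia.
  by rewrite /upd eqSS.
have /choice[G Gspec] (i : 'I_m) : exists g : R -> R, [/\ g a = 0, g b <= K0 &
    forall x y, a <= x -> x <= y -> y <= b ->
      `|F y (d.+1 + i)%N - F x (d.+1 + i)%N| <= g y - g x].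
  apply: (variation_majorant ab) => s abs.
  exact: (variation_tame B0 (bnd i) (tame i)).
pose g x := \sum_(i < m) G i x.
have gF x y (i : 'I_m) : a <= x -> x <= y -> y <= b ->
    `|F y (d.+1 + i)%N - F x (d.+1 + i)%N| <= g y - g x.
  move=> ax xy yb; rewrite /g -sumrB (bigD1 i)//=.
  have [_ _ /(_ x y ax xy yb) H] := Gspec i.
  apply: (le_trans H); rewrite lerDl sumr_ge0// => j _.
  have [_ _ /(_ x y ax xy yb)] := Gspec j.
  exact: le_trans.
have gmono x y : a <= x -> x <= y -> y <= b -> g x <= g y.
  move=> ax xy yb; apply: ler_sum => j _; rewrite -subr_ge0.
  have [_ _ /(_ x y ax xy yb)] := Gspec j.
  exact: le_trans.
have gab : g b - g a <= m%:R * K0.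
  rewrite /g -sumrB (@le_trans _ _ (\sum_(i < m) K0))//.
    by apply: ler_sum => i _; have [-> le _] := Gspec i; rewrite subr0.
  by rewrite sumr_const card_ord mulr_natl.
have [x xab xder] := monotone_derived_number ab gmono.
have [Fx YFx XFx] := Fspec x xab.
have Fd s : a <= s <= b -> F s d = s /\ agree_off d m.+1 e (F s).
  move=> sab; have [Fs _ _] := Fspec s sab; split.
    by rewrite Fs ?updE// ltnn.
  move=> k kd; rewrite Fs; last by move: kd; clear; lia.
  by rewrite /upd; case: eqP => // kd'; move: kd; rewrite kd'; clear; lia.
exists (F x); have [Fxd xoff] := Fd x xab; split=> //; first by rewrite Fxd.
move=> h /xder[y [yab xy yh gxy]].
have [Fyd yoff] := Fd y yab; have [_ _ XFy] := Fspec y yab.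
exists (F y); rewrite Fxd Fyd; split=> // j jd.
have jm : (j - d.+1 < m)%N by move: jd; clear; lia.
have -> : j = (d.+1 + Ordinal jm)%N by rewrite /=; move: jd; clear; lia.
have ba0 : 0 < b - a by rewrite subr_gt0.
have gle : `|F y (d.+1 + Ordinal jm)%N - F x (d.+1 + Ordinal jm)%N| <= `|g y - g x|.
  have /andP[ax xb] := xab; have /andP[ay yb] := yab.
  have [le|/ltW le] := leP x y.
    by rewrite (le_trans (gF _ _ (Ordinal jm) ax le yb))// ler_norm.
  rewrite distrC [leRHS]distrC.
  by rewrite (le_trans (gF _ _ (Ordinal jm) ay le xb))// ler_norm.
apply: (le_trans gle); apply: (le_trans gxy).
rewrite ler_wpM2r// mulrA ler_wpM2r ?invr_ge0 ?(ltW ba0)//.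
by rewrite /K; lra.
Qed.

End Secants.

(** * Counting *)

Section Counting.
Variable R : realType.

Lemma pigeonhole_class (I : finType) (J : {set I}) (M : nat) (phi : I -> nat) :
  (forall i, (phi i <= M)%N) ->
  exists q, (#|J| <= M.+1 * #|[set i in J | phi i == q]|)%N.
Proof.
move=> phiM; apply: contrapT => /forallNP no.
have E : #|J| = (\sum_(q < M.+1) #|[set i in J | phi i == q]|)%N.
  rewrite -sum1_card (partition_big (fun i => inord (phi i) : 'I_M.+1) predT)//=.
  apply: eq_bigr => q _; rewrite -sum1_card; apply: eq_bigl => i.
  by rewrite !inE -val_eqE /= inordK ?ltnS.
have : (M.+1 * #|J| < M.+1 * #|J|)%N; last by rewrite ltnn.
rewrite {1}E big_distrr /= -[X in (_ < X * _)%N]card_ord -sum_nat_const.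
apply: (@leq_trans (\sum_(q < M.+1) (#|J|.-1))%N.+1).
  rewrite ltnS; apply: leq_sum => q _.
  by have /negP := no q; rewrite -ltnNge => lt; rewrite -ltnS (ltn_predK lt).
have [j0|j1] := posnP #|J|.
  by case: (no 0%N); rewrite j0.
rewrite !sum_nat_const card_ord; move: j1; clear; nia.
Qed.

(** The cells are sorted by the number of points of [r] to their left. Two cells of one class have
    no breakpoint between their left ends, so the hull of a class lies in [S], and there are at most
    [size r + 1] classes. *)
Lemma tame_interval (S : R -> Prop) (r : seq R) (kap c : R) n (J : {set 'I_n}) :
  tame_off r S -> 0 < kap -> J != finset.set0 ->
  (forall j, j \in J -> forall s, c + j%:R * kap <= s <= c + j.+1%:R * kap -> S s) ->
  exists a b, [/\ a < b, forall s, a <= s <= b -> S s &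
    kap * #|J|%:R <= (size r).+1%:R * (b - a)].
Proof.
move=> Sr kap0 J0 JS.
pose phi (j : 'I_n) := count (fun z => (z < c + j%:R * kap)%R) r.
have [q Jq] := pigeonhole_class J (fun j => count_size _ r : (phi j <= size r)%N).
set A := [set i in J | phi i == q] in Jq.
have [j0 j0A] : exists j0, j0 \in A.
  apply/set0Pn; rewrite -card_gt0; move: J0; rewrite -card_gt0.
  by case: #|A| Jq => //; rewrite muln0; case: #|J|.
case: (arg_minnP (fun j : 'I_n => j : nat) j0A) => lo loA lomin.
case: (arg_maxnP (fun j : 'I_n => j : nat) j0A) => hi hiA himax.
have {}loA : lo \in A := loA; have {}hiA : hi \in A := hiA.
have lohi : (lo <= hi)%N by exact: lomin.
have AE : (#|A| <= hi.+1 - lo)%N.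
  rewrite -(size_iota lo (hi.+1 - lo)) cardE -(size_map val).
  apply: uniq_leq_size; first by rewrite (map_inj_uniq val_inj) enum_uniq.
  move=> _ /mapP[j + ->]; rewrite mem_enum => jA.
  have lj : (lo <= j)%N := lomin _ jA; have jh : (j <= hi)%N := himax _ jA.
  by rewrite mem_iota subnKC ?lj ?ltnS// leqW.
have mulS j : j.+1%:R * kap = j%:R * kap + kap by rewrite -natr1 mulrDl mul1r.
have [loJ hiJ] : lo \in J /\ hi \in J.
  by move: loA hiA; rewrite /A !inE => /andP[-> _] /andP[-> _].
have kle : lo%:R * kap <= hi%:R * kap by rewrite ler_pM2r// ler_nat.
exists (c + lo%:R * kap), (c + hi.+1%:R * kap); split.
- by rewrite mulS; lra.
- move=> s /andP[los shi].
  have [sl|ls] := leP s (c + lo.+1%:R * kap); first by apply: (JS lo); rewrite ?los.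
  have [hs|sh] := leP (c + hi%:R * kap) s; first by apply: (JS hi); rewrite ?hs.
  apply/(Sr (c + lo%:R * kap) s los); last first.
    by apply: (JS lo) => //; rewrite lexx mulS; lra.
  move=> z zr; apply/negP => /andP[loz zs].
  have : (phi lo < phi hi)%N.
    apply: (count_ltn (z := z)) => // [w /=||].
    - by move=> /lt_le_trans; apply; rewrite lerD2l.
    - exact: le_lt_trans sh.
    - by rewrite -leNgt.
  move: loA hiA; rewrite /A !inE => /andP[_ /eqP ->] /andP[_ /eqP ->].
  by rewrite ltnn.
- have -> : c + hi.+1%:R * kap - (c + lo%:R * kap) = (hi.+1 - lo)%:R * kap.
    by rewrite natrB ?leqW//; ring.
  rewrite mulrC mulrA ler_pM2r// -natrM ler_nat (leq_trans Jq)//.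
  by rewrite leq_mul2l AE orbT.
Qed.

Definition harmonic_sum (n : nat) : R := \sum_(m < n) m.+1%:R^-1.

Lemma harmonic_sum_ge0 n : 0 <= harmonic_sum n.
Proof. by apply: sumr_ge0 => i _; rewrite invr_ge0. Qed.

Lemma sum_ltn_ord k n : (k <= n)%N -> (\sum_(m < n) (m < k) = k)%N.
Proof.
elim: n k => [|n IH] k kn; first by rewrite big_ord0; move: kn; case: k.
rewrite big_ord_recr /=; move: kn; rewrite leq_eqVlt => /orP[/eqP ->|kn].
  rewrite ltnSn addn1; congr S.
  by rewrite -[RHS](IH n)//; apply: eq_bigr => m _; rewrite ltn_ord leqW.
by rewrite IH// ltnNge -ltnS kn addn0.
Qed.

(** The sum of [f] is the sum over [m > 0] of the number of [x] with [m <= f x]; if each of these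
    numbers fell below its share, weighted by [1 / m], the total would be too small. The use: rows
    with [f x] cells are traded for rows with at least [m] cells each, at the price of a
    logarithm. *)
Lemma harmonic_pigeonhole (T : finType) (f : T -> nat) n :
  (forall x, (f x <= n)%N) -> (0 < \sum_x f x)%N ->
  exists2 m, (0 < m)%N & (\sum_x f x)%:R <= harmonic_sum n * (m%:R * #|[set x | (m <= f x)%N]|%:R).
Proof.
move=> fn f0; apply: contrapT => no; pose N : R := (\sum_x f x)%:R.
have N0 : 0 < N by rewrite ltr0n.
have n0 : (0 < n)%N.
  case: n fn {no} => // fn; move: f0; rewrite big1// => x _.
  by apply/eqP; rewrite -leqn0.
have H0 : 0 < harmonic_sum n.
  by case: n n0 {fn no} => // n _; rewrite /harmonic_sum big_ord_recl ltr_wpDr// sumr_ge0.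
have E : (\sum_x f x = \sum_(m < n) #|[set x | (m < f x)%N]|)%N.
  under [RHS]eq_bigr do rewrite -sum1dep_card big_mkcond /=.
  rewrite exchange_big /=; apply: eq_bigr => x _.
  by rewrite -[LHS](sum_ltn_ord (fn x)); apply: eq_bigr => m _; case: ltnP.
have : N < N; last by rewrite ltxx.
rewrite {1}/N {1}E natr_sum.
apply: (@lt_le_trans _ _ (\sum_(m < n) N / harmonic_sum n / m.+1%:R)); last first.
  by rewrite -mulr_sumr divfK// gt_eqF.
apply: ltr_sum => [|m _]; first by case: (n) n0 => // k _; apply/hasP; exists ord0; rewrite ?mem_index_enum.
rewrite -mulrA -invfM ltr_pdivlMr ?mulr_gt0// mulrC -mulrA ltNge.
by apply/negP => le; apply: no; exists m.+1.
Qed.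
End Counting.

(** * Triangular systems of secants *)

Section TriangularSecants.
Variable R : realType.
Implicit Types (e : nat -> R) (X : (nat -> R) -> Prop).

Definition ffun_rcons d n (q : {ffun 'I_d -> 'I_n}) (i : 'I_n) : {ffun 'I_d.+1 -> 'I_n} :=
  [ffun k => if unlift ord_max k is Some k' then q k' else i].

Lemma card_ffun_rcons d n (Q : {set {ffun 'I_d.+1 -> 'I_n}}) :
  (#|Q| = \sum_(q : {ffun 'I_d -> 'I_n}) #|[set i | ffun_rcons q i \in Q]|)%N.
Proof.
under [RHS]eq_bigr do rewrite -sum1dep_card.
rewrite pair_big_dep /= -sum1_card.
pose h (p : {ffun 'I_d -> 'I_n} * 'I_n) := ffun_rcons p.1 p.2.
pose g (q : {ffun 'I_d.+1 -> 'I_n}) := ([ffun k => q (lift ord_max k)], q ord_max).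
rewrite (reindex h) /=; first by apply: eq_bigl => -[q i].
exists g => [[q i] _|q _]; rewrite /h /g /ffun_rcons /=.
  congr (_, _); last by rewrite ffunE unlift_none.
  by apply/ffunP => k; rewrite !ffunE liftK.
by apply/ffunP => k; rewrite ffunE; case: unliftP => [k' ->|->]; rewrite ?ffunE.
Qed.

(** Coordinate [D] of [v] is skipped: it is an extra parameter inserted into the sequence, which
    [has_secants] reads as a speed. *)
Definition splice (d D : nat) (y v : nat -> R) : nat -> R :=
  fun k => if (k < d)%N then v k else if (k < D)%N then y k else v k.+1.

(* Coordinate D of v holds the inverse of the Lipschitz constant allowed in the
   block of coordinates from d + 1 to D - 1. *)
Definition has_secants X (d D : nat) (v : nat -> R) :=
  X (splice d D v v) /\ forall h, 0 < h -> exists y, X (splice d D y v) /\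
    (0 < (y d - v d) ^+ 2 /\ ((y d - v d) ^+ 2 < h ^+ 2 /\
     forall j, (d < j < D)%N -> (v D * (y j - v j)) ^+ 2 <= (y d - v d) ^+ 2)).

Lemma semialg_has_secants X d D : (d < D)%N -> semialg X -> semialg (has_secants X d D).
Proof.
move=> dD sX; apply: semialg_and.
  apply: semialg_subst sX => k; rewrite /splice.
  by case: (k < d)%N; case: (k < D)%N; semialg.
refine (semialg_forall _); cbv beta.
apply: semialg_imp; first by semialg.
apply: (@semialg_ex_vec _ D).
  move=> y y' e yy' [Xy [H1 [H2 H3]]].
  have yd : y d = y' d by rewrite yy'.
  rewrite -yd; split; last first.
    by do 2 split=> //; move=> j /andP[dj jD]; rewrite -yy'// H3// dj.
  have <- : splice d D y (fun n => e n.+1) = splice d D y' (fun n => e n.+1).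
    by apply/funext => k; rewrite /splice; case: ifP => // _; case: ifP => // /yy'.
  by [].
apply: semialg_and.
  apply: semialg_subst sX => k; rewrite /splice.
  by case: (k < d)%N; case: (k < D)%N; semialg.
do 2 (apply: semialg_and; first by semialg).
apply: (semialg_forall_nat (n := D)) => [j|j /andP[]//].
by semialg.
Qed.

(** Connects norms with the squares in [has_secants], which keep its conditions polynomial. *)
Lemma ltr_sqr_norm (x h : R) : 0 < h -> x ^+ 2 < h ^+ 2 <-> `|x| < h.
Proof.
move=> h0; rewrite -(real_normK (num_real x)).
by split; rewrite ltr_pXn2r// nnegrE ltW.
Qed.

(* The secants through e1 are triangular: moving coordinate k < d fixes the
   earlier coordinates, and moves the later ones at speed at most (l k)^-1. The
   coordinate d - 1 is treated first; it then joins the dependent block. *)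
Lemma triangular_secants d m X (B : R) : semialg X -> 0 < B ->
  (forall e, X e -> forall k, (k < d + m)%N -> `|e k| <= B) ->
  exists2 C : R, 0 < C & forall e n (kap c : R) (Q : {set {ffun 'I_d -> 'I_n}}),
    0 < kap -> Q != finset.set0 ->
    (forall q (w : nat -> R), q \in Q ->
      (forall k : 'I_d, c + (q k)%:R * kap <= w k <= c + (q k).+1%:R * kap) ->
      (forall k, (d + m <= k)%N -> w k = e k) ->
      exists e', agree_off d m w e' /\ X e') ->
    exists l e1 : nat -> R, [/\ forall k, (k < d)%N -> 0 < l k <= n%:R * kap,
      #|Q|%:R * kap ^+ d <= C * harmonic_sum R n ^+ d * \prod_(k < d) l k,
      forall k, (d + m <= k)%N -> e1 k = e k, X e1 &
      forall k, (k < d)%N -> forall h, 0 < h -> exists e', [/\ X e',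
        forall j, (j < k)%N || (d + m <= j)%N -> e' j = e1 j,
        0 < `|e' k - e1 k|, `|e' k - e1 k| < h &
        forall j, (k < j < d + m)%N -> l k * `|e' j - e1 j| <= `|e' k - e1 k|]].
Proof.
elim: d m X => [|d IH] m X sX B0 XB.
  exists 1 => // e n kap c Q kap0 /set0Pn[q qQ] QX.
  have [[]//|//|e1 [ee1 Xe1]] := QX q e qQ.
  exists (fun=> 1), e1; split=> //; last first.
    by move=> k mk; apply: ee1; rewrite -leqNgt in mk *; case: ltnP mk => //; lia.
  rewrite !expr0 big_ord0 !mulr1.
  have -> : Q = [set q].
    apply/setP => q'; rewrite !inE (_ : q' = q) ?eqxx//.
    by apply/ffunP => -[].
  by rewrite cards1.
pose D := (d + m.+1)%N.
have dD : (d < D)%N by rewrite /D; lia.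
have DE : D = (d.+1 + m)%N by rewrite /D addSnnS.
have [|K K1 LK] := @semialg_derived_number _ X d m B sX B0.
  by move=> e /XB Xe k kd; apply: Xe; move: kd; clear; lia.
have K0 : 0 < K by exact: lt_le_trans K1.
pose Xd e := exists e', agree_off d.+1 m e e' /\ X e'.
have [M tM] := semialg_tame d (semialg_ex_block d.+1 m sX : semialg Xd).
pose X' := has_secants X d D.
have sX' : semialg X' by exact: semialg_has_secants.
(* In [X'] coordinate [d] belongs to the dependent block, which still ends at [D]. The speed is a
   coordinate of [X'], so [C'] is fixed before the speed is known. *)
have [|C' C'0 IHX] := IH m.+1 X' sX' B0.
  move=> v [/XB Xv _] k kD; have := Xv k; rewrite -DE => /(_ kD).
  by rewrite /splice kD; case: ifP.
(* [M.+1] is lost in passing from cells to an interval, [K] in passing from an interval to a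
   slope. *)
exists (C' * (M.+1%:R * K)); first by rewrite !mulr_gt0.
move=> e n kap c Q kap0 Q0 QX.
pose f q := #|[set i | ffun_rcons q i \in Q]|.
have fQ : (\sum_q f q = #|Q|)%N by rewrite -card_ffun_rcons.
have fn q : (f q <= n)%N by rewrite -[leqRHS]card_ord max_card.
have [||mm mm0 Hmm] := @harmonic_pigeonhole R _ f n.
- exact: fn.
- by rewrite fQ card_gt0.
pose Q' := [set q | (mm <= f q)%N].
have Q'0 : Q' != finset.set0.
  apply/negP => /eqP Q'0; move: Hmm; rewrite -/Q' Q'0 cards0 !mulr0 fQ.
  by rewrite lern0 cards_eq0 (negbTE Q0).
(* A row of [Q'] has at least [mm] cells, so the section of [Xd] contains an interval of length
   [mm * kap / M.+1], on which [semialg_derived_number] gives slopes at most [lam^-1]. The value is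
   common to all rows of [Q'] and is stored in coordinate [D]. *)
pose lam := mm%:R * kap / (M.+1%:R * K).
have lam0 : 0 < lam by rewrite divr_gt0 ?mulr_gt0// ltr0n.
pose e' k := if k == D then lam else if (D < k)%N then e k.-1 else e k.
have [|l [v1 [l0 cardQ' v1tail Xv1 v1sec]]] := IHX e' n kap c Q' kap0 Q'0.
  move=> q w; rewrite inE => fq wq wtail.
  pose u := splice d D w w.
  have wD : w D = lam by rewrite wtail ?/e' ?eqxx.
  have utail k : (D <= k)%N -> u k = e k.
    move=> Dk; rewrite /u /splice !ltnNge Dk (leq_trans (ltnW dD) Dk) /=.
    rewrite wtail; last by rewrite -/D leqW.
    rewrite /e' ltnS Dk; case: eqP => // kD.
    by move: Dk; rewrite -kD ltnn.
  have [r rM Tr] := tM u.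
  pose J := [set i | ffun_rcons q i \in Q].
  have J0 : J != finset.set0 by rewrite -card_gt0 (leq_trans mm0).
  have [|a [b [ab Sab lenab]]] := tame_interval (c := c) Tr kap0 J0.
    move=> i; rewrite inE => qi s si; apply: (QX _ _ qi).
      move=> k; rewrite ffunE; case: unliftP => [k' ->|->].
        have kd : (lift ord_max k' < d)%N by rewrite lift_max.
        have := wq k'; rewrite /upd ltn_eqF// /u /splice kd.
        by rewrite lift_max.
      by rewrite /upd eqxx.
    move=> k; rewrite -DE => Dk; rewrite /upd gtn_eqF ?utail//.
    exact: leq_trans dD Dk.
  have [s sab|e1 [ue1 e1ab Xe1 e1sec]] := LK u a b ab.
    have [e2 [ue2 Xe2]] := Sab s sab.
    exists e2; split=> //; last first.
      by rewrite ue2 ?updE// ltnn.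
    move=> k kd; rewrite ue2 /upd; last by move: kd; clear; lia.
    by case: eqP => // kd'; move: kd; rewrite kd'; clear; lia.
  pose v k := if (k < D)%N then e1 k else w k.
  have e1lo k : (k < d)%N -> e1 k = w k.
    move=> kd; rewrite ue1; last by rewrite leqNgt kd.
    by rewrite /u /splice kd.
  have e1hi k : (D <= k)%N -> e1 k = w k.+1.
    move=> Dk; rewrite ue1; last by rewrite -/D (ltnNge k) Dk andbF.
    by rewrite /u /splice !ltnNge Dk (leq_trans (ltnW dD) Dk).
  have vE : splice d D v v = e1.
    apply/funext => k; rewrite /splice /v; case: (ltnP k D) => kD.
      by case: ifP.
    by rewrite !ltnNge (leq_trans (ltnW dD) kD) leqW//= e1hi.
  exists v; split.
    move=> k kd; rewrite /v; case: ifP => // kD; apply: e1lo.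
    by move: kd kD; rewrite /D; clear; lia.
  split; first by rewrite vE.
  move=> h /e1sec[e2 [ue2 Xe2 d0 dh dsec]].
  exists e2; have -> : splice d D e2 v = e2.
    apply/funext => k; rewrite /splice /v; case: (ltnP k d) => kd.
      rewrite (ltn_trans kd dD) e1lo// ue2; last by rewrite leqNgt kd.
      by rewrite /u /splice kd.
    case: (ltnP k D) => kD //; rewrite ltnNge leqW//=.
    rewrite -e1hi// ue2 ?ue1//; rewrite -/D (ltnNge k) kD andbF//.
  have vd : v d = e1 d by rewrite /v dD.
  have h0 : 0 < h by exact: lt_trans dh.
  rewrite vd; split=> //; split.
    by rewrite exprn_even_gt0//= -normr_gt0.
  split; first exact/ltr_sqr_norm.
  move=> j /andP[dj jD]; rewrite /v jD ltnn wD.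
  rewrite -[leLHS](real_normK (num_real _)) -[leRHS](real_normK (num_real _)).
  rewrite ler_pXn2r ?nnegrE//.
  rewrite normrM (gtr0_norm lam0).
  have := dsec j; rewrite dj -/D jD => /(_ isT) /(ler_wpM2l (ltW lam0)) le1.
  apply: (le_trans le1); rewrite mulrA ler_piMl//.
  have ba0 : 0 < b - a by rewrite subr_gt0.
  rewrite mulrA ler_pdivrMr// mul1r /lam invfM mulrA divfK ?gt_eqF//.
  rewrite ler_pdivrMr ?ltr0n// mulrC [leRHS]mulrC.
  apply: le_trans (le_trans lenab _).
    by rewrite ler_pM2l// ler_nat.
  by rewrite ler_pM2r// ler_nat.
pose l' k := if (k < d)%N then l k else lam.
exists l', (splice d D v1 v1).
have v1D : v1 D = lam by rewrite v1tail ?/e' ?eqxx.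
have v1hi k : (D <= k)%N -> splice d D v1 v1 k = e k.
  move=> Dk; rewrite /splice !ltnNge Dk (leq_trans (ltnW dD) Dk) /=.
  rewrite v1tail; last by rewrite -/D leqW.
  rewrite /e' ltnS Dk; case: eqP => // kD.
  by move: Dk; rewrite -kD ltnn.
have v1lo k : (k < D)%N -> splice d D v1 v1 k = v1 k.
  by move=> kD; rewrite /splice kD; case: ifP.
split.
- move=> k _; rewrite /l'; case: ifP => [/l0//|_]; rewrite lam0 /=.
  have /set0Pn[q] := Q'0; rewrite inE => /leq_trans/(_ (fn q)) mmn.
  rewrite /lam ler_pdivrMr ?mulr_gt0// -mulrA ler_pM// ?ler_nat//.
    by rewrite ltW.
  by apply: ler_peMr (ltW kap0) _; apply: mulr_ege1; rewrite ?ler1n.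
- rewrite big_ord_recr /= {2}/l' ltnn.
  under eq_bigr => k _ do rewrite /l' ltn_ord.
  rewrite -fQ; set H := harmonic_sum R n in Hmm cardQ' *.
  have H0 : 0 <= H by exact: harmonic_sum_ge0.
  apply: (@le_trans _ _ (H * (mm%:R * #|Q'|%:R) * kap ^+ d.+1)).
    by rewrite ler_wpM2r// exprn_ge0// ltW.
  have -> : H * (mm%:R * #|Q'|%:R) * kap ^+ d.+1 =
     (H * (mm%:R * kap)) * (#|Q'|%:R * kap ^+ d) by rewrite exprS; ring.
  apply: (le_trans (ler_wpM2l _ cardQ')).
    by rewrite mulr_ge0// mulr_ge0// ltW.
  rewrite le_eqVlt; apply/orP; left; apply/eqP.
  have -> : mm%:R * kap = lam * (M.+1%:R * K).
    by rewrite /lam divfK// gt_eqF// mulr_gt0.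
  by rewrite exprS; ring.
- by rewrite -DE.
- by case: Xv1.
(* For [k = d] the secants are part of membership in [X']; for [k < d] they come from the induction
   and end in [X'], hence in [X]. *)
- move=> k; rewrite ltnS leq_eqVlt => /orP[/eqP ->|kd] h h0.
    case: Xv1 => _ /(_ h h0)[y [Xy [d0 [dh dsec]]]].
    have yE j : (d <= j)%N -> (j < D)%N -> splice d D y v1 j = y j.
      by move=> dj jD; rewrite /splice ltnNge dj /= jD.
    exists (splice d D y v1); rewrite yE// v1lo//; split=> //.
    + move=> j; rewrite -DE => /orP[jd|Dj].
        by rewrite /splice jd.
      by rewrite /splice !ltnNge Dj (leq_trans (ltnW dD) Dj).
    + by rewrite normr_gt0; apply: contraTneq d0 => ->; rewrite expr0n ltxx.
    + exact/ltr_sqr_norm.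
    + move=> j; rewrite -DE => /andP[dj jD]; rewrite yE ?(ltnW dj)// v1lo//.
      have := dsec j; rewrite dj jD v1D => /(_ isT).
      rewrite -[X in X <= _](real_normK (num_real _)).
      rewrite -[X in _ <= X](real_normK (num_real _)) ler_pXn2r ?nnegrE//.
      by rewrite normrM (gtr0_norm lam0) /l' ltnn.
  have [v2 [[Xv2 _] v2off d0 dh dsec]] := v1sec k kd h h0.
  have kD : (k < D)%N by exact: ltn_trans dD.
  have v2lo j : (j < D)%N -> splice d D v2 v2 j = v2 j.
    by move=> jD; rewrite /splice jD; case: ifP.
  exists (splice d D v2 v2); rewrite v1lo// v2lo//; split=> //.
  + move=> j; rewrite -DE => /orP[jk|Dj].
      have jD : (j < D)%N by exact: ltn_trans kD.
      by rewrite v1lo// v2lo// v2off// jk.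
    rewrite /splice !ltnNge Dj (leq_trans (ltnW dD) Dj) /=.
    by rewrite v2off// -/D leqW ?orbT.
  + move=> j; rewrite -DE => /andP[kj jD]; rewrite v1lo// v2lo//.
    by rewrite /l' kd dsec// kj.
Qed.

End TriangularSecants.

(** * Secants to a neighborhood of a hypersurface *)

Section VolumeBound.
Variable R : realType.

Definition det3 (r0 r1 r2 : nat -> R) : R :=
  r0 0%N * (r1 1%N * r2 2%N - r1 2%N * r2 1%N)
  - r0 1%N * (r1 0%N * r2 2%N - r1 2%N * r2 0%N)
  + r0 2%N * (r1 0%N * r2 1%N - r1 1%N * r2 0%N).

(** Cramer's rule: the determinant times [g j] is the sum of the products of the three rows with
    [g], each multiplied by a 2x2 minor, which is at most [2 * b ^+ 2]. *)
Lemma det3_bound (b c E : R) (n : nat -> nat -> R) (g : nat -> R) :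
  0 <= b -> 0 < c -> 0 <= E ->
  (forall i j, (i < 3)%N -> (j < 3)%N -> `|n i j| <= b) ->
  (forall i, (i < 3)%N -> `|\sum_(j < 3) n i j * g j| <= E) ->
  (exists2 j, (j < 3)%N & c <= `|g j|) ->
  `|det3 (n 0%N) (n 1%N) (n 2%N)| <= 6 * b ^+ 2 * E / c.
Proof.
have eqW (x y : R) : x = y -> x <= y by move=> ->.
move=> b0 c0 E0 nb ngE [j j3 cg]; set det := det3 _ _ _.
have {}ngE i : (i < 3)%N -> `|n i 0%N * g 0%N + n i 1%N * g 1%N + n i 2%N * g 2%N| <= E.
  by move=> /ngE; rewrite !big_ord_recr big_ord0 /= add0r.
have minor i1 i2 j1 j2 i : (i1 < 3)%N -> (i2 < 3)%N -> (j1 < 3)%N -> (j2 < 3)%N -> (i < 3)%N ->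
    `|(n i1 j1 * n i2 j2 - n i1 j2 * n i2 j1) *
      (n i 0%N * g 0%N + n i 1%N * g 1%N + n i 2%N * g 2%N)| <= 2 * b ^+ 2 * E.
  move=> *; rewrite normrM; apply: ler_pM => //; last exact: ngE.
  apply: (le_trans (ler_normB _ _)); rewrite !normrM expr2.
  have : `|n i1 j1| * `|n i2 j2| <= b * b by apply: ler_pM => //; exact: nb.
  have : `|n i1 j2| * `|n i2 j1| <= b * b by apply: ler_pM => //; exact: nb.
  lra.
suff le : `|det * g j| <= 6 * b ^+ 2 * E.
  rewrite ler_pdivlMr//; apply: le_trans le.
  by rewrite normrM ler_wpM2l.
have tri (x y z e : R) : `|x| <= e -> `|y| <= e -> `|z| <= e -> `|x + y + z| <= 3 * e.
  move=> xe ye ze; apply: (le_trans (ler_normD _ _)).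
  by have := ler_normD x y; lra.
rewrite (_ : 6 * b ^+ 2 * E = 3 * (2 * b ^+ 2 * E)); last by ring.
case: j j3 {cg} => [|[|[|//]]] _.
- apply: le_trans _ (tri _ _ _ _ (minor 1%N 2%N 1%N 2%N 0%N isT isT isT isT isT)
    (minor 2%N 0%N 1%N 2%N 1%N isT isT isT isT isT) (minor 0%N 1%N 1%N 2%N 2%N isT isT isT isT isT)).
  by apply: eqW; congr Num.norm; rewrite /det /det3; ring.
- apply: le_trans _ (tri _ _ _ _ (minor 1%N 2%N 2%N 0%N 0%N isT isT isT isT isT)
    (minor 2%N 0%N 2%N 0%N 1%N isT isT isT isT isT) (minor 0%N 1%N 2%N 0%N 2%N isT isT isT isT isT)).
  by apply: eqW; congr Num.norm; rewrite /det /det3; ring.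
- apply: le_trans _ (tri _ _ _ _ (minor 1%N 2%N 0%N 1%N 0%N isT isT isT isT isT)
    (minor 2%N 0%N 0%N 1%N 1%N isT isT isT isT isT) (minor 0%N 1%N 0%N 1%N 2%N isT isT isT isT isT)).
  by apply: eqW; congr Num.norm; rewrite /det /det3; ring.
Qed.

(** [c3] is the third divided difference at the four points; each division by a gap of at least [s]
    multiplies the bound by [2 / s]. *)
Lemma cubic_leading_coef (c0 c1 c2 c3 s E : R) (t : nat -> R) : 0 < s ->
  (forall k, (k < 3)%N -> t k + s <= t k.+1) ->
  (forall k, (k < 4)%N -> `|c0 + c1 * t k + c2 * t k ^+ 2 + c3 * t k ^+ 3| <= E) ->
  `|c3| <= 8 * E / s ^+ 3.
Proof.
move=> s0 ts qE.
have t01 := ts 0%N isT; have t12 := ts 1%N isT; have t23 := ts 2%N isT.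
have dd (x y e d : R) : `|x| <= e -> `|y| <= e -> s <= d -> `|(y - x) / d| <= 2 * e / s.
  move=> xe ye sd; have d0 : 0 < d by exact: lt_le_trans sd.
  have e0 : 0 <= 2 * e by rewrite mulr_ge0// (le_trans _ xe).
  rewrite normrM normfV (gtr0_norm d0).
  apply: ler_pM => //; first by rewrite invr_ge0 ltW.
    by have := ler_normB y x; lra.
  by rewrite lef_pV2// posrE.
have D01 : `|c1 + c2 * (t 0%N + t 1%N) + c3 * (t 0%N ^+ 2 + t 0%N * t 1%N + t 1%N ^+ 2)|
    <= 2 * E / s.
  have := dd _ _ _ (t 1%N - t 0%N) (qE 0%N isT) (qE 1%N isT).
  rewrite (_ : _ / _ = c1 + c2 * (t 0%N + t 1%N) + c3 * (t 0%N ^+ 2 + t 0%N * t 1%N + t 1%N ^+ 2)).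
    by apply; lra.
  by field; rewrite subr_eq0 gt_eqF//; lra.
have D12 : `|c1 + c2 * (t 1%N + t 2%N) + c3 * (t 1%N ^+ 2 + t 1%N * t 2%N + t 2%N ^+ 2)|
    <= 2 * E / s.
  have := dd _ _ _ (t 2%N - t 1%N) (qE 1%N isT) (qE 2%N isT).
  rewrite (_ : _ / _ = c1 + c2 * (t 1%N + t 2%N) + c3 * (t 1%N ^+ 2 + t 1%N * t 2%N + t 2%N ^+ 2)).
    by apply; lra.
  by field; rewrite subr_eq0 gt_eqF//; lra.
have D23 : `|c1 + c2 * (t 2%N + t 3%N) + c3 * (t 2%N ^+ 2 + t 2%N * t 3%N + t 3%N ^+ 2)|
    <= 2 * E / s.
  have := dd _ _ _ (t 3%N - t 2%N) (qE 2%N isT) (qE 3%N isT).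
  rewrite (_ : _ / _ = c1 + c2 * (t 2%N + t 3%N) + c3 * (t 2%N ^+ 2 + t 2%N * t 3%N + t 3%N ^+ 2)).
    by apply; lra.
  by field; rewrite subr_eq0 gt_eqF//; lra.
have D02 : `|c2 + c3 * (t 0%N + t 1%N + t 2%N)| <= 2 * (2 * E / s) / s.
  have := dd _ _ _ (t 2%N - t 0%N) D01 D12.
  rewrite (_ : _ / _ = c2 + c3 * (t 0%N + t 1%N + t 2%N)).
    by apply; lra.
  by field; rewrite subr_eq0 gt_eqF//; lra.
have D13 : `|c2 + c3 * (t 1%N + t 2%N + t 3%N)| <= 2 * (2 * E / s) / s.
  have := dd _ _ _ (t 3%N - t 1%N) D12 D23.
  rewrite (_ : _ / _ = c2 + c3 * (t 1%N + t 2%N + t 3%N)).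
    by apply; lra.
  by field; rewrite subr_eq0 gt_eqF//; lra.
have := dd _ _ _ (t 3%N - t 0%N) D02 D13.
rewrite (_ : _ / (t 3%N - t 0%N) = c3).
  rewrite (_ : 8 * E / s ^+ 3 = 2 * (2 * (2 * E / s) / s) / s); first by apply; lra.
  by field; rewrite gt_eqF.
by field; rewrite subr_eq0 gt_eqF//; lra.
Qed.


(* z is a point of Z at distance O(del) from (a + t w, t), with normalized error nu. *)
Definition near_line (Z : (nat -> R) -> Prop) (del : R) (w a : nat -> R) (t : R)
    (z nu : nat -> R) :=
  [/\ Z z, forall j, (j < 4)%N -> `|nu j| <= 1,
    forall i, (i < 3)%N -> a i + t * w i = z i + 2 * del * nu i
    & t = z 3%N + 2 * del * nu 3%N].

(** [g] is a normal to [Z] at [z] in a weak sense: secants within [Z] are orthogonal to it to first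
    order. No rate is asked, since the secants can be taken arbitrarily short. *)
Definition tangent_at (Z : (nat -> R) -> Prop) (z g : nat -> R) :=
  forall eta, 0 < eta -> exists2 r, 0 < r & forall s z', Z z' -> s < r ->
    (forall j, (j < 4)%N -> `|z' j - z j| <= s) ->
    `|\sum_(j < 4) g j * (z' j - z j)| <= eta * s.

Lemma norm_dot_le n (g x : nat -> R) u : (forall j, (j < n)%N -> `|g j| <= 1) ->
  (forall j, (j < n)%N -> `|x j| <= u) -> `|\sum_(j < n) g j * x j| <= n%:R * u.
Proof.
move=> g1 xu; apply: (le_trans (ler_norm_sum _ _ _)).
rewrite (@le_trans _ _ (\sum_(j < n) u))//; last first.
  by rewrite sumr_const card_ord mulr_natl.
apply: ler_sum => j _; rewrite normrM -[leRHS]mul1r.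
by apply: ler_pM => //; [exact: g1|exact: xu].
Qed.

(** Only [t] moves, so the point of the line moves by [t' - t] times [(w, 1)]. Its component along
    [g] is that of [z], at most [K * del] per unit of [t] by tangency, plus that of the error, at
    most [2 * del * (4 * K)]. *)
Lemma line_row Z del K w a t z nu g : 0 < del -> 0 < K ->
  near_line Z del w a t z nu -> (forall j, (j < 4)%N -> `|g j| <= 1) ->
  tangent_at Z z g ->
  (forall h, 0 < h -> exists t' z' nu', [/\ near_line Z del w a t' z' nu',
    0 < `|t' - t|, `|t' - t| < h,
    forall j, (j < 4)%N -> `|z' j - z j| <= K * `|t' - t| &
    forall j, (j < 4)%N -> `|nu' j - nu j| <= K * `|t' - t|]) ->
  `|\sum_(j < 3) g j * w j + g 3%N| <= 9 * K * del.
Proof.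
move=> d0 K0 [_ _ E E3] g1 /(_ _ d0)[r r0 tg] sec.
have [|t' [z' [nu' [[Zz' _ E' E3'] t0 th zK nuK]]]] := sec (r / K).
  by rewrite divr_gt0.
have /(tg _ _ Zz')/(_ zK) tz : K * `|t' - t| < r by rewrite mulrC -ltr_pdivlMr.
have tn := norm_dot_le g1 (x := fun j => nu' j - nu j) nuK.
have id : (\sum_(j < 3) g j * w j + g 3%N) * (t' - t) =
    \sum_(j < 4) g j * (z' j - z j) + 2 * del * \sum_(j < 4) g j * (nu' j - nu j).
  rewrite !big_ord_recr !big_ord0 /= !add0r.
  have e i : (i < 3)%N -> w i * (t' - t) = (z' i - z i) + 2 * del * (nu' i - nu i).
    by move=> i3; have := E i i3; have := E' i i3; lra.
  have e3 : t' - t = (z' 3%N - z 3%N) + 2 * del * (nu' 3%N - nu 3%N).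
    by rewrite {1}E3 {1}E3'; lra.
  rewrite 3!mulrDl -!mulrA !e// [in g 3%N * _]e3; ring.
have : `|(\sum_(j < 3) g j * w j + g 3%N) * (t' - t)| <= (9 * K * del) * `|t' - t|.
  rewrite id; apply: (le_trans (ler_normD _ _)).
  have : `|2 * del * \sum_(j < 4) g j * (nu' j - nu j)| <= 2 * del * (4%:R * (K * `|t' - t|)).
    by rewrite normrM gtr0_norm ?mulr_gt0// ler_wpM2l// ltW// mulr_gt0.
  by move: tz; lra.
by rewrite normrM ler_pM2r.
Qed.

(** The displacement of the point of the line contains [t' - t] times [(w, 1)], which is almost
    orthogonal to [g] by [line_row]. In units of [del * u] the terms are 1 for tangency, 8 for the
    normalized error, [9 * K] for the motion of [t], and 3 for the product of the motions of [t] and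
    [w]. *)
Lemma secant_row Z del K u w a t z nu w' a' t' z' nu' g : 0 < del -> 0 <= u ->
  near_line Z del w a t z nu -> near_line Z del w' a' t' z' nu' ->
  (forall j, (j < 4)%N -> `|g j| <= 1) ->
  `|\sum_(j < 3) g j * w j + g 3%N| <= 9 * K * del ->
  `|\sum_(j < 4) g j * (z' j - z j)| <= del * u ->
  `|t' - t| <= u -> (forall j, (j < 3)%N -> `|w' j - w j| <= del) ->
  (forall j, (j < 4)%N -> `|nu' j - nu j| <= u) ->
  `|\sum_(j < 3) g j * ((a' j - a j) + t * (w' j - w j))| <= (9 * K + 12) * del * u.
Proof.
move=> d0 u0 [_ _ E E3] [_ _ E' E3'] g1 gw gz tu wd nuu.
have tn := norm_dot_le g1 (x := fun j => nu' j - nu j) nuu.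
have tw : `|\sum_(j < 3) g j * (w' j - w j)| <= 3%:R * del.
  by apply: (norm_dot_le (x := fun j => w' j - w j)) => // j j3; apply: g1; exact: leqW.
have -> : \sum_(j < 3) g j * ((a' j - a j) + t * (w' j - w j)) =
    \sum_(j < 4) g j * (z' j - z j) + 2 * del * (\sum_(j < 4) g j * (nu' j - nu j))
    - (\sum_(j < 3) g j * w j + g 3%N) * (t' - t)
    - (t' - t) * \sum_(j < 3) g j * (w' j - w j).
  rewrite !big_ord_recr !big_ord0 /= !add0r.
  have e i : (i < 3)%N -> (a' i - a i) + t * (w' i - w i) = (z' i - z i) +
      2 * del * (nu' i - nu i) - w i * (t' - t) - (t' - t) * (w' i - w i).
    by move=> i3; have := E i i3; have := E' i i3; lra.
  rewrite !e//; have : g 3%N * (t' - t) = g 3%N * ((z' 3%N - z 3%N) + 2 * del * (nu' 3%N - nu 3%N)).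
    by rewrite {1}E3 {1}E3'; ring.
  by lra.
apply: (le_trans (ler_normB _ _)).
have : `|(t' - t) * \sum_(j < 3) g j * (w' j - w j)| <= u * (3%:R * del).
  by rewrite normrM; apply: ler_pM.
have : `|(\sum_(j < 3) g j * w j + g 3%N) * (t' - t)| <= 9 * K * del * u.
  by rewrite normrM; apply: ler_pM.
have : `|2 * del * (\sum_(j < 4) g j * (nu' j - nu j))| <= 2 * del * (4%:R * u).
  by rewrite normrM gtr0_norm ?mulr_gt0// ler_wpM2l// ltW// mulr_gt0.
set x1 := \sum_(j < 4) _ in gz *; set x2 := 2 * del * _; set x3 := _ * (t' - t).
have := ler_normB (x1 + x2) x3; have := ler_normD x1 x2.
by move: gz; lra.
Qed.

(** The constant sees only the speed [K] in [t], the spacing [s] and the bound [L]; the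
    hypersurface, [del] and the points come after it. The secants of the last hypothesis are
    triangular, so that [det W] is the product of the [l i]. *)
Lemma volume_bound (K s L : R) : 0 < K -> 0 < s -> 0 < L ->
  exists2 C : R, 0 < C & forall Z del w a t z nu (l : nat -> R),
    0 < del ->
    (forall p, Z p -> exists g, [/\ forall j, (j < 4)%N -> `|g j| <= 1,
       exists2 j, (j < 4)%N & `|g j| = 1 & tangent_at Z p g]) ->
    (forall i, (i < 3)%N -> `|w i| <= 3) ->
    (forall k, (k < 3)%N -> t k + s <= t k.+1) ->
    (forall k, (k < 4)%N -> `|t k| <= 3) ->
    (forall k, (k < 4)%N -> near_line Z del w a (t k) (z k) (nu k)) ->
    (forall k, (k < 4)%N -> forall h, 0 < h -> exists t' z' nu',
      [/\ near_line Z del w a t' z' nu', 0 < `|t' - t k|, `|t' - t k| < h,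
      forall j, (j < 4)%N -> `|z' j - z k j| <= K * `|t' - t k| &
      forall j, (j < 4)%N -> `|nu' j - nu k j| <= K * `|t' - t k|]) ->
    (forall i, (i < 3)%N -> 0 < l i <= L) ->
    (forall i, (i < 3)%N -> forall h, 0 < h -> exists w' a' t' z' nu',
      [/\ forall k, (k < 4)%N -> near_line Z del w' a' (t' k) (z' k) (nu' k),
       0 < `|w' i - w i|, `|w' i - w i| < h,
       forall j, (j < i)%N -> w' j = w j &
       [/\ forall j, (i < j < 3)%N -> l i * `|w' j - w j| <= `|w' i - w i|,
        forall j, (j < 3)%N -> l i * `|a' j - a j| <= `|w' i - w i|,
        forall k, (k < 4)%N -> l i * `|t' k - t k| <= `|w' i - w i|,
        forall k j, (k < 4)%N -> (j < 4)%N -> l i * `|z' k j - z k j| <= `|w' i - w i| &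
        forall k j, (k < 4)%N -> (j < 4)%N -> l i * `|nu' k j - nu k j| <= `|w' i - w i|]]) ->
    l 0%N * l 1%N * l 2%N <= C * del.
Proof.
move=> K0 s0 L0.
(* [b] bounds the entries of [A + t W]: [1 + 3 * (1 + L)]. [E] is the constant of [secant_row]. *)
pose b := 4 + 3 * L; pose E := 9 * K + 12.
pose C1 := L * L * L * (18 * K).
pose C2 := 8 * (6 * b ^+ 2 * E / (20^-1)) / s ^+ 3.
have b0 : 0 < b by rewrite /b; lra.
have E0 : 0 < E by rewrite /E; lra.
have C10 : 0 < C1 by rewrite /C1 !mulr_gt0.
have C20 : 0 < C2 by rewrite /C2 divr_gt0 ?exprn_gt0// mulr_gt0// divr_gt0// !mulr_gt0// exprn_gt0.
exists (C1 + C2) => [|Z del w a t z nu l d0 Ztan w3 ts t3 zl tsec lL wsec].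
  exact: addr_gt0.
have l0 i : (i < 3)%N -> 0 < l i by move=> /lL/andP[].
have lL' i : (i < 3)%N -> l i <= L by move=> /lL/andP[].
(* When [del] is not small compared with [K^-1], the trivial bound [L ^+ 3] is already O(del). *)
have [big|small] := ltP 1 (18 * K * del).
  have le3 : l 0%N * l 1%N * l 2%N <= L * L * L.
    apply: ler_pM (lL' _ _) => //; [|exact/ltW/l0|apply: ler_pM; rewrite ?lL'//].
    - by rewrite mulr_ge0// ltW// l0.
    - exact/ltW/l0.
    - exact/ltW/l0.
  apply: (le_trans le3); rewrite mulrDl.
  have : L * L * L * 1 <= L * L * L * (18 * K * del).
    by rewrite ler_wpM2l ?mulr_ge0 ?ltW.
  have : 0 < C2 * del by exact: mulr_gt0.
  rewrite /C1; lra.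
have /choice[g gP] k : exists g, (k < 4)%N -> [/\ forall j, (j < 4)%N -> `|g j| <= 1,
    exists2 j, (j < 4)%N & `|g j| = 1 & tangent_at Z (z k) g].
  have [k4|] := boolP (k < 4)%N; last by exists (fun=> 0).
  by have [Zz _ _ _] := zl k k4; have [g gP] := Ztan _ Zz; exists g.
have g1 k : (k < 4)%N -> forall j, (j < 4)%N -> `|g k j| <= 1 by move=> /gP[].
have grow k : (k < 4)%N -> `|\sum_(j < 3) g k j * w j + g k 3%N| <= 9 * K * del.
  move=> k4; apply: line_row (tsec k k4) => //; [exact: zl|exact: g1|].
  by have [] := gP k k4.
(* Otherwise the last entry of [g k] has absolute value 1 while the product of the others with [w]
   is at most 9 / 20. This contradicts [grow], whose bound is now at most 1 / 2. *)
have g20 k : (k < 4)%N -> exists2 j, (j < 3)%N & 20^-1 <= `|g k j|.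
  move=> k4; have [_ [j j4 gj] _] := gP k k4.
  move: j4; rewrite ltnS leq_eqVlt => /orP[/eqP j3|j3]; last first.
    by exists j => //; rewrite gj; lra.
  apply: contrapT => no.
  have sm i : (i < 3)%N -> `|g k i| <= 20^-1.
    move=> i3; rewrite leNgt; apply/negP => lt; apply: no; exists i => //.
    exact: ltW.
  have : `|\sum_(j < 3) g k j * w j| <= 3%:R * (3 / 20).
    apply: (le_trans (ler_norm_sum _ _ _)).
    rewrite (@le_trans _ _ (\sum_(j < 3) 3 / 20))//; last first.
      by rewrite sumr_const card_ord [leRHS]mulr_natl.
    apply: ler_sum => i _; rewrite normrM mulrC; apply: ler_pM => //.
      exact: w3.
    exact: sm.
  have := grow k k4; have := ler_normB (\sum_(j < 3) g k j * w j + g k 3%N) (\sum_(j < 3) g k j * w j).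
  rewrite addrC addKr; move: gj; rewrite j3 => ->.
  by move: small; lra.
have /choice[r rP] k : exists r, (k < 4)%N -> 0 < r /\ forall u z', Z z' -> u < r ->
    (forall j, (j < 4)%N -> `|z' j - z k j| <= u) ->
    `|\sum_(j < 4) g k j * (z' j - z k j)| <= del * u.
  have [k4|] := boolP (k < 4)%N; last by exists 0.
  by have [_ _ /(_ _ d0)[r r0 rP]] := gP k k4; exists r.
pose r0 := Num.min (Num.min (r 0%N) (r 1%N)) (Num.min (r 2%N) (r 3%N)).
have r00 : 0 < r0.
  rewrite /r0 !lt_min; apply/andP; split; apply/andP; split;
  by [have [] := rP 0%N isT|have [] := rP 1%N isT|have [] := rP 2%N isT|have [] := rP 3%N isT].
have r0r k : (k < 4)%N -> r0 <= r k.
  by case: k => [|[|[|[|//]]]] _; rewrite /r0 !ge_min lexx ?orbT.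
have rows i : exists AW : (nat -> R) * (nat -> R), (i < 3)%N ->
    [/\ forall j, (j < 3)%N -> `|AW.1 j| <= 1, AW.2 i = l i,
     forall j, (j < i)%N -> AW.2 j = 0, forall j, (i < j < 3)%N -> `|AW.2 j| <= 1 &
     forall k, (k < 4)%N -> `|\sum_(j < 3) (AW.1 j + t k * AW.2 j) * g k j| <= E * del].
  have [i3|] := boolP (i < 3)%N; last by exists (fun=> 0, fun=> 0).
  have li := l0 i i3.
  (* So short that all four points [z k] stay within their radii of tangency and [w] moves by at
     most [del]. *)
  pose h := Num.min del (Num.min (l i * del) (l i * r0)).
  have h0 : 0 < h by rewrite !lt_min d0 !mulr_gt0.
  have [w' [a' [t' [z' [nu' [zl' rho0 rhoh wlo [wu au tu zu nuu]]]]]]] := wsec i i3 h h0.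
  set rho := `|w' i - w i| in rho0 rhoh wu au tu zu nuu.
  move: rhoh; rewrite !lt_min => /and3P[rd rld rlr].
  have div x : l i * x <= rho -> x <= rho / l i.
    by move=> le; rewrite ler_pdivlMr// mulrC.
  have u0 : 0 <= rho / l i by rewrite divr_ge0 ?ltW.
  have ud : rho / l i <= del by rewrite ler_pdivrMr// mulrC ltW.
  have ur : rho / l i < r0 by rewrite ltr_pdivrMr// mulrC.
  have wd j : (j < 3)%N -> `|w' j - w j| <= del.
    move=> j3; have [ji|ij|->] := ltngtP j i.
    - by rewrite wlo// subrr normr0 ltW.
    - by apply: le_trans ud; apply: div; apply: wu; rewrite ij.
    - exact: ltW.
  have wi0 : w' i - w i != 0 by rewrite -normr_gt0.
  (* Rescales the secant so that its own slope coordinate moves by exactly [l i]; the later slopes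
     and [a] then move by at most 1. *)
  pose m := l i / (w' i - w i).
  have mE x : `|m * x| = l i * `|x| / rho.
    by rewrite /m normrM normrM normfV (gtr0_norm li) mulrAC.
  exists (fun j => m * (a' j - a j), fun j => m * (w' j - w j)) => _; split=> /=.
  - by move=> j j3; rewrite mE ler_pdivrMr// mul1r au.
  - by rewrite /m divfK.
  - by move=> j ji; rewrite wlo// subrr mulr0.
  - by move=> j j3; rewrite mE ler_pdivrMr// mul1r wu.
  move=> k k4; have [_ rk] := rP k k4; have zlk' := zl' k k4.
  have row := @secant_row Z del K (rho / l i) w a (t k) (z k) (nu k) w' a' (t' k) (z' k) (nu' k)
    (g k) d0 u0 (zl k k4) zlk' (g1 k k4) (grow k k4).
  have -> : \sum_(j < 3) (m * (a' j - a j) + t k * (m * (w' j - w j))) * g k j =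
      m * \sum_(j < 3) g k j * ((a' j - a j) + t k * (w' j - w j)).
    by rewrite mulr_sumr; apply: eq_bigr => j _; ring.
  rewrite mE ler_pdivrMr// mulrC -ler_pdivlMr// -mulrA; apply: row.
  - have [Zz' _ _ _] := zlk'; apply: rk => //.
      exact: lt_le_trans (r0r k k4).
    by move=> j j4; apply: div; exact: zu.
  - by apply: div; exact: tu.
  - exact: wd.
  - by move=> j j4; apply: div; exact: nuu.
have /choice[AW AWP] := rows.
pose A i := (AW i).1; pose W i := (AW i).2.
have [W00 W11 W22] : [/\ W 0%N 0%N = l 0%N, W 1%N 1%N = l 1%N & W 2%N 2%N = l 2%N].
  by split; [case: (AWP 0%N isT)|case: (AWP 1%N isT)|case: (AWP 2%N isT)].
have [W10 W20 W21] : [/\ W 1%N 0%N = 0, W 2%N 0%N = 0 & W 2%N 1%N = 0].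
  have [_ _ W1 _ _] := AWP 1%N isT; have [_ _ W2 _ _] := AWP 2%N isT.
  by split; [exact: W1|exact: W2|exact: W2].
have detE k : (k < 4)%N ->
    `|det3 (fun j => A 0%N j + t k * W 0%N j) (fun j => A 1%N j + t k * W 1%N j)
       (fun j => A 2%N j + t k * W 2%N j)| <= 6 * b ^+ 2 * (E * del) / 20^-1.
  move=> k4.
  apply: (@det3_bound b 20^-1 (E * del) (fun i j => A i j + t k * W i j) (g k)) => //.
  - exact: ltW.
  - by rewrite mulr_ge0// ltW.
  - move=> i j i3 j3; have [A1 Wi Wlo Whi _] := AWP i i3.
    have Wb : `|W i j| <= 1 + L.
      have [ji|ij|->] := ltngtP j i.
      + by rewrite /W Wlo// normr0; move: L0; lra.
      + have := Whi j; rewrite ij j3 => /(_ isT) le; apply: (le_trans le).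
        by move: L0; lra.
      + by rewrite /W Wi (gtr0_norm (l0 i i3)); have := lL' i i3; lra.
    apply: (le_trans (ler_normD _ _)); rewrite normrM.
    have : `|t k| * `|W i j| <= 3 * (1 + L) by apply: ler_pM => //; exact: t3.
    by have := A1 j j3; rewrite -/(A i) /b; lra.
  - by move=> i i3; have [_ _ _ _ /(_ k k4)] := AWP i i3.
  - exact: g20.
have := @cubic_leading_coef (det3 (A 0%N) (A 1%N) (A 2%N))
  (det3 (W 0%N) (A 1%N) (A 2%N) + det3 (A 0%N) (W 1%N) (A 2%N) + det3 (A 0%N) (A 1%N) (W 2%N))
  (det3 (A 0%N) (W 1%N) (W 2%N) + det3 (W 0%N) (A 1%N) (W 2%N) + det3 (W 0%N) (W 1%N) (A 2%N))
  (det3 (W 0%N) (W 1%N) (W 2%N)) s (6 * b ^+ 2 * (E * del) / 20^-1) t s0 ts.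
have -> : det3 (W 0%N) (W 1%N) (W 2%N) = l 0%N * l 1%N * l 2%N.
  by rewrite /det3 W00 W11 W22 W10 W20 W21; ring.
move=> key; apply: (@le_trans _ _ (C2 * del)); last first.
  by rewrite ler_pM2r// lerDr ltW.
apply: (le_trans (ler_norm _)); apply: (le_trans (key _)).
  move=> k k4; apply: le_trans (detE k k4).
  rewrite le_eqVlt; apply/orP; left; apply/eqP; congr Num.norm.
  by rewrite /det3 W00 W11 W22 W10 W20 W21; ring.
rewrite le_eqVlt; apply/orP; left; apply/eqP; rewrite /C2.
by ring.
Qed.

End VolumeBound.

(** * Segments of lines near a semialgebraic family *)

Section Core.
Variable R : realType.

Lemma semialg_norm_le (f g : (nat -> R) -> R) : polyfun f -> polyfun g ->
  semialg (fun e => `|f e| <= g e).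
Proof.
move=> pf pg; apply: (@semialg_iff _ (fun e => - g e <= f e /\ f e <= g e)).
  by semialg.
by move=> e; rewrite ler_norml; split=> [[-> ->]|/andP[]].
Qed.

(** Coordinates 0-3 of [Zs] are a point of space, and those from 4 on, filled by [p], select a
    member of the family. *)
Definition fiber (Zs : (nat -> R) -> Prop) (p : nat -> R) (z : nat -> R) : Prop :=
  Zs (fun k => if (k < 4)%N then z k else p (k - 4)%N).

Lemma fiber_ext Zs p z z' : (forall j, (j < 4)%N -> z j = z' j) ->
  fiber Zs p z -> fiber Zs p z'.
Proof.
rewrite /fiber => zz'.
suff -> : (fun k => if (k < 4)%N then z k else p (k - 4)%N) =
          (fun k => if (k < 4)%N then z' k else p (k - 4)%N) by [].
by apply/funext => k; case: ifP => // /zz'.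
Qed.

(* Coordinates: t at 0, z at 1-4, nu at 5-8, w at 9-11, a at 12-14, del at 15,
   the parameters of the family Zs from 16 on. *)
Definition contact (Zs : (nat -> R) -> Prop) (e : nat -> R) : Prop :=
  near_line (fiber Zs (fun k => e (16 + k)%N)) (e 15%N) (fun k => e (9 + k)%N)
    (fun k => e (12 + k)%N) (e 0%N) (fun k => e (1 + k)%N) (fun k => e (5 + k)%N).

Lemma semialg_contact Zs : semialg Zs -> semialg (contact Zs).
Proof.
move=> sZ.
apply: (@semialg_iff _ (fun e =>
  fiber Zs (fun k => e (16 + k)%N) (fun k => e (1 + k)%N) /\
  ((forall j, (j < 4)%N -> `|e (5 + j)%N| <= 1) /\
  ((forall i, (i < 3)%N -> e (12 + i)%N + e 0%N * e (9 + i)%N =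
      e (1 + i)%N + 2 * e 15%N * e (5 + i)%N) /\
  e 0%N = e (1 + 3)%N + 2 * e 15%N * e (5 + 3)%N)))); last first.
  by move=> e; split=> [[? [? [? ?]]]|[]].
apply: semialg_and.
  by apply: semialg_subst sZ => k; case: (k < 4)%N; semialg.
apply: semialg_and.
  by apply: (semialg_forall_nat (n := 4)) => // j; apply: semialg_norm_le; semialg.
apply: semialg_and; last by semialg.
by apply: (semialg_forall_nat (n := 3)) => // j; semialg.
Qed.

(** Makes room at coordinate 9, where [has_secants] with [D = 9] expects the inverse Lipschitz
    constant. *)
Definition insert9 (lam : R) (e : nat -> R) : nat -> R :=
  fun k => if (k < 9)%N then e k else if k == 9%N then lam else e k.-1.

Lemma splice_insert9 lam e y :
  splice 0 9 y (insert9 lam e) = fun k => if (k < 9)%N then y k else e k.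
Proof.
apply/funext => k; rewrite /splice /insert9 ltn0; case: ltnP => // k9.
by rewrite ltnNge leqW //= gtn_eqF.
Qed.

(** Translates the layout of [contacts] into that of [contact]: group [k] goes to 0-8, [w] and [a]
    to 9-14, and [del] with the parameters to 15 and beyond. *)
Definition block (k : nat) (e : nat -> R) : nat -> R := fun j =>
  if (j < 9)%N then e (6 + 9 * k + j)%N else
  if (j < 15)%N then e (j - 9)%N else e (j + 27)%N.

(* Coordinates: w at 0-2, a at 3-5, four groups (t, z, nu) from 6 to 41, del at
   42, parameters from 43 on. *)
Definition contacts Zs (lam s : R) (e : nat -> R) : Prop :=
  [/\ forall k, (k < 4)%N -> has_secants (contact Zs) 0 9 (insert9 lam (block k e)),
      forall k, (k < 3)%N -> e (6 + 9 * k)%N + s <= e (6 + 9 * k.+1)%N,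
      0 < e 42%N <= 1 & forall i, (i < 3)%N -> `|e i| <= 3].

Lemma semialg_contacts Zs lam s : semialg Zs -> semialg (contacts Zs lam s).
Proof.
move=> sZ; have sX := semialg_has_secants (isT : (0 < 9)%N) (semialg_contact sZ).
apply: (@semialg_iff _ (fun e =>
  (forall k, (k < 4)%N -> has_secants (contact Zs) 0 9 (insert9 lam (block k e))) /\
  ((forall k, (k < 3)%N -> e (6 + 9 * k)%N + s <= e (6 + 9 * k.+1)%N) /\
   ((0 < e 42%N /\ e 42%N <= 1) /\ forall i, (i < 3)%N -> `|e i| <= 3)))); last first.
  move=> e; split=> [[? [? [[e0 e1] ?]]]|[? ? /andP[]]]; last by [].
  by split=> //; rewrite e0.
apply: semialg_and.
  apply: (semialg_forall_nat (n := 4)) => // k; apply: semialg_subst sX => j.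
  rewrite /insert9 /block; case: (j < 9)%N; first by semialg.
  case: (j == 9%N); first by semialg.
  by case: (j.-1 < 9)%N; [semialg|case: (j.-1 < 15)%N; semialg].
apply: semialg_and.
  by apply: (semialg_forall_nat (n := 3)) => // j; semialg.
apply: semialg_and; first by semialg.
by apply: (semialg_forall_nat (n := 3)) => // j; apply: semialg_norm_le; semialg.
Qed.

Lemma contact_le1 Zs e : (forall e, Zs e -> forall j, (j < 4)%N -> `|e j| <= 1) ->
  contact Zs e -> forall j, (0 < j < 9)%N -> `|e j| <= 1.
Proof.
move=> Zbox [Zz nu1 _ _].
have z1 j : (j < 4)%N -> `|e (1 + j)%N| <= 1.
  by move=> j4; have := Zbox _ Zz j j4; rewrite j4.
by do 9 (case=> [//|]; try (move=> _; first
  [exact: (z1 0%N)|exact: (z1 1%N)|exact: (z1 2%N)|exact: (z1 3%N)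
  |exact: (nu1 0%N)|exact: (nu1 1%N)|exact: (nu1 2%N)|exact: (nu1 3%N)])).
Qed.

Lemma contact_bound Zs e : (forall e, Zs e -> forall j, (j < 4)%N -> `|e j| <= 1) ->
  contact Zs e -> 0 < e 15%N <= 1 ->
  (forall j, (j < 9)%N -> `|e j| <= 3) /\
  (forall i, (i < 3)%N -> `|e (9 + i)%N| <= 3 -> `|e (12 + i)%N| <= 12).
Proof.
move=> Zbox Xe /andP[d0 d1]; have le1 := contact_le1 Zbox Xe.
have [_ _ E E3] := Xe.
have dnu j : (j < 4)%N -> `|e (1 + j)%N + 2 * e 15%N * e (5 + j)%N| <= 3.
  move=> j4; apply: (le_trans (ler_normD _ _)).
  rewrite normrM gtr0_norm ?mulr_gt0//.
  have : 2 * e 15%N * `|e (5 + j)%N| <= 2 * 1.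
    apply: ler_pM => //; [by rewrite mulr_ge0 ?ltW| lra|].
    by apply: le1; move: j4; clear; lia.
  have : `|e (1 + j)%N| <= 1 by apply: le1; move: j4; clear; lia.
  lra.
have t3 : `|e 0%N| <= 3 by rewrite E3; exact: dnu.
split=> //.
  by case=> [_|j j9] //; apply: (le_trans (le1 _ _)); [exact: j9|lra].
move=> i i3 w3; rewrite (_ : e (12 + i)%N = e (1 + i)%N + 2 * e 15%N * e (5 + i)%N - e 0%N * e (9 + i)%N).
  apply: (le_trans (ler_normB _ _)); rewrite normrM.
  have := dnu i (leqW i3).
  have : `|e 0%N| * `|e (9 + i)%N| <= 3 * 3 by apply: ler_pM.
  lra.
by have := E i i3; lra.
Qed.

Lemma contacts_contact Zs lam s e k : contacts Zs lam s e -> (k < 4)%N ->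
  contact Zs (block k e).
Proof.
move=> [/(_ k) H _ _ _] /H[+ _].
rewrite splice_insert9 (_ : (fun j => _) = block k e)//.
by apply/funext => j; rewrite /insert9; case: ltnP.
Qed.

Lemma contacts_near Zs lam s e k : contacts Zs lam s e -> (k < 4)%N ->
  near_line (fiber Zs (fun j => e (43 + j)%N)) (e 42%N) e (fun i => e (3 + i)%N)
    (e (6 + 9 * k)%N) (fun j => e (7 + 9 * k + j)%N) (fun j => e (11 + 9 * k + j)%N).
Proof.
move=> Xe k4; have [Zz nu1 E E3] := contacts_contact Xe k4.
have idx j : (j < 9)%N -> block k e j = e (6 + 9 * k + j)%N by move=> j9; rewrite /block j9.
have zE j : (j < 4)%N -> block k e (1 + j)%N = e (7 + 9 * k + j)%N.
  by move=> j4; rewrite idx; [congr e|]; move: j4; clear; lia.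
have nuE j : (j < 4)%N -> block k e (5 + j)%N = e (11 + 9 * k + j)%N.
  by move=> j4; rewrite idx; [congr e|]; move: j4; clear; lia.
have pE : (fun j => block k e (16 + j)%N) = (fun j => e (43 + j)%N).
  apply/funext => j; rewrite /block.
  have [-> ->] : (16 + j < 9)%N = false /\ (16 + j < 15)%N = false.
    by split; apply/negP => ?; lia.
  by congr e; clear; lia.
have t0E : block k e 0%N = e (6 + 9 * k)%N by rewrite idx// addn0.
split.
- by rewrite -pE; apply: fiber_ext Zz.
- by move=> j j4; rewrite -nuE// nu1.
- move=> i i3; have i4 := leqW i3.
  have aE : block k e (12 + i)%N = e (3 + i)%N by case: i i3 {i4} => [|[|[|//]]].
  have wE : block k e (9 + i)%N = e i by case: i i3 {i4 aE} => [|[|[|//]]].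
  by rewrite -aE -wE -t0E -(zE i)// -(nuE i)//; exact: E.
- by rewrite -t0E E3 zE// nuE.
Qed.

(** Definable choice needs bounded coordinates; these are the three slopes and the 39 coordinates
    that depend on them, all those before [del]. *)
Lemma contacts_bound Zs lam s e : (forall e, Zs e -> forall j, (j < 4)%N -> `|e j| <= 1) ->
  contacts Zs lam s e -> forall k, (k < 3 + 39)%N -> `|e k| <= 12.
Proof.
move=> Zbox Xe k k42; have [_ _ e42 e3] := Xe.
have cb q : (q < 4)%N -> _ := fun q4 => contact_bound Zbox (contacts_contact Xe q4) e42.
have [k3|k3] := ltnP k 3; first by have := e3 k k3; lra.
have [k6|k6] := ltnP k 6.
  have [_ /(_ (k - 3)%N)] := cb 0%N isT.
  rewrite (_ : block 0 e (12 + (k - 3)) = e k); last first.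
    by rewrite /block; case: k k3 k6 {k42} => [|[|[|[|[|[|]]]]]].
  apply; first by move: k3 k6; clear; lia.
  apply: (le_trans _ (e3 (k - 3)%N _)); last by move: k3 k6; clear; lia.
  by rewrite /block; case: k k3 k6 {k42} => [|[|[|[|[|[|]]]]]].
pose q := ((k - 6) %/ 9)%N; pose r := ((k - 6) %% 9)%N.
have r9 : (r < 9)%N by rewrite ltn_mod.
have q4 : (q < 4)%N by rewrite ltn_divLR//; move: k42 k6; clear; lia.
have kE : k = (6 + 9 * q + r)%N.
  by rewrite -addnA (mulnC 9) -divn_eq subnKC.
have [/(_ r r9) + _] := cb q q4.
by rewrite /block r9 -kE; lra.
Qed.

End Core.

(** * Counting grid cells of slopes *)

Section CellCount.
Variable R : realType.

Definition pack (p : nat -> R) (del : R) (w a : nat -> R) (t : R) (z nu : nat -> R)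
    : nat -> R := fun j =>
  if j == 0%N then t else if (j < 5)%N then z (j - 1)%N else
  if (j < 9)%N then nu (j - 5)%N else if (j < 12)%N then w (j - 9)%N else
  if (j < 15)%N then a (j - 12)%N else if j == 15%N then del else p (j - 16)%N.

Lemma contact_pack Zs p del w a t z nu :
  near_line (fiber Zs p) del w a t z nu -> contact Zs (pack p del w a t z nu).
Proof.
move=> [Zz nu1 E E3]; split=> /=.
- rewrite (_ : (fun k => _) = p); last first.
    by apply/funext => j; rewrite /pack /= addKn.
  by apply: fiber_ext Zz => -[|[|[|[|//]]]].
- by move=> -[|[|[|[|//]]]] _; [exact: (nu1 0%N)|exact: (nu1 1%N)|exact: (nu1 2%N)|exact: (nu1 3%N)].
- by move=> -[|[|[|//]]] _; [exact: (E 0%N)|exact: (E 1%N)|exact: (E 2%N)].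
- exact: E3.
Qed.

(** [C] is uniform over the family: [p] and [del] sit in the coordinates from 42 on, outside the
    block that [triangular_secants] moves. *)
Lemma cell_count_bound (Zs : (nat -> R) -> Prop) (len : R) : semialg Zs -> 0 < len ->
  (forall e, Zs e -> forall j, (j < 4)%N -> `|e j| <= 1) ->
  exists2 C : R, 0 < C & forall p del n (kap c : R) (Q : {set {ffun 'I_3 -> 'I_n}}),
    0 < del -> del <= 1 -> 0 < kap -> n%:R * kap <= 6 ->
    (forall z, fiber Zs p z -> exists g, [/\ forall j, (j < 4)%N -> `|g j| <= 1,
       exists2 j, (j < 4)%N & `|g j| = 1 & tangent_at (fiber Zs p) z g]) ->
    (forall q (w : nat -> R), q \in Q ->
      (forall k : 'I_3, c + (q k)%:R * kap <= w k <= c + (q k).+1%:R * kap) ->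
      (forall i, (i < 3)%N -> `|w i| <= 3) /\ exists a b, forall t, b <= t <= b + len ->
        exists z nu, near_line (fiber Zs p) del w a t z nu) ->
    #|Q|%:R * kap ^+ 3 <= C * harmonic_sum R n ^+ 3 * del.
Proof.
(* The segment is cut into seven pieces of length [s]. The pieces 0, 2, 4, 6 hold one contact each,
   and the others keep the contacts at least [s] apart. *)
move=> sZ len0 Zbox; pose s := len / 7; have s0 : 0 < s by rewrite divr_gt0.
have sX0 := semialg_contact sZ.
(* The line is fixed here: [t] moves, and [z] and [nu] are the dependent block. *)
have [K K1 LK] := @semialg_derived_number _ _ 0 8 _ sX0 ltr01 (fun e => contact_le1 Zbox (e := e)).
have K0 : 0 < K by exact: lt_le_trans K1.
pose lam := s / K; have lam0 : 0 < lam by rewrite divr_gt0.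
have sX2 := semialg_contacts lam s sZ.
have [C1 C10 secants] := triangular_secants sX2 (ltr0n R 12) (fun e => @contacts_bound _ _ lam s e Zbox).
(* The speed in [t] is [K] divided by the length [s] of a piece, and the speeds [l k] are at most
   [n * kap <= 6]. *)
have [|C2 C20 volume] := volume_bound (K := K / s) (s := s) (L := 6) _ s0 (ltr0n R 6).
  by rewrite divr_gt0.
exists (C1 * C2); first exact: mulr_gt0.
move=> p del n kap c Q d0 d1 kap0 nkap Ztan QZ.
have [->|Q0] := eqVneq Q finset.set0.
  by rewrite cards0 mul0r mulr_ge0 ?(ltW d0)// mulr_ge0 ?exprn_ge0 ?harmonic_sum_ge0// ltW// mulr_gt0.
pose e k := if k == 42%N then del else p (k - 43)%N.
have [|l [e1 [lL cardQ e1tail Xe1 sec]]] := secants e n kap c Q kap0 Q0.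
  move=> q w qQ wq wtail; have [w3 [a [b bt]]] := QZ q w qQ wq.
  pose u := pack p del w a 0 (fun=> 0) (fun=> 0).
  (* In each piece a point is chosen at which the contact has secants in [t]; the four together form
     a point of [contacts]. *)
  have /choice[f fP] k : exists e1, (k < 4)%N -> [/\ agree_off 0 9 u e1,
      b + (2 * k)%:R * s <= e1 0%N <= b + (2 * k).+1%:R * s, contact Zs e1 &
      forall h, 0 < h -> exists e', [/\ agree_off 0 9 u e', contact Zs e',
        0 < `|e' 0%N - e1 0%N|, `|e' 0%N - e1 0%N| < h &
        forall j, (0 < j < 9)%N -> lam * `|e' j - e1 j| <= `|e' 0%N - e1 0%N|]].
    have [k4|] := boolP (k < 4)%N; last by exists u.
    have sE : (b + (2 * k).+1%:R * s) - (b + (2 * k)%:R * s) = s.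
      by rewrite -natr1; ring.
    have [||e1 [ue1 e1s Xe1 e1sec]] := LK u (b + (2 * k)%:R * s) (b + (2 * k).+1%:R * s).
    - by rewrite -subr_gt0 sE.
    - move=> t /andP[bt1 tb1]; have [|z [nu zl]] := bt t.
        apply/andP; split.
          by apply: le_trans bt1; rewrite lerDl mulr_ge0// ltW.
        apply: (le_trans tb1); rewrite lerD2l (_ : len = 7%:R * s); last first.
          by rewrite /s mulrC divfK.
        by rewrite ler_pM2r// ler_nat; move: k4; clear; lia.
      exists (pack p del w a t z nu); split=> //; last exact: contact_pack.
      by move=> j; rewrite -leqNgt add0n => j9; rewrite /u /pack; case: j j9 => [|[|[|[|[|[|[|[|[|j]]]]]]]]].
    exists e1 => _; split=> // h /e1sec[e' [ue' Xe' d0' dh de']].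
    exists e'; split=> // j /de'; rewrite sE => le1.
    by rewrite mulrC -ler_pdivlMr// /lam invf_div mulrC.
  pose e' j := if (j < 3)%N then w j else if (j < 6)%N then a (j - 3)%N else
    if (j < 42)%N then f ((j - 6) %/ 9)%N ((j - 6) %% 9)%N else w j.
  have e'blk k j : (k < 4)%N -> (j < 9)%N -> e' (6 + 9 * k + j)%N = f k j.
    move=> k4 j9; rewrite /e'.
    have [-> -> ->] : [/\ (6 + 9 * k + j < 3)%N = false, (6 + 9 * k + j < 6)%N = false
        & (6 + 9 * k + j < 42)%N = true].
      by split; [apply/negP|apply/negP|]; move: k4 j9; clear; lia.
    rewrite -addnA addKn mulnC divnMDl// divn_small// addn0.
    by rewrite modnMDl modn_small.
  have blkE k : (k < 4)%N -> block k e' = f k.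
    move=> k4; apply/funext => j; have [fu _ _ _] := fP k k4.
    rewrite /block; case: ltnP => j9; first exact: e'blk.
    rewrite fu; last by rewrite add0n -leqNgt.
    case: ltnP => j15.
      rewrite /e' /u /pack.
      by case: j j9 j15 => [|[|[|[|[|[|[|[|[|[|[|[|[|[|[|j]]]]]]]]]]]]]]].
    rewrite /e'; have [-> -> ->] : [/\ (j + 27 < 3)%N = false, (j + 27 < 6)%N = false
        & (j + 27 < 42)%N = false].
      by split; apply/negP; move: j15; clear; lia.
    rewrite wtail; last by move: j15; clear; lia.
    rewrite /e /u /pack.
    have [-> -> -> -> ->] : [/\ (j == 0)%N = false, (j < 5)%N = false, (j < 9)%N = false,
       (j < 12)%N = false & (j < 15)%N = false].
      by split; apply/negP; move: j15; clear; lia.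
    have -> : (j + 27 == 42)%N = (j == 15%N) by apply/eqP/eqP; clear; lia.
    by case: eqP => // _; congr p; clear; lia.
  exists e'; split.
    move=> k k42; rewrite /e'.
    have : (k < 3)%N || (42 <= k)%N by move: k42; clear; lia.
    case/orP => [->//|k42'].
    have [-> -> ->] : [/\ (k < 3)%N = false, (k < 6)%N = false & (k < 42)%N = false].
      by split; apply/negP; move: k42'; clear; lia.
    by [].
  have e42 : e' 42%N = del by rewrite /e' /= wtail.
  split.
  - move=> k k4; rewrite blkE//; have [fu fk Xf fsec] := fP k k4; split.
      rewrite splice_insert9 (_ : (fun j => _) = f k)//.
      by apply/funext => j; rewrite /insert9; case: ltnP.
    move=> h /fsec[e2 [ue2 Xe2 d0' dh de2]]; exists e2.
    rewrite splice_insert9 (_ : (fun j => _) = e2); last first.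
      apply/funext => j; case: ltnP => // j9.
      by rewrite fu ?ue2// add0n -leqNgt.
    have h0 : 0 < h by exact: lt_trans dh.
    have -> : insert9 lam (f k) 0%N = f k 0%N by [].
    split=> //; split; first by rewrite exprn_even_gt0//= -normr_gt0.
    split; first exact/ltr_sqr_norm.
    move=> j /andP[j0 j9].
    have -> : insert9 lam (f k) 9%N = lam by [].
    have -> : insert9 lam (f k) j = f k j by rewrite /insert9 j9.
    rewrite -[leLHS](real_normK (num_real _)) -[leRHS](real_normK (num_real _)).
    rewrite ler_pXn2r ?nnegrE// normrM (gtr0_norm lam0).
    by apply: de2; rewrite j0.
  - move=> k k3; rewrite -[X in e' X](addn0 (6 + 9 * k)%N) -[X in _ <= e' X](addn0 (6 + 9 * k.+1)%N).
    rewrite !e'blk//; last exact: leqW.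
    have [_ /andP[_ up] _ _] := fP k (leqW k3); have [_ /andP[lo _] _ _] := fP k.+1 k3.
    have E1 : (2 * k.+1)%:R * s = (2 * k).+1%:R * s + s.
      by rewrite -[in RHS]natr1 mulnS addnC natrD; ring.
    by rewrite E1 in lo; move: up lo; clear; lra.
  - by rewrite e42 d0.
  - by move=> i i3; rewrite /e' i3; exact: w3.
have p1 : (fun k => e1 (43 + k)%N) = p.
  by apply/funext => k; rewrite e1tail// /e /= addKn.
have del1 : e1 42%N = del by rewrite e1tail.
have near k : (k < 4)%N -> near_line (fiber Zs p) del e1 (fun i => e1 (3 + i)%N)
    (e1 (6 + 9 * k)%N) (fun j => e1 (7 + 9 * k + j)%N) (fun j => e1 (11 + 9 * k + j)%N).
  by move=> k4; have := contacts_near Xe1 k4; rewrite p1 del1.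
have := volume (fiber Zs p) del e1 (fun i => e1 (3 + i)%N) (fun k => e1 (6 + 9 * k)%N)
  (fun k j => e1 (7 + 9 * k + j)%N) (fun k j => e1 (11 + 9 * k + j)%N) l d0 Ztan.
have [tsec ts e42 w3] := Xe1.
have eb k : (k < 4)%N -> _ := fun k4 => contact_bound Zbox (contacts_contact Xe1 k4) e42.
move=> /(_ w3 ts) V.
have {}V : l 0%N * l 1%N * l 2%N <= C2 * del.
  apply: V => //.
  - move=> k k4; have [/(_ 0%N isT) + _] := eb k k4; by rewrite /block /= addn0.
  - move=> k k4 h h0; have [X0 /(_ h h0)[y [Xy [d0' [dh dy]]]]] := tsec k k4.
    move: Xy; rewrite splice_insert9; set v := (fun j => _) => Xy.
    have v9 j : (j < 9)%N -> v j = y j by rewrite /v => ->.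
    have b0 : insert9 lam (block k e1) 0%N = e1 (6 + 9 * k)%N by rewrite /insert9 /block /= addn0.
    rewrite b0 in d0' dh dy.
    have dyE j : (0 < j < 9)%N -> `|y j - e1 (6 + 9 * k + j)%N| <= K / s * `|y 0%N - e1 (6 + 9 * k)%N|.
      move=> /[dup] j9 /dy; rewrite /insert9 /=.
      have /andP[_ ->] := j9; rewrite /block; have /andP[_ ->] := j9.
      rewrite -[X in X <= _](real_normK (num_real _)).
      rewrite -[X in _ <= X](real_normK (num_real _)) ler_pXn2r ?nnegrE//.
      rewrite normrM (gtr0_norm lam0) => le1.
      by rewrite mulrC -[K / s]invf_div ler_pdivlMr// mulrC.
    have [Zz nu1 E E3] := Xy.
    have pv : (fun j => v (16 + j)%N) = p.
      rewrite -p1; apply/funext => j; rewrite /v /block /=.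
      by congr e1; clear; lia.
    have dv : v 15%N = del by rewrite -del1.
    rewrite pv dv in Zz E E3.
    exists (v 0%N), (fun j => v (1 + j)%N), (fun j => v (5 + j)%N); split.
    + split=> // i i3; rewrite -E//.
      by case: i i3 => [|[|[|//]]].
    + by rewrite v9// normr_gt0; apply: contraTneq d0' => ->; rewrite expr0n ltxx.
    + by rewrite v9//; exact/ltr_sqr_norm.
    + move=> j j4; rewrite !v9//; last by move: j4; clear; lia.
      have := dyE (1 + j)%N; rewrite addnA (_ : (6 + 9 * k + 1)%N = (7 + 9 * k)%N); last by clear; lia.
      by apply; move: j4; clear; lia.
    + move=> j j4; rewrite !v9//.
      have := dyE (5 + j)%N; rewrite addnA (_ : (6 + 9 * k + 5)%N = (11 + 9 * k)%N); last by clear; lia.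
      by apply; move: j4; clear; lia.
  - by move=> i i3; have /andP[-> /le_trans] := lL i i3; apply.
  - move=> i i3 h h0; have [e2 [Xe2 e2off d0' dh de2]] := sec i i3 h h0.
    have p2 : (fun k => e2 (43 + k)%N) = p.
      by rewrite -p1; apply/funext => k; rewrite e2off// orbT.
    have del2 : e2 42%N = del by rewrite e2off ?orbT.
    exists e2, (fun i => e2 (3 + i)%N), (fun k => e2 (6 + 9 * k)%N),
      (fun k j => e2 (7 + 9 * k + j)%N), (fun k j => e2 (11 + 9 * k + j)%N); split=> //.
    + by move=> k k4; have := contacts_near Xe2 k4; rewrite p2 del2.
    + by move=> j ji; rewrite e2off// ji.
    split.
    + by move=> j /andP[ij j3]; apply: de2; rewrite ij ltn_addr.
    + by move=> j j3; apply: de2; move: i3 j3; clear; lia.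
    + by move=> k k4; apply: de2; move: i3 k4; clear; lia.
    + by move=> k j k4 j4; apply: de2; move: i3 k4 j4; clear; lia.
    + by move=> k j k4 j4; apply: de2; move: i3 k4 j4; clear; lia.
apply: (le_trans cardQ); rewrite 3!big_ord_recr big_ord0 /= mul1r.
have -> : C1 * C2 * harmonic_sum R n ^+ 3 * del = C1 * harmonic_sum R n ^+ 3 * (C2 * del) by ring.
apply: ler_wpM2l => //.
by rewrite mulr_ge0 ?(ltW C10)// exprn_ge0// harmonic_sum_ge0.
Qed.

End CellCount.

(** * Regular zeros of polynomials *)

Section Polynomials.
Variable R : realType.
Local Notation mpoly4 := (mpoly.mpoly 4 R).
Implicit Types (P p q : mpoly4) (x y : 'I_4 -> R).

Lemma msize_mderiv i P : (mpoly.msize (mpoly.mderiv i P) <= (mpoly.msize P).-1)%N.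
Proof.
rewrite [X in (X <= _)%N]mpoly.msizeE; apply/bigmax_leqP_seq => m mP _.
move: mP; rewrite mpoly.mcoeff_msupp mpoly.mcoeff_deriv => mP.
have : mpoly.mnm_add m (mpoly.mnm1 i) \in mpoly.msupp P.
  by rewrite mpoly.mcoeff_msupp; apply: contraNneq mP => ->; rewrite mul0rn.
move=> /mpoly.msize_mdeg_lt; rewrite mpoly.mdegD mpoly.mdeg1 addn1.
by case: (mpoly.msize P).
Qed.

Lemma mderiv_eq0_const P : (forall i, mpoly.mderiv i P = 0) ->
  P = mpoly.mpolyC 4 (mpoly.mcoeff (mpoly.mnm0 (n := 4)) P).
Proof.
move=> dP0; apply/mpoly.mpolyP => m; rewrite mpoly.mcoeffC.
have [->|m0] := eqVneq m (mpoly.mnm0 (n := 4)); first by rewrite mulr1.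
rewrite mulr0; have [i mi] : exists i, m i != 0%N.
  apply: contrapT => no; move/negP: m0; apply; apply/eqP/mpoly.mnmP => i.
  by rewrite mpoly.mnm0E; apply/eqP/negPn/negP => mi; apply: no; exists i.
have := congr1 (mpoly.mcoeff (mpoly.mnm_sub m (mpoly.mnm1 i))) (dP0 i).
rewrite mpoly.mcoeff_deriv mpoly.mcoeff0 mpoly.submK ?mpoly.lep1mP//.
by move/eqP; rewrite mulrn_eq0 /= => /eqP.
Qed.

(** [None] stands for no derivation, so that [D]-tuples, a finite type, index the derivatives of
    order at most [D]. *)
Definition mderivs (s : seq (option 'I_4)) P : mpoly4 :=
  foldl (fun p o => if o is Some i then mpoly.mderiv i p else p) P s.

Lemma msize_mderivs s P : (mpoly.msize (mderivs s P) <= mpoly.msize P)%N.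
Proof.
elim: s P => //= o s IH P; apply: (leq_trans (IH _)); case: o => // i.
exact: leq_trans (msize_mderiv i P) (leq_pred _).
Qed.

Lemma mderivs_id k P : mderivs (nseq k None) P = P.
Proof. by elim: k. Qed.

(** If all first derivatives vanish at [x], some of them is a nonzero polynomial of lower degree
    that still vanishes there. This stops because a nonzero constant has no zero. *)
Lemma zero_regular_mderivs D P x : P != 0 -> (mpoly.msize P <= D.+1)%N ->
  mpoly.meval x P = 0 -> exists s : D.-tuple (option 'I_4),
    mpoly.meval x (mderivs s P) = 0 /\
    exists i, mpoly.meval x (mpoly.mderiv i (mderivs s P)) != 0.
Proof.
elim: D P => [|D IH] P P0 sP Px.
  move: Px P0; rewrite (mpoly.msize1_polyC sP) mpoly.mevalC => ->.
  by rewrite mpoly.mpolyC0 eqxx.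
have [[i dPx]|no] := pselect (exists i, mpoly.meval x (mpoly.mderiv i P) != 0).
  by exists [tuple of nseq D.+1 None]; rewrite mderivs_id; split=> //; exists i.
have [[i dP]|no'] := pselect (exists i, mpoly.mderiv i P != 0).
  have [||s [sx dsx]] := IH _ dP.
  - by apply: (leq_trans (msize_mderiv i P)); case: (mpoly.msize P) sP.
  - by apply/eqP/negPn/negP => h; apply: no; exists i.
  by exists [tuple of Some i :: s].
exfalso; have PC : P = mpoly.mpolyC 4 (mpoly.mcoeff (mpoly.mnm0 (n := 4)) P).
  by apply: mderiv_eq0_const => i; apply/eqP/negPn/negP => h; apply: no'; exists i.
move: Px P0; rewrite PC mpoly.mevalC => ->.
by rewrite mpoly.mpolyC0 eqxx.
Qed.

(** [K] may depend on [x] and [P]: it only serves to establish [tangent_at], which is local. *)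
Definition taylor_bound x P (K : R) := forall s y, (forall i, `|y i - x i| <= s) -> s <= 1 ->
  `|mpoly.meval y P - mpoly.meval x P -
    \sum_i mpoly.meval x (mpoly.mderiv i P) * (y i - x i)| <= K * s ^+ 2.

Lemma taylorC x c : taylor_bound x (mpoly.mpolyC 4 c) 0.
Proof.
move=> s y _ _; rewrite !mpoly.mevalC subrr big1 ?subrr ?normr0 ?mul0r// => i _.
by rewrite mpoly.mderivC mpoly.meval0 mul0r.
Qed.

Lemma taylorX x i : taylor_bound x (mpoly.mpolyX R (mpoly.mnm1 i)) 0.
Proof.
move=> s y _ _; rewrite !mpoly.mevalXU (bigD1 i)//= big1 ?addr0.
  rewrite mpoly.mderivX mpoly.mevalZ mpoly.mevalX mpoly.mnm1E eqxx mul1r.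
  rewrite big1 ?mul1r ?subrr ?normr0 ?mul0r// => j _.
  by rewrite mpoly.mnmBE subnn.
move=> j ji; rewrite mpoly.mderivX mpoly.mevalZ mpoly.mnm1E.
by rewrite eq_sym (negbTE ji) !mul0r.
Qed.

Lemma taylorD x p q K L : taylor_bound x p K -> taylor_bound x q L -> taylor_bound x (p + q) (K + L).
Proof.
move=> tp tq s y yx s1; have := tp s y yx s1; have := tq s y yx s1.
rewrite !mpoly.mevalD.
under [in X in _ -> _ -> X]eq_bigr do rewrite mpoly.mderivD mpoly.mevalD mulrDl.
rewrite big_split /=; set dp := \sum_i _; set dq := \sum_i _ => lq lp.
rewrite (_ : _ - _ - _ = (mpoly.meval y p - mpoly.meval x p - dq) +
  (mpoly.meval y q - mpoly.meval x q - dp)); last by ring.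
by apply: (le_trans (ler_normD _ _)); rewrite mulrDl lerD.
Qed.

Lemma taylor_lipschitz x p K s y : taylor_bound x p K -> 0 <= K ->
  (forall i, `|y i - x i| <= s) -> s <= 1 ->
  `|mpoly.meval y p - mpoly.meval x p| <=
    (K + \sum_i `|mpoly.meval x (mpoly.mderiv i p)|) * s.
Proof.
move=> tp K0 yx s1; have s0 : 0 <= s by exact: le_trans (yx ord0).
have := tp s y yx s1; set u := mpoly.meval y p - mpoly.meval x p; set d := \sum_i _ => ud.
rewrite -(subrK d u); apply: (le_trans (ler_normD _ _)); rewrite mulrDl lerD//.
  by apply: (le_trans ud); rewrite ler_wpM2l// expr2 ler_piMl.
apply: (le_trans (ler_norm_sum _ _ _)); rewrite mulr_suml; apply: ler_sum => i _.
by rewrite normrM ler_wpM2l.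
Qed.

Lemma taylorM x p q K L : 0 <= K -> 0 <= L -> taylor_bound x p K -> taylor_bound x q L ->
  exists2 M, 0 <= M & taylor_bound x (p * q) M.
Proof.
move=> K0 L0 tp tq.
pose Dp := \sum_i `|mpoly.meval x (mpoly.mderiv i p)|.
pose Dq := \sum_i `|mpoly.meval x (mpoly.mderiv i q)|.
have Dp0 : 0 <= Dp by apply: sumr_ge0.
have Dq0 : 0 <= Dq by apply: sumr_ge0.
exists ((K + Dp) * (L + Dq) + K * `|mpoly.meval x q| + L * `|mpoly.meval x p|).
  by rewrite !addr_ge0 ?mulr_ge0 ?addr_ge0.
move=> s y yx s1; have s0 : 0 <= s by exact: le_trans (yx ord0).
have lp := taylor_lipschitz tp K0 yx s1; have lq := taylor_lipschitz tq L0 yx s1.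
have := tp s y yx s1; have := tq s y yx s1.
rewrite !mpoly.mevalM.
under [in X in _ -> _ -> X]eq_bigr => i _.
  rewrite mpoly.mderivM mpoly.mevalD !mpoly.mevalM mulrDl.
  rewrite mulrAC -[X in _ + X]mulrA; over.
rewrite big_split /= -mulr_suml -mulr_sumr.
move: lp lq; rewrite -/Dp -/Dq.
set px := mpoly.meval x p; set qx := mpoly.meval x q.
set py := mpoly.meval y p; set qy := mpoly.meval y q.
set dp := \sum_i _; set dq := \sum_i _ => lp lq tq' tp'.
rewrite (_ : _ - _ - _ = (py - px) * (qy - qx) + ((py - px - dq) * qx + px * (qy - qx - dp))); last by ring.
rewrite [leRHS](_ : _ = (K + Dp) * s * ((L + Dq) * s) +
  (K * s ^+ 2 * `|qx| + `|px| * (L * s ^+ 2))); last by ring.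
apply: (le_trans (ler_normD _ _)); apply: lerD.
  by rewrite normrM; apply: ler_pM.
apply: (le_trans (ler_normD _ _)); rewrite !normrM; apply: lerD.
  by rewrite ler_wpM2r.
by rewrite ler_wpM2l.
Qed.

Lemma taylor_ex x P : exists2 K, 0 <= K & taylor_bound x P K.
Proof.
elim/mpoly.mpolyind: P => [|c m p _ _ [L L0 tp]].
  by exists 0 => //; rewrite -mpoly.mpolyC0; exact: taylorC.
have [K K0 tm] : exists2 K, 0 <= K & taylor_bound x (c *: mpoly.mpolyX R m) K.
  rewrite -mpoly.mul_mpolyC mpoly.mpolyXE_id.
  have [K K0 tK] : exists2 K, 0 <= K &
      taylor_bound x (\prod_(i < 4) mpoly.mpolyX R (mpoly.mnm1 i) ^+ m i) K.
    elim/big_ind: _ => [|p' q' [K K0 tK] [L' L'0 tL]|i _].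
    - by exists 0 => //; rewrite -mpoly.mpolyC1; exact: taylorC.
    - exact: (taylorM K0 L'0 tK tL).
    - elim: (m i) => [|k [K K0 tK]].
        by exists 0 => //; rewrite expr0 -mpoly.mpolyC1; exact: taylorC.
      by rewrite exprS; exact: (taylorM (lexx 0) K0 (@taylorX x i) tK).
  exact: (taylorM (lexx 0) K0 (@taylorC x c) tK).
by exists (K + L); [exact: addr_ge0|exact: taylorD].
Qed.

End Polynomials.

(** * Regular zeros as a semialgebraic family *)

Section RegularZeros.
Variable R : realType.
Local Notation mpoly4 := (mpoly.mpoly 4 R).
Variables (D : nat) (s : 'I_4 -> 'I_4).
Implicit Types (f : mpoly4) (z : nat -> R).

Let bm := mpoly.bmultinom 4 D.+1.
Let M := #|{: bm}|.

Definition monomial (r : nat) : mpoly.multinom 4 :=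
  if insub r : option 'I_M is Some r' then mpoly.bmnm (enum_val r') else mpoly.mnm0.

(** Coefficients in rows of length [M]: row 0 for [f], row [c.+1] for its partial derivative in
    variable [c]. With both stored, regularity of a zero is a polynomial condition on the
    coordinates. *)
Definition poly_env f (k : nat) : R :=
  mpoly.mcoeff (monomial (k %% M)) (if (k %/ M)%N is c.+1 then mpoly.mderiv (inord c) f else f).

Definition eval_env (c : nat) (e : nat -> R) : R :=
  \sum_(r < M) e (4 + (c * M + r))%N * \prod_(i < 4) e (s i) ^+ monomial r i.

(* Regular zeros in the cube of a polynomial whose coefficients, and those of
   its partial derivatives, are the coordinates from 4 on; s permutes the
   variables. *)
Definition regular_zero (e : nat -> R) : Prop :=
  (forall j, (j < 4)%N -> `|e j| <= 1) /\ (eval_env 0 e = 0 /\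
   ~ (forall i, (i < 4)%N -> eval_env i.+1 e = 0)).

Lemma polyfun_sum (I : Type) (r : seq I) (F : I -> (nat -> R) -> R) :
  (forall i, polyfun (F i)) -> polyfun (fun e => \sum_(i <- r) F i e).
Proof.
move=> pF; elim: r => [|i r IH].
  rewrite (_ : (fun _ => _) = fun=> 0); first by semialg.
  by apply/funext => e; rewrite big_nil.
rewrite (_ : (fun _ => _) = fun e => F i e + \sum_(i <- r) F i e).
  by apply: polyfun_add.
by apply/funext => e; rewrite big_cons.
Qed.

Lemma polyfun_prod (I : Type) (r : seq I) (F : I -> (nat -> R) -> R) :
  (forall i, polyfun (F i)) -> polyfun (fun e => \prod_(i <- r) F i e).
Proof.
move=> pF; elim: r => [|i r IH].
  rewrite (_ : (fun _ => _) = fun=> 1); first by semialg.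
  by apply/funext => e; rewrite big_nil.
rewrite (_ : (fun _ => _) = fun e => F i e * \prod_(i <- r) F i e).
  by apply: polyfun_mul.
by apply/funext => e; rewrite big_cons.
Qed.

Lemma polyfun_eval_env c : polyfun (eval_env c).
Proof.
apply: polyfun_sum => r; apply: polyfun_mul; first by semialg.
by apply: polyfun_prod => i; semialg.
Qed.

Lemma semialg_regular_zero : semialg regular_zero.
Proof.
have pe := polyfun_eval_env.
apply: semialg_and.
  by apply: (semialg_forall_nat (n := 4)) => // j; apply: semialg_norm_le; semialg.
apply: semialg_and; first exact: semialg_eq0.
apply: semialg_not; apply: (semialg_forall_nat (n := 4)) => // j.
exact: semialg_eq0.
Qed.

Lemma meval_monomials (x : 'I_4 -> R) f : (mpoly.msize f <= D.+1)%N ->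
  mpoly.meval x f =
    \sum_(r < M) mpoly.mcoeff (monomial r) f * \prod_(i < 4) x i ^+ monomial r i.
Proof.
move=> sf; rewrite {1}(mpoly.mpolywE sf) raddf_sum /=.
rewrite (big_enum_val (fun m : bm => mpoly.meval x (mpoly.mcoeff m f *: mpoly.mpolyX R m))) /=.
apply: eq_bigr => r _; rewrite mpoly.mevalZ mpoly.mevalX.
by rewrite /monomial valK.
Qed.

Lemma eval_envE c z f : (mpoly.msize f <= D.+1)%N ->
  eval_env c (fun k => if (k < 4)%N then z k else poly_env f (k - 4)%N) =
  mpoly.meval (fun i => z (s i)) (if c is c'.+1 then mpoly.mderiv (inord c') f else f).
Proof.
move=> sf; rewrite meval_monomials; last first.
  case: c => // c; apply: (leq_trans (msize_mderiv _ _)).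
  exact: leq_trans (leq_pred _) sf.
apply: eq_bigr => r _; rewrite ltnNge leq_addr /= addKn.
have M0 : (0 < M)%N by apply: leq_ltn_trans (ltn_ord r).
congr (_ * _); last by apply: eq_bigr => i _; rewrite ltn_ord.
by rewrite /poly_env modnMDl modn_small// divnMDl// divn_small// addn0.
Qed.

Lemma fiber_regular_zero f z : (mpoly.msize f <= D.+1)%N ->
  fiber regular_zero (poly_env f) z <-> [/\ forall j, (j < 4)%N -> `|z j| <= 1,
    mpoly.meval (fun i => z (s i)) f = 0 &
    exists i, mpoly.meval (fun i => z (s i)) (mpoly.mderiv i f) != 0].
Proof.
move=> sf; rewrite /fiber /regular_zero eval_envE//; split.
- move=> [z1 [fz nfz]]; split=> //; first by move=> j j4; have := z1 j j4; rewrite j4.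
  apply: contrapT => no; apply: nfz => i i4; rewrite eval_envE//.
  by apply/eqP/negPn/negP => h; apply: no; exists (inord i).
- move=> [z1 fz [i nfz]]; split; first by move=> j j4; rewrite j4; exact: z1.
  split=> // all0; have := all0 i (ltn_ord i); rewrite eval_envE// inord_val.
  exact/eqP.
Qed.

(** The normal is the gradient divided by its largest entry, with the variables permuted by [s].
    Both points are zeros of [f], so the linear term of the Taylor expansion is, up to sign, the
    quadratic remainder. *)
Lemma regular_zero_tangent f z : involutive s -> (mpoly.msize f <= D.+1)%N ->
  fiber regular_zero (poly_env f) z ->
  exists g, [/\ forall j, (j < 4)%N -> `|g j| <= 1,
    exists2 j, (j < 4)%N & `|g j| = 1 & tangent_at (fiber regular_zero (poly_env f)) z g].
Proof.
move=> ss sf /(fiber_regular_zero _ sf)[_ fz [i0 dfz]].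
pose x i := z (s i); pose G i := mpoly.meval x (mpoly.mderiv i f).
have [i _ imax] := @Order.TotalTheory.arg_maxP _ _ _ i0 xpredT (fun i => `|G i|) isT.
have Gi0 : 0 < `|G i| by apply: lt_le_trans (imax i0 isT); rewrite normr_gt0.
exists (fun j => G (s (inord j)) / `|G i|); split.
- by move=> j _; rewrite normrM normfV normr_id ler_pdivrMr// mul1r; exact: imax.
- exists (s i) => //; rewrite inord_val ss normrM normfV normr_id divff//.
  by rewrite gt_eqF.
move=> eta eta0; have [K K0 tK] := taylor_ex x f.
(* Below the second bound [K * t ^+ 2] is at most [eta * t] times the largest entry; the [+ 1]
   covers [K = 0]. *)
exists (Num.min 1 (eta * `|G i| / (K + 1))).
  by rewrite lt_min ltr01 divr_gt0 ?mulr_gt0// ltr_wpDl.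
move=> t z' /(fiber_regular_zero _ sf)[_ fz' _]; rewrite lt_min => /andP[t1 tr] zt.
have t0 : 0 <= t by exact: le_trans (zt 0%N isT).
have := tK t (fun i => z' (s i)) (fun i => zt _ (ltn_ord _)) (ltW t1).
rewrite fz' fz subrr add0r normrN => le1.
have -> : \sum_(j < 4) G (s (inord j)) / `|G i| * (z' j - z j) =
    (\sum_i0 G i0 * (z' (s i0) - x i0)) / `|G i|.
  rewrite mulr_suml (reindex_inj (inv_inj ss)) /=; apply: eq_bigr => j _.
  by rewrite inord_val ss /x mulrAC.
rewrite normrM normfV normr_id ler_pdivrMr//; apply: (le_trans le1).
move: tr; rewrite ltr_pdivlMr; last by rewrite ltr_wpDl.
move=> tr; rewrite expr2 mulrA [leRHS]mulrAC ler_wpM2r//.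
by move: tr; lra.
Qed.

End RegularZeros.

(** * Lines and directions *)

Section LineInterval.
Local Open Scope classical_set_scope.
Local Open Scope ring_scope.
Variable R : realType.

(** Monotonicity on arbitrary sets, through the outer measure: the set measured in [line_measure]
    comes without a proof of measurability. *)
Lemma lebesgue_measure_le (A B : set R) : A `<=` B ->
  (lebesgue_measure A <= lebesgue_measure B)%E.
Proof. exact: (le_outer_measure ((wlength (idfun : R -> R))^*)%mu). Qed.

Definition near_seq (rr : seq R) (l : R) : set R :=
  [set s | exists2 z, z \in rr & `|s - z| <= l].

Lemma lebesgue_measure_near_seq (rr : seq R) (l : R) : 0 <= l ->
  (lebesgue_measure (near_seq rr l) <= ((size rr)%:R * (2 * l))%:E)%E.
Proof.
move=> l0; elim: rr => [|z rr IH].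
  rewrite mul0r (_ : near_seq _ _ = set0) ?measure0//.
  by apply/seteqP; split => // s /= [].
pose B := [set` `[z - l, z + l]] : set R.
apply: (@le_trans _ _ (lebesgue_measure (B `|` near_seq rr l))).
  apply: lebesgue_measure_le => s /= [y]; rewrite in_cons => /orP[/eqP ->|yr] sy.
    by left; rewrite /B /= in_itv /=; move: sy; rewrite ler_norml; lra.
  by right; exists y.
apply: (le_trans (outer_measureU2 ((wlength (idfun : R -> R))^*)%mu B (near_seq rr l))).
have -> : ((size (z :: rr))%:R * (2 * l))%:E =
    ((2 * l)%:E + ((size rr)%:R * (2 * l))%:E)%E.
  by rewrite -EFinD /= -natr1 mulrDl mul1r addrC.
apply: leeD; last exact: IH.
rewrite [X in (X <= _)%E](lebesgue_measure_itv `[z - l, z + l]) /=.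
case: ifP => _; last by rewrite lee_fin mulr_ge0.
by rewrite -EFinD lee_fin; lra.
Qed.

(** If no [T w] contained such an interval, every point of [A] would have a breakpoint within [len],
    but the windows around all the breakpoints have total length below 1. *)
Lemma tame_cover_interval (W : finType) (M : nat) (T : W -> R -> Prop) (A : set R) (len : R) :
  0 < len -> (#|W| * M)%:R * (2 * len) < 1 ->
  (forall w, exists2 r : seq R, (size r <= M)%N & tame_off r (T w)) ->
  A `<=` [set s | exists w, T w s] -> (1%:E <= lebesgue_measure A)%E ->
  exists w a, forall s, a <= s <= a + len -> T w s.
Proof.
move=> len0 lenM rT AT A1; apply: contrapT => no.
have /choice[r rP] w : exists r : seq R, (size r <= M)%N /\ tame_off r (T w).
  by have [r] := rT w; exists r.
pose rr := flatten [seq r w | w <- enum W].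
have srr : (size rr <= #|W| * M)%N.
  rewrite /rr size_flatten /shape -map_comp sumnE big_map big_enum /=.
  by rewrite -sum_nat_const; apply: leq_sum => w _; have [] := rP w.
have cover : A `<=` near_seq rr len.
  move=> s /AT[w Tws]; apply: contrapT => far; apply: no; exists w, s => s' /andP[ss' s'l].
  have [_ tr] := rP w; apply/(tr s s' ss') => // z zr; apply/negP => /andP[sz zs'].
  apply: far; exists z; last by rewrite ler_norml; lra.
  by apply/flattenP; exists (r w) => //; apply/mapP; exists w => //; rewrite mem_enum.
have := le_trans A1 (le_trans (lebesgue_measure_le cover)
  (lebesgue_measure_near_seq rr (ltW len0))).
rewrite lee_fin leNgt => /negP; apply; apply: le_lt_trans lenM.
by rewrite ler_wpM2r ?mulr_ge0 ?(ltW len0)// ler_nat.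
Qed.

(** One [M] serves all lines, members of the family and [del], as these are coordinates of a single
    set: [s] at 0, [P0] at 1-4, [V] at 5-8, [del] at 9, [p] from 10 on. *)
Lemma contact_line_tame (Zs : (nat -> R) -> Prop) : semialg Zs ->
  exists M, forall (p P0 V : nat -> R) (del : R),
    exists2 r : seq R, (size r <= M)%N & tame_off r (fun s => exists z, fiber Zs p z /\
      forall j, (j < 4)%N -> `|P0 j + s * V j - z j| <= del).
Proof.
move=> sZ.
pose T (e : nat -> R) := exists y, fiber Zs (fun k => e (10 + k)%N) y /\
  forall j, (j < 4)%N -> `|e (1 + j)%N + e 0%N * e (5 + j)%N - y j| <= e 9%N.
have sT : semialg T.
  apply: (@semialg_ex_vec _ 4).
    move=> y y' e yy' [Zy ye]; split; first exact: fiber_ext Zy.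
    by move=> j j4; rewrite -yy'// ye.
  apply: semialg_and.
    by apply: semialg_subst sZ => k; case: (k < 4)%N; semialg.
  apply: (semialg_forall_nat (n := 4)) => // j.
  by apply: semialg_norm_le; semialg.
have [M tM] := semialg_tame 0 sT; exists M => p P0 V del.
pose e k := if (k < 5)%N then P0 (k - 1)%N else if (k < 9)%N then V (k - 5)%N else
  if k == 9%N then del else p (k - 10)%N.
have [r rM tr] := tM e; exists r => //.
have E s : T (upd e 0 s) <-> exists z, fiber Zs p z /\
    forall j, (j < 4)%N -> `|P0 j + s * V j - z j| <= del.
  have pE : (fun k => upd e 0 s (10 + k)%N) = p.
    by apply/funext => k; rewrite /upd /e /= addKn.
  by split=> -[z [Zz ze]]; exists z; rewrite pE in Zz *; split=> // j j4;
    have := ze j j4; case: j j4 => [|[|[|[|//]]]].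
by move=> x y xy /(tr x y xy); rewrite !E.
Qed.

End LineInterval.

(** * Logarithms and charts on the space of lines *)

Section Charts.
Variable R : realType.

Lemma harmonic_sum_ln n : (0 < n)%N -> harmonic_sum R n <= 1 + ln n%:R.
Proof.
case: n => // n _; elim: n => [|n IH].
  by rewrite /harmonic_sum big_ord_recl big_ord0 ln1 invr1 !addr0.
rewrite /harmonic_sum big_ord_recr /= -/(harmonic_sum R n.+1).
have : ln (1 + - n.+2%:R^-1) <= - n.+2%:R^-1 :> R.
  by apply: le_ln1Dx; rewrite ltrN2 invf_lt1// ltr1n.
have -> : 1 + - n.+2%:R^-1 = n.+1%:R / n.+2%:R :> R.
  have n2 : n.+2%:R != 0 :> R by rewrite pnatr_eq0.
  by rewrite -[X in X + _](divff n2) -[X in _ - X]mul1r -mulrBl -natr1 addrK.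
rewrite ln_div ?posrE ?ltr0n//.
move: IH; set a := harmonic_sum R n.+1; set b := ln n.+1%:R.
by set c := ln n.+2%:R; set d := n.+2%:R^-1; lra.
Qed.

(** With y = del^(-eps/3), ln (1/del) = (3/eps) ln y <= (3/eps) y, so the harmonic sum is O(y). The
    21 comes from the mesh [del / 10]: a grid of [-1, 1] has at most [20 / del + 1] cells. *)
Lemma harmonic_sum_cube (eps : R) : 0 < eps -> exists2 C : R, 0 < C &
  forall del n, 0 < del -> del < 1 -> (0 < n)%N -> n%:R <= 21 / del ->
    harmonic_sum R n ^+ 3 <= C * del `^ (- eps).
Proof.
move=> e0; have e30 : 0 < 3 / eps by rewrite divr_gt0.
exists ((22 + 3 / eps) ^+ 3) => [|del n d0 d1 n0 nd]; first by rewrite exprn_gt0// addr_gt0.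
pose y := del `^ (- (eps / 3)).
have lny : ln y = - (eps / 3) * ln del by rewrite ln_powR.
have lnd : ln del < 0 by apply: ln_lt0; rewrite d0.
have lny0 : 0 < ln y by rewrite lny mulNr oppr_gt0 pmulr_rlt0// divr_gt0.
have y1 : 1 <= y.
  by rewrite leNgt; apply/negP => y1; have := ln_lt0 (x := y); rewrite powR_gt0// y1 => /(_ isT); rewrite ltNge ltW.
have ln_le : ln del = - (3 / eps) * ln y by rewrite lny; field; rewrite gt_eqF.
have lnn : ln n%:R <= 21 + 3 / eps * y.
  have le1 : ln n%:R <= ln (21 / del) by rewrite ler_ln// posrE ?ltr0n// divr_gt0.
  apply: (le_trans le1); rewrite ln_div ?posrE// ln_le.
  have : ln 21 < 21 :> R by exact: ln_sublinear.
  have : 3 / eps * ln y <= 3 / eps * y.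
    by rewrite ler_pM2l// ltW// ln_sublinear// (lt_le_trans ltr01).
  by lra.
have -> : del `^ (- eps) = y ^+ 3.
  rewrite -powR_mulrn ?powR_ge0// /y -powRrM; congr (_ `^ _); by field.
rewrite -exprMn; apply: lerXn2r; rewrite ?nnegrE ?harmonic_sum_ge0//.
  by rewrite mulr_ge0 ?powR_ge0// addr_ge0// ltW.
apply: (le_trans (harmonic_sum_ln n0)).
by rewrite mulrDl; move: lnn y1; lra.
Qed.

(** Moves coordinate [i], in which the direction is largest, to the last place, that of the
    parameter [t] in [near_line]. *)
Definition swap_last (i : 'I_4) : 'I_4 -> 'I_4 := tperm i ord_max.

Lemma swap_lastK i : involutive (swap_last i).
Proof. exact: tpermK. Qed.

(** Reparametrization by [t = P0 i + s * V i], which keeps half of the length. Since [t] is at most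
    2 in absolute value, replacing the slopes by [w'] adds at most [2 * (del / 8)] to the error
    [del]; the factor 2 in [near_line] absorbs this. *)
Lemma chart_contact (D : nat) (i : 'I_4) (P0 V : 'I_4 -> R) (f : mpoly.mpoly 4 R) (del alpha len : R) (w' : nat -> R) :
  (mpoly.msize f <= D.+1)%N -> 0 < del -> del <= 1 -> 1 / 2 <= `|V i| -> 0 < len ->
  (forall j, (j < 3)%N -> `|w' j - V (swap_last i (inord j)) / V i| <= del / 8) ->
  (forall s, alpha <= s <= alpha + len ->
    exists z, fiber (regular_zero D id) (poly_env D f) z /\
      forall j, (j < 4)%N -> `|P0 (inord j) + s * V (inord j) - z j| <= del) ->
  exists a b, forall t, b <= t <= b + len / 2 -> exists z nu,
    near_line (fiber (regular_zero D (swap_last i)) (poly_env D f)) del w' a t z nu.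
Proof.
move=> sf d0 d1 Vi len0 w'V sec.
have Vi0 : V i != 0 by rewrite -normr_gt0; move: Vi; lra.
exists (fun j => P0 (swap_last i (inord j)) - P0 i * (V (swap_last i (inord j)) / V i)).
(* The lower end of the range of [t]; for negative [V i] the segment is run through backwards. *)
pose b := P0 i + alpha * V i + (if 0 < V i then 0 else len * V i).
exists b => t /andP[bt tb].
pose s := (t - P0 i) / V i.
have [|z [Zz zP]] := sec s.
  have [Vp|Vn] := ltP 0 (V i).
    move: bt tb; rewrite /b Vp addr0 => bt tb.
    have V2 : 1 / 2 <= V i by move: Vi; rewrite gtr0_norm.
    rewrite /s ler_pdivlMr// ler_pdivrMr//; apply/andP; split; first lra.
    have : len * (1 / 2) <= len * V i by rewrite ler_wpM2l// ltW.
    by rewrite mulrDl; lra.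
  have Vlt : V i < 0 by rewrite lt_neqAle Vi0.
  move: bt tb; rewrite /b ltNge (ltW Vlt) /= => bt tb.
  have V2 : 1 / 2 <= - V i by move: Vi; rewrite ltr0_norm.
  rewrite /s ler_ndivlMr// ler_ndivrMr//; apply/andP; split.
    have : len * (1 / 2) <= len * - V i by rewrite ler_wpM2l// ltW.
    by rewrite mulrN; lra.
  by rewrite mulrDl; lra.
have zP' k : `|P0 k + s * V k - z k| <= del by have := zP k (ltn_ord k); rewrite inord_val.
have [z1 fz nfz] : [/\ forall j, (j < 4)%N -> `|z j| <= 1,
    mpoly.meval (fun j => z j) f = 0 & exists i, mpoly.meval (fun j => z j) (mpoly.mderiv i f) != 0].
  exact/(fiber_regular_zero _ _ sf).
have sV : s * V i = t - P0 i by rewrite /s divfK.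
have t2 : `|t| <= 2.
  have := zP' i; rewrite sV addrCA subrr addr0 => tz.
  have := ler_normD (t - z i) (z i); rewrite subrK; have := z1 i (ltn_ord i).
  by move: tz; lra.
pose sw (j : nat) := swap_last i (inord j).
have sw3 : sw 3%N = i.
  have -> : sw 3%N = swap_last i ord_max by congr swap_last; apply/val_inj; rewrite /= inordK.
  by rewrite /swap_last tpermR.
have zE : (fun j : 'I_4 => z (sw (swap_last i j))) = (fun j : 'I_4 => z j).
  by apply/funext => j; rewrite /sw inord_val swap_lastK.
exists (fun j => z (sw j)), (fun j => if j == 3%N then (t - z i) / (2 * del) else
  (P0 (sw j) - P0 i * (V (sw j) / V i) + t * w' j - z (sw j)) / (2 * del)).
have d20 : 0 < 2 * del by rewrite mulr_gt0.
split.
- apply/(fiber_regular_zero _ _ sf); rewrite zE; split=> //.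
  by move=> j _; exact: z1.
- move=> j j4; rewrite (_ : (if _ then _ else _) = (if j == 3%N then t - z i else
    P0 (sw j) - P0 i * (V (sw j) / V i) + t * w' j - z (sw j)) / (2 * del)); last by case: ifP.
  rewrite normrM normfV (gtr0_norm d20) ler_pdivrMr// mul1r.
  case: ifP => [_|j3].
    by have := zP' i; rewrite sV addrCA subrr addr0 => tz; apply: (le_trans tz); lra.
  have j3' : (j < 3)%N by move: j4; rewrite ltnS leq_eqVlt j3.
  have xE : s * V (sw j) = (t - P0 i) * (V (sw j) / V i) by rewrite /s mulrAC mulrA.
  have := zP' (sw j); rewrite xE => le1.
  have le2 : `|t * (w' j - V (sw j) / V i)| <= 2 * (del / 8).
    by rewrite normrM; apply: ler_pM => //; exact: w'V.
  rewrite (_ : _ - _ = (P0 (sw j) + (t - P0 i) * (V (sw j) / V i) - z (sw j)) +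
    t * (w' j - V (sw j) / V i)); last by ring.
  by apply: (le_trans (ler_normD _ _)); move: le1 le2; lra.
- move=> j j3; rewrite ltn_eqF//= -/(sw j).
  by rewrite [2 * del * _]mulrC divfK ?gt_eqF//; ring.
- by rewrite /= sw3 [2 * del * _]mulrC divfK ?gt_eqF//; ring.
Qed.

End Charts.

(** * Directions and their slopes *)

Section Directions.
Local Open Scope classical_set_scope.
Local Open Scope ring_scope.
Variable R : realType.

Lemma coord_le_enorm n (x : 'rV[R]_n) i : `|x 0 i| <= enorm x.
Proof.
rewrite -sqrtr_sqr ler_wsqrtr// (bigD1 i)//= lerDl sumr_ge0// => j _.
exact: sqr_ge0.
Qed.

Lemma enorm1_sum (v : 'rV[R]_4) : enorm v = 1 -> \sum_i v 0 i ^+ 2 = 1.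
Proof.
rewrite /enorm => v1; rewrite -[LHS]sqr_sqrtr ?v1 ?expr1n// sumr_ge0// => i _.
exact: sqr_ge0.
Qed.

Lemma enorm_le (x : 'rV[R]_4) c : 0 <= c -> (forall i, `|x 0 i| <= c / 2) -> enorm x <= c.
Proof.
move=> c0 xc; rewrite -(ger0_norm c0) -sqrtr_sqr /enorm ler_wsqrtr//.
have -> : c ^+ 2 = \sum_(i < 4) (c / 2) ^+ 2.
  by rewrite sumr_const card_ord -mulr_natl; field.
apply: ler_sum => i _; rewrite -(real_normK (num_real (x 0 i))).
by apply: lerXn2r; rewrite ?nnegrE ?divr_ge0.
Qed.

Lemma enorm1_max_coord (v : 'rV[R]_4) : enorm v = 1 ->
  exists2 i, 1 / 2 <= `|v 0 i| & forall j, `|v 0 j| <= `|v 0 i|.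
Proof.
move=> /enorm1_sum v1.
have [i _ imax] := @Order.TotalTheory.arg_maxP _ _ _ (ord0 : 'I_4) xpredT (fun i => `|v 0 i|) isT.
exists i => [|j]; last exact: imax.
rewrite leNgt; apply/negP => lt; have : \sum_(j < 4) v 0 j ^+ 2 < 1; last by rewrite v1 ltxx.
apply: (@le_lt_trans _ _ (\sum_(j < 4) `|v 0 i| ^+ 2)).
  apply: ler_sum => j _; rewrite -(real_normK (num_real (v 0 j))).
  by apply: lerXn2r; rewrite ?nnegrE//; exact: imax.
rewrite sumr_const card_ord -mulr_natl.
have : `|v 0 i| ^+ 2 < (1 / 2) ^+ 2 by rewrite ltrXn2r// nnegrE.
lra.
Qed.

(** A unit vector is recovered from its ratios: [v 0 i ^+ 2] is the inverse of the sum of their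
    squares, and the sign is shared. The sums of squares differ by at most [8 * kap], the entries
    [i] by [4 * kap], and each coordinate by one more [kap]. *)
Lemma same_cell_close (v u : 'rV[R]_4) i kap : enorm v = 1 -> enorm u = 1 ->
  v 0 i != 0 -> u 0 i != 0 ->
  (forall j, `|v 0 j| <= `|v 0 i|) -> (forall j, `|u 0 j| <= `|u 0 i|) ->
  (0 <= v 0 i) = (0 <= u 0 i) ->
  (forall j, `|v 0 j / v 0 i - u 0 j / u 0 i| <= kap) ->
  forall j, `|v 0 j - u 0 j| <= 5 * kap.
Proof.
move=> v1 u1 vi0 ui0 vmax umax sgn close.
have ratio (w : 'rV[R]_4) j : w 0 i != 0 -> (forall j, `|w 0 j| <= `|w 0 i|) ->
    `|w 0 j / w 0 i| <= 1.
  by move=> wi0 wmax; rewrite normrM normfV ler_pdivrMr ?normr_gt0// mul1r.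
have kap0 : 0 <= kap by exact: le_trans (close i).
pose x := `|v 0 i|; pose y := `|u 0 i|.
have x0 : 0 < x by rewrite normr_gt0.
have y0 : 0 < y by rewrite normr_gt0.
have x1 : x <= 1 by rewrite -v1 coord_le_enorm.
have y1 : y <= 1 by rewrite -u1 coord_le_enorm.
have sumE (w : 'rV[R]_4) : enorm w = 1 -> w 0 i != 0 ->
    `|w 0 i| ^+ 2 * \sum_j (w 0 j / w 0 i) ^+ 2 = 1.
  move=> /enorm1_sum w1 wi0; rewrite real_normK ?num_real// mulr_sumr -[RHS]w1.
  by apply: eq_bigr => j _; rewrite -exprMn mulrC divfK.
pose A := \sum_j (v 0 j / v 0 i) ^+ 2; pose B := \sum_j (u 0 j / u 0 i) ^+ 2.
have xA : x ^+ 2 * A = 1 by exact: sumE.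
have yB : y ^+ 2 * B = 1 by exact: sumE.
have AB : `|B - A| <= 8 * kap.
  rewrite distrC /A /B -sumrB; apply: (le_trans (ler_norm_sum _ _ _)).
  apply: (@le_trans _ _ (\sum_(j < 4) kap * 2)).
    apply: ler_sum => j _; rewrite subr_sqr normrM; apply: ler_pM => //.
    apply: (le_trans (ler_normD _ _)).
    by have := ratio v j vi0 vmax; have := ratio u j ui0 umax; lra.
  by rewrite sumr_const card_ord -mulr_natl; lra.
(* [x ^+ 2 - y ^+ 2 = x ^+ 2 * y ^+ 2 * (B - A)], and the product of squares is at most
   [(x + y) / 2], which cancels the factor [x + y]. *)
have xy : `|x - y| <= 4 * kap.
  have xy0 : 0 < x + y by exact: addr_gt0.
  rewrite -(ler_pM2r xy0) -[X in _ * X <= _](gtr0_norm xy0) -normrM -subr_sqr.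
  have -> : x ^+ 2 - y ^+ 2 = (x ^+ 2 * y ^+ 2) * (B - A).
    rewrite mulrBr -[_ * B]mulrA yB mulr1 [x ^+ 2 * _]mulrC -mulrA xA mulr1 //.
  have xxyy : x ^+ 2 * y ^+ 2 <= (x + y) / 2.
    have X1 : x ^+ 2 <= x by rewrite expr2 ler_piMl// ltW.
    have Y1 : y ^+ 2 <= y by rewrite expr2 ler_piMl// ltW.
    have : x ^+ 2 * y ^+ 2 <= x * 1.
      by apply: ler_pM; rewrite ?sqr_ge0// (le_trans Y1).
    have : x ^+ 2 * y ^+ 2 <= 1 * y.
      by apply: ler_pM; rewrite ?sqr_ge0// (le_trans X1).
    by lra.
  have xy2 : 0 <= x ^+ 2 * y ^+ 2 by rewrite mulr_ge0 ?sqr_ge0.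
  rewrite normrM (ger0_norm xy2).
  rewrite (_ : 4 * kap * (x + y) = (x + y) / 2 * (8 * kap)); last by field.
  by apply: ler_pM.
have vu : `|v 0 i - u 0 i| <= 4 * kap.
  move: sgn xy; rewrite /x /y.
  have [vi|vi] := leP 0 (v 0 i); have [ui|ui] := leP 0 (u 0 i) => // _.
    by rewrite (ger0_norm vi) (ger0_norm ui).
  by rewrite (ltr0_norm vi) (ltr0_norm ui) opprK addrC distrC.
move=> j; rewrite (_ : v 0 j - u 0 j = v 0 i * (v 0 j / v 0 i - u 0 j / u 0 i) +
   (v 0 i - u 0 i) * (u 0 j / u 0 i)); last by field; rewrite ?ui0 ?vi0.
apply: (le_trans (ler_normD _ _)); rewrite !normrM.
have : `|v 0 i| * `|v 0 j / v 0 i - u 0 j / u 0 i| <= 1 * kap by apply: ler_pM.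
have : `|v 0 i - u 0 i| * `|u 0 j / u 0 i| <= 4 * kap * 1.
  by apply: ler_pM => //; exact: ratio.
rewrite normrM; lra.
Qed.

(** Each point of the line in the neighborhood is near a regular zero of one of finitely many
    derivatives. These conditions cut tame sets out of the line, so a measure of at least 1 leaves
    an interval of length [len] to one of them. *)
Lemma Sigma_interval (D : nat) : exists2 len : R, 0 < len &
  forall (P : mpoly.mpoly 4 R) del l, mpoly.msize P = D.+1 -> 0 < del ->
    Sigma del (zero_set P `&` eball 0 1) l ->
    exists (w : D.-tuple (option 'I_4)) (P0 : 'I_4 -> R) (alpha : R),
      forall s, alpha <= s <= alpha + len ->
      exists z, fiber (regular_zero D id) (poly_env D (mderivs w P)) z /\
        forall j, (j < 4)%N -> `|P0 (inord j) + s * Dir l 0 (inord j) - z j| <= del.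
Proof.
have [M tM] := contact_line_tame (semialg_regular_zero R D id).
pose W : finType := D.-tuple (option 'I_4).
(* Small enough that windows of width [2 * len] around [#|W| * M] breakpoints have total length
   below 1. *)
pose len : R := (4 * ((#|W| * M)%:R + 1))^-1.
have N0 : 0 < (#|W| * M)%:R + 1 :> R by rewrite ltr_wpDl.
have len0 : 0 < len by rewrite invr_gt0 mulr_gt0.
exists len => // P del l sP d0 [lL].
rewrite /line_measure; set A := (X in lebesgue_measure X) => A1.
pose P0 i := xget 0 l 0 i : R.
pose T (w : W) s := exists z, fiber (regular_zero D id) (poly_env D (mderivs w P)) z /\
  forall j, (j < 4)%N -> `|P0 (inord j) + s * Dir l 0 (inord j) - z j| <= del.
have [|w|s||w [a aT]] := @tame_cover_interval R W M T A len len0.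
- have : len * (4 * ((#|W| * M)%:R + 1)) = 1 by rewrite mulVf// gt_eqF// mulr_gt0.
  have : 0 < len * ((#|W| * M)%:R + 1) by exact: mulr_gt0.
  by lra.
- exact: (tM (poly_env D (mderivs w P)) (fun j => P0 (inord j)) (fun j => Dir l 0 (inord j)) del).
- rewrite /A /= => -[_ [x [Px x1] sx]].
  have Pn0 : P != 0 by apply/eqP => PE; move: sP; rewrite PE mpoly.msize0.
  have [||w [fx dfx]] := @zero_regular_mderivs R D P (fun i => x 0 i) Pn0.
  - by rewrite sP.
  - exact: Px.
  exists w, (fun j => x 0 (inord j)).
  have xE : (fun i : 'I_4 => x 0 (inord (id i))) = (fun i => x 0 i).
    by apply/funext => i; rewrite inord_val.
  split.
    apply/fiber_regular_zero.
      by rewrite (leq_trans (msize_mderivs _ _))// sP.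
    rewrite xE; split=> // j _.
    by apply: (le_trans (coord_le_enorm _ _)); move: x1; rewrite /eball /= subr0.
  move=> j j4; move: sx; rewrite /eball /=; apply: le_trans.
  by rewrite (le_trans _ (coord_le_enorm _ (inord j)))// !mxE.
- exact: A1.
- by exists w, P0, a.
Qed.

End Directions.

(** * Covering the directions by grid cells *)

Section Cover.
Local Open Scope classical_set_scope.
Local Open Scope ring_scope.
Variable R : realType.

(** Each center is a member of its class, so the diameter of a class is what [del] must bound; an
    empty class gets the default center 0. *)
Lemma covering_number_le (I : finType) (S : {set I}) n (del : R) (E : set 'rV[R]_n)
    (cls : I -> set 'rV[R]_n) :
  (forall v, E v -> exists2 x, x \in S & cls x v) ->
  (forall x v u, cls x v -> cls x u -> enorm (v - u) <= del) ->
  (covering_number del E <= (#|S|%:R)%:E)%E.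
Proof.
move=> ES clsd; apply: ereal_inf_lbound; exists #|S| => //=.
exists (fun j : 'I_#|S| => xget 0 (cls (enum_val j))) => v /ES[x xS xv].
exists (enum_rank_in xS x) => //; rewrite enum_rankK_in//.
by apply: (clsd _ _ _ xv); exact: xgetI xv.
Qed.

Lemma card_fibers (A B : finType) (S : {set A * B}) :
  (#|S| = \sum_a #|[set b | (a, b) \in S]%SET|)%N.
Proof.
under [RHS]eq_bigr do rewrite -sum1dep_card.
by rewrite pair_big_dep /= -sum1_card; apply: eq_bigl => -[a b].
Qed.

Lemma grid_cell (kap u : R) : 0 < kap -> -1 <= u <= 1 ->
  exists2 j, (j <= Num.truncn (2 / kap))%N & -1 + j%:R * kap <= u <= -1 + j.+1%:R * kap.
Proof.
move=> kap0 /andP[u1 u2].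
have y0 : 0 <= (u + 1) / kap by rewrite divr_ge0 ?(ltW kap0)//; lra.
exists (Num.truncn ((u + 1) / kap)).
  by apply: le_truncn; rewrite ler_pM2r ?invr_gt0//; lra.
have /andP[lo hi] := truncn_itv y0.
move: lo hi; rewrite ler_pdivlMr// ltr_pdivrMr// => lo hi.
by apply/andP; split; lra.
Qed.

(* i is the chart, w the derivative of P whose regular zeros accompany a segment
   of direction v, b the sign of v 0 i, q the grid cell of the slopes of v. *)
Definition direction_cell (D : nat) (len : R) (P : mpoly.mpoly 4 R) (del kap : R) n
    (x : 'I_4 * D.-tuple (option 'I_4) * bool * {ffun 'I_3 -> 'I_n}) : set 'rV[R]_4 :=
  let: (i, w, b, q) := x in
  [set v | [/\ enorm v = 1, 1 / 2 <= `|v 0 i| /\ forall j, `|v 0 j| <= `|v 0 i|,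
    (0 <= v 0 i) = b,
    forall k : 'I_3, -1 + (q k)%:R * kap <= v 0 (swap_last i (inord k)) / v 0 i
      <= -1 + (q k).+1%:R * kap &
    exists (P0 : 'I_4 -> R) (alpha : R), forall s, alpha <= s <= alpha + len ->
      exists z, fiber (regular_zero D id) (poly_env D (mderivs w P)) z /\
        forall j, (j < 4)%N -> `|P0 (inord j) + s * v 0 (inord j) - z j| <= del]].

(** The origin of the mesh: ratios agree up to [del / 10], coordinates up to [del / 2] by
    [same_cell_close], and in dimension 4 the Euclidean norm is at most twice the largest
    coordinate. *)
Lemma direction_cell_diam D len P del n x (v u : 'rV[R]_4) : 0 < del ->
  direction_cell (D := D) len P del (del / 10) (n := n) x v ->
  direction_cell len P del (del / 10) x u -> enorm (v - u) <= del.
Proof.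
case: x => [[[i w] b] q] d0 [v1 [vi vmax] vb vq _] [u1 [ui umax] ub uq _].
have nz (y : R) : 1 / 2 <= `|y| -> y != 0 by rewrite -normr_gt0; lra.
apply: enorm_le => [|j]; first exact: ltW.
rewrite !mxE (_ : del / 2 = 5 * (del / 10)); last by field.
apply: (same_cell_close (i := i)) => //; rewrite ?nz ?vb ?ub// => k.
have [->|ki] := eqVneq k i.
  by rewrite !divff ?nz// subrr normr0 divr_ge0// ltW.
pose m := swap_last i k.
have m3 : (m < 3)%N.
  have : m != ord_max.
    apply: contraNneq ki => mE.
    have := swap_lastK i k; rewrite -/m mE => <-.
    by rewrite /swap_last tpermR.
  by rewrite -val_eqE /= => ne; have := ltn_ord m; rewrite ltnS leq_eqVlt (negbTE ne).
have kE : swap_last i (inord (Ordinal m3)) = k by rewrite /= inord_val /m swap_lastK.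
have /andP[v2 v3] := vq (Ordinal m3); have /andP[u2 u3] := uq (Ordinal m3).
rewrite kE in v2 v3 u2 u3.
rewrite ler_norml; move: v3 u3; rewrite -natr1 mulrDl mul1r => v3 u3.
by apply/andP; split; lra.
Qed.

(** Chart, derivative and sign take a number of values depending on [D] only; for each of their
    combinations [cell_count_bound] counts the cells. *)
Lemma direction_cells_count (D : nat) (len : R) : 0 < len -> exists2 C : R, 0 < C &
  forall (P : mpoly.mpoly 4 R) del n (S : {set 'I_4 * D.-tuple (option 'I_4) * bool *
      {ffun 'I_3 -> 'I_n}}),
    mpoly.msize P = D.+1 -> 0 < del -> del < 1 -> n%:R * (del / 10) <= 4 ->
    (forall x, x \in S -> exists v, direction_cell len P del (del / 10) x v) ->
    #|S|%:R * (del / 10) ^+ 3 <= C * harmonic_sum R n ^+ 3 * del.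
Proof.
move=> len0.
have len20 : 0 < len / 2 by rewrite divr_gt0.
have box s e : regular_zero (R := R) D s e -> forall j, (j < 4)%N -> `|e j| <= 1 by case.
pose ex i := cell_count_bound (semialg_regular_zero R D (swap_last i)) len20 (box _).
pose C i := s2val (cid2 (ex i)).
have C0 i : 0 < C i by exact: (s2valP (cid2 (ex i))).
pose CP i := s2valP' (cid2 (ex i)).
have N0 : (0 < #|{: 'I_4 * D.-tuple (option 'I_4) * bool}|)%N.
  by apply/card_gt0P; exists (ord0, [tuple of nseq D None], true).
set N := #|_| in N0.
exists (N%:R * \sum_i C i) => [|P del n S sP d0 d1 nk Scell].
  rewrite mulr_gt0 ?ltr0n// (bigD1 ord0)//= ltr_wpDr ?sumr_ge0//.
  by move=> i _; rewrite ltW.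
pose H := harmonic_sum R n ^+ 3 * del.
have H0 : 0 <= H by rewrite mulr_ge0 ?exprn_ge0 ?harmonic_sum_ge0// ltW.
have kap0 : 0 < del / 10 by rewrite divr_gt0.
have fiber_le (y : 'I_4 * D.-tuple (option 'I_4) * bool) :
    #|[set q | (y, q) \in S]%SET|%:R * (del / 10) ^+ 3 <= (\sum_i C i) * H.
  case: y => [[i w] b]; set Q := [set q | _]%SET.
  apply: (@le_trans _ _ (C i * H)); last first.
    rewrite ler_wpM2r// (bigD1 i)//= lerDl sumr_ge0// => j _.
    by rewrite ltW.
  rewrite /H mulrA.
  have sf : (mpoly.msize (mderivs w P) <= D.+1)%N.
    by rewrite (leq_trans (msize_mderivs _ _))// sP.
  apply: (CP i (poly_env D (mderivs w P)) del n (del / 10) (-1) Q) => //.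
  - exact: ltW.
  - by move: nk; clear; lra.
  - by move=> z; apply: regular_zero_tangent sf; exact: swap_lastK.
  (* One direction speaks for all slopes of its cell: they differ from its own by at most
     [del / 10], within the tolerance [del / 8] of [chart_contact]. *)
  move=> q w' qQ w'q; move: qQ; rewrite inE => /Scell[v [v1 [vi vmax] _ vq [P0 [alpha slab]]]].
  have w'k (k : 'I_3) : -1 <= w' k <= 3.
    have /andP[lo hi] := w'q k; apply/andP; split.
      by apply: le_trans lo; rewrite lerDl mulr_ge0// ltW.
    apply: (le_trans hi); have : (q k).+1%:R * (del / 10) <= n%:R * (del / 10).
      by rewrite ler_pM2r// ler_nat.
    by move: nk; clear; lra.
  split.
    move=> j j3; have /andP[lo hi] := w'k (Ordinal j3).
    by rewrite ler_norml; move: lo hi => /=; clear; lra.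
  apply: (@chart_contact R D i P0 (fun i => v 0 i) (mderivs w P) del alpha len w') => //.
  - exact: ltW.
  - move=> j j3; have /andP[lo hi] := w'q (Ordinal j3); have /andP[lo' hi'] := vq (Ordinal j3).
    rewrite ler_norml; move: hi hi' lo lo' => /=; rewrite -natr1 mulrDl mul1r; clear => *.
    by apply/andP; split; lra.
rewrite card_fibers natr_sum mulr_suml.
apply: (@le_trans _ _ (\sum_(y : 'I_4 * D.-tuple (option 'I_4) * bool) (\sum_i C i) * H)).
  by apply: ler_sum => y _; exact: fiber_le.
by rewrite sumr_const -/N /H -[leLHS]mulr_natl !mulrA.
Qed.

End Cover.

Unset Implicit Arguments.
Local Open Scope classical_set_scope.
Local Open Scope ring_scope.

Theorem corollary1p2 (R : realType) (D : nat) (eps : R) (eps_gt0 : 0 < eps) :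
  exists2 C : R, 0 < C &
    forall (P : mpoly.mpoly 4 R) (delta : R),
      mpoly.msize P = D.+1 -> 0 < delta -> delta < 1 ->
      let Z := zero_set P `&` eball 0 1 in
      (covering_number delta (@Dir R @` Sigma delta Z)
         <= (C * delta `^ (- 2 - eps))%:E)%E.
Proof.
have [len len0 lenP] := Sigma_interval R D.
have [C C0 CP] := direction_cells_count D len0.
have [C' C'0 C'P] := harmonic_sum_cube eps_gt0.
(* The factor [10 ^+ 3] comes from dividing by [kap ^+ 3 = (del / 10) ^+ 3]. *)
exists (10 ^+ 3 * C * C'); first by rewrite mulr_gt0// mulr_gt0// exprn_gt0.
move=> P del sP d0 d1; cbv zeta.
pose kap := del / 10; have kap0 : 0 < kap by rewrite divr_gt0.
(* The index given by [grid_cell] may equal the truncation, hence the successor. *)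
pose n := (Num.truncn (2 / kap)).+1.
pose I : finType := ('I_4 * D.-tuple (option 'I_4) * bool * {ffun 'I_3 -> 'I_n})%type.
pose S : {set I} := [set x | `[< exists v, direction_cell len P del kap x v >]]%SET.
have cov : (covering_number del (@Dir R @` Sigma del (zero_set P `&` eball 0 1)) <= (#|S|%:R)%:E)%E.
  apply: (@covering_number_le R I S 4 del _ (@direction_cell R D len P del kap n)); last first.
    by move=> x v u; exact: direction_cell_diam.
  move=> _ [l [ll lS] <-].
  have [v1 _ _] := DirP ll; set v := Dir l in v1 *.
  have [i vi vmax] := enorm1_max_coord v1.
  have [w [P0 [alpha slab]]] := lenP P del l sP d0 (conj ll lS).
  have /choice[q qP] (k : 'I_3) : exists j : 'I_n, -1 + j%:R * kap <=
      v 0 (swap_last i (inord k)) / v 0 i <= -1 + j.+1%:R * kap.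
    have [|j jn jP] := @grid_cell R kap (v 0 (swap_last i (inord k)) / v 0 i) kap0.
      rewrite -ler_norml normrM normfV ler_pdivrMr ?mul1r//.
      by move: vi; lra.
    by exists (inord j); rewrite inordK.
  exists (i, w, 0 <= v 0 i, [ffun k => q k]).
    rewrite inE; apply/asboolP; exists v; split=> // [k|]; first by rewrite ffunE.
    by exists P0, alpha.
  by split=> // [k|]; [rewrite ffunE|exists P0, alpha].
apply: (le_trans cov).
rewrite lee_fin.
have n_le : n%:R * kap <= 2 + kap.
  have : (Num.truncn (2 / kap))%:R <= 2 / kap by rewrite truncn_le// divr_ge0// ltW.
  by rewrite ler_pdivlMr// /n -natr1 mulrDl mul1r; lra.
have := CP P del n S sP d0 d1; rewrite -/kap.
have d10 : kap <= 2 by rewrite /kap; lra.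
have SP x : x \in S -> exists v, direction_cell len P del kap x v.
  by rewrite inE => /asboolP.
move=> /(_ _ SP) count.
have {}count : #|S|%:R * kap ^+ 3 <= C * harmonic_sum R n ^+ 3 * del.
  by apply: count; lra.
have Hle : harmonic_sum R n ^+ 3 <= C' * del `^ (- eps).
  apply: C'P => //; rewrite ler_pdivlMr//.
  by move: n_le; rewrite /kap mulrA ler_pdivrMr//; lra.
have dE : del `^ (- 2 - eps) = (del ^+ 2)^-1 * del `^ (- eps).
  rewrite powRD; last by rewrite (gt_eqF d0) implybT.
  by congr (_ * _); exact: (powR_invn 2 (ltW d0)).
have k3 : 0 < kap ^+ 3 by rewrite exprn_gt0.
rewrite -(ler_pM2r k3); apply: (le_trans count).
rewrite dE (_ : _ * kap ^+ 3 = C * (C' * del `^ (- eps)) * del).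
  by rewrite ler_pM2r// ler_pM2l.
by rewrite /kap; field; rewrite gt_eqF.
Qed.
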